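(* Let $M,N$ be $kQ$-modules with $\dim_k\mathrm{Ext}^1_{k\widetilde Q}(M,N)=\dim_k\mathrm{Hom}_{k\widetilde Q}(N,\tau M)=1$. Let $$0\to N\to E\to M\to 0$$ be a non-split short exact sequence, and let $$0\to D_0\to N\xrightarrow{f}\tau M\to \tau A\oplus I\to 0$$ be the exact sequence given by a nonzero morphism $f$, where $I$ is an injective $k\widetilde Q$-module and $A$ has no projective direct summands. Write $M=M'\oplus P_0$ with $P_0$ a projective $k\widetilde Q$-module and $M'$ without projective direct summands, and put $A_0=A\oplus P_0$. Assume that $\mathrm{Hom}_{k\widetilde Q}(D_0,\tau A_0\oplus I)=\mathrm{Hom}_{k\widetilde Q}(A_0,I)=0$. Then $$X_NX_M=q^{\frac12\Lambda((\widetilde I-\widetilde R)\underline n,(\widetilde I-\widetilde R)\underline m)}X_E+q^{\frac12\Lambda((\widetilde I-\widetilde R)\underline n,(\widetilde I-\widetilde R)\underline m)+\frac12\langle M,N\rangle-\frac12\langle A_0,D_0\rangle}X_{D_0\oplus A_0\oplus I[-1]}.$$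
   Context: Setting. $k$ is a finite field, $q=|k|$, $m\ge n$ are positive integers, $\widetilde Q$ is an acyclic quiver with vertex set $\{1,\dots,m\}$ (vertices $n+1,\dots,m$ are frozen), and $Q$ is its full subquiver on $\{1,\dots,n\}$. All modules are finite-dimensional, $kQ$-modules are regarded as $k\widetilde Q$-modules, $S_i$ is the simple module at $i$; the module convention is that $\dim_k\mathrm{Ext}^1_{k\widetilde Q}(S_i,S_j)$ is the number of arrows $j\to i$. $\tau$ is the Auslander–Reiten translation of $k\widetilde Q$-modules (so $\tau$ kills projectives). Matrices (all $m\times n$): $\widetilde B=(b_{ij})$ with $b_{ij}=|\{\text{arrows } i\to j\}|-|\{\text{arrows } j\to i\}|$; $\widetilde R=(\widetilde r_{ij})$ with $\widetilde r_{ij}=\dim_k\mathrm{Ext}^1_{k\widetilde Q}(S_i,S_j)$; $\widetilde I=\begin{bmatrix}I_n\\0\end{bmatrix}$. Assume given a skew-symmetric integer $m\times m$ matrix $\Lambda$ with $\Lambda(-\widetilde B)=\widetilde I$, and write $\Lambda(x,y)=x^{tr}\Lambda y$ for $x,y\in\mathbb Z^m$. Quantum torus: $\mathcal T$ is the $\mathbb Z[q^{\pm1/2}]$-algebra (with $q=|k|$) with basis $\{X^e: e\in\mathbb Z^m\}$ and product $X^eX^f=q^{\Lambda(e,f)/2}X^{e+f}$. The Euler form is $\langle M,N\rangle=\dim_k\mathrm{Hom}_{k\widetilde Q}(M,N)-\dim_k\mathrm{Ext}^1_{k\widetilde Q}(M,N)$; it depends only on dimension vectors. Underlined small letters denote dimension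 vectors ($\underline m=\underline{\dim}M$, $\underline n=\underline{\dim}N$, etc.), regarded as columns in $\mathbb Z^n$ for $kQ$-modules. Quantum Caldero–Chapoton map: for a $kQ$-module $M$ and a projective $k\widetilde Q$-module $P$ (with $P[1]$ its shift), $$X_{M\oplus P[1]}=\sum_{\underline e}|\mathrm{Gr}_{\underline e}M|\,q^{-\frac12\langle\underline e,\underline m-\underline e\rangle}X^{\widetilde B\underline e-(\widetilde I-\widetilde R)\underline m+\underline{\dim}P/\mathrm{rad}P}\in\mathcal T,$$ where $\mathrm{Gr}_{\underline e}M$ is the set of submodules of $M$ of dimension vector $\underline e$. For an injective $k\widetilde Q$-module $I$, $I[-1]$ is identified with $P[1]$ where $P$ is the projective module with $P/\mathrm{rad}P\cong\mathrm{soc}\,I$; thus $X_{M\oplus I[-1]}:=X_{M\oplus P[1]}$. *)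

(* Defs.v *)
From HB Require Import structures.
From mathcomp Require Import all_boot all_order all_algebra all_field.
From mathcomp Require Import finmap boolp.
From mathcomp.multinomials Require Import monalg.
From mathcomp Require Import ring.
From mathcomp Require classical_sets.

Set Implicit Arguments.
Unset Strict Implicit.
Unset Printing Implicit Defensive.

Import Order.TTheory GRing.Theory Num.Theory.
Local Open Scope ring_scope.

Record quiver (m : nat) := Quiver {
  arrow : finType;
  src : arrow -> 'I_m;
  tgt : arrow -> 'I_m }.

Definition acyclic m (Q : quiver m) : Prop :=
  forall (a : arrow Q) (s : seq (arrow Q)),
    path (fun b c => tgt b == src c) a s -> tgt (last a s) != src a.

Definition narrows m (Q : quiver m) (i j : 'I_m) : nat :=
  #|[set a : arrow Q | (src a == i) && (tgt a == j)]|.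

Definition opq m (Q : quiver m) : quiver m := Quiver (@tgt m Q) (@src m Q).

(* A finite-dimensional module over the path algebra of Q, given by the action
   of its generators: the orthogonal idempotents e_i and the arrows.  The arrow
   a : s -> t acts as a map e_t M -> e_s M; this is the orientation for which
   dim Ext^1(S_i, S_j) is the number of arrows j -> i.  Products in the path
   algebra are thus concatenations of paths, and a = e_s a e_t. *)
Record qmod (k : fieldType) m (Q : quiver m) := QMod {
  carrier :> vectType k;
  vtx : 'I_m -> 'End(carrier);
  arw : arrow Q -> 'End(carrier);
  vtxM : forall i j, (vtx i \o vtx j)%VF = if i == j then vtx i else 0;
  vtx1 : \sum_i vtx i = \1%VF;
  arwE : forall a, (vtx (src a) \o arw a \o vtx (tgt a))%VF = arw a }.

Section LinFun.
Variables (k : fieldType) (U V : vectType k) (f : U -> V).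
Hypothesis lin : linear f.

Lemma linfunP x : linfun f x = f x.
Proof.
pose L := GRing.isLinear.Build _ _ _ _ _ lin.
pose F : {linear _ -> _} := HB.pack f L.
by rewrite -[linfun f]/(linfun F) lfunE.
Qed.
End LinFun.


Section Composition.
Variables (k : fieldType) (U V W : vectType k).

Definition precomp (f : 'Hom(U, V)) : 'Hom('Hom(V, W), 'Hom(U, W)) :=
  linfun (fun g : 'Hom(V, W) => (g \o f)%VF).

Definition postcomp (f : 'Hom(V, W)) : 'Hom('Hom(U, V), 'Hom(U, W)) :=
  linfun (fun g : 'Hom(U, V) => (f \o g)%VF).

Lemma precompE f g : precomp f g = (g \o f)%VF.
Proof. by rewrite linfunP // => c x y; rewrite comp_lfunDl comp_lfunZl. Qed.

Lemma postcompE f g : postcomp f g = (f \o g)%VF.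
Proof. by rewrite linfunP // => c x y; rewrite comp_lfunDr comp_lfunZr. Qed.

End Composition.

Arguments precomp {k U V} W f.
Arguments postcomp {k} U {V W} f.

Section Modules.
Variables (k : fieldType) (m : nat) (Q : quiver m).
Implicit Types M N P X Y : qmod k Q.

Definition homs M N : {vspace 'Hom(M, N)} :=
  ((\bigcap_(i < m) lker (precomp N (vtx M i) - postcomp M (vtx N i))) :&:
   (\bigcap_(a : arrow Q) lker (precomp N (arw M a) - postcomp M (arw N a))))%VS.

Lemma homsP M N (f : 'Hom(M, N)) :
  reflect ((forall i, f \o vtx M i = vtx N i \o f)%VF /\
           (forall a, f \o arw M a = arw N a \o f)%VF)
          (f \in homs M N).
Proof.
have comE (x : 'End(M)) (y : 'End(N)) :
    (f \in lker (precomp N x - postcomp M y)) = ((f \o x)%VF == (y \o f)%VF).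
  by rewrite memv_ker add_lfunE opp_lfunE precompE postcompE subr_eq0.
rewrite memv_cap.
apply: (iffP andP) => [[/subv_bigcapP h1 /subv_bigcapP h2]|[h1 h2]].
  by split=> [i|a]; apply/eqP; rewrite -comE; [exact: h1 | exact: h2].
by split; apply/subv_bigcapP => i _; rewrite -memvE comE; apply/eqP.
Qed.

Definition qiso M N : Prop :=
  exists f, [/\ f \in homs M N, lker f == 0%VS & limg f == fullv].

Definition exact_at (U V W : vectType k) (f : 'Hom(U, V)) (g : 'Hom(V, W)) :=
  limg f == lker g.

Definition short_exact (N E M : qmod k Q) (i : 'Hom(N, E)) (p : 'Hom(E, M)) : Prop :=
  [/\ i \in homs N E, p \in homs E M, lker i == 0%VS, exact_at i p
    & limg p == fullv].

Definition split_epi (E M : qmod k Q) (p : 'Hom(E, M)) : Prop :=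
  exists2 s, s \in homs M E & (p \o s)%VF = \1%VF.

Definition projective P : Prop :=
  forall X Y (g : 'Hom(X, Y)) (h : 'Hom(P, Y)),
    g \in homs X Y -> limg g = fullv -> h \in homs P Y ->
    exists2 h', h' \in homs P X & (g \o h')%VF = h.

Definition injective_mod (I : qmod k Q) : Prop :=
  forall X Y (g : 'Hom(X, Y)) (h : 'Hom(X, I)),
    g \in homs X Y -> lker g = 0%VS -> h \in homs X I ->
    exists2 h', h' \in homs Y I & (h' \o g)%VF = h.

Definition submod M (U : {vspace M}) : bool :=
  [forall i, (vtx M i @: U <= U)%VS] && [forall a, (arw M a @: U <= U)%VS].

Definition superfluous M (K : {vspace M}) : Prop :=
  forall U : {vspace M}, submod U -> (U + K)%VS = fullv -> U = fullv.

End Modules.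

Section DirectSum.
Variables (k : fieldType) (m : nat) (Q : quiver m) (M N : qmod k Q).

Definition pair_lfun (f : 'End(M)) (g : 'End(N)) : 'End((M * N)%type) :=
  linfun (fun x : (M * N)%type => (f x.1, g x.2)).

Lemma pair_lfunE f g x : pair_lfun f g x = (f x.1, g x.2).
Proof.
by rewrite linfunP // => c u v; rewrite !linearP.
Qed.

Lemma dsum_vtxM i j :
  (pair_lfun (vtx M i) (vtx N i) \o pair_lfun (vtx M j) (vtx N j))%VF
  = if i == j then pair_lfun (vtx M i) (vtx N i) else 0.
Proof.
apply/lfunP => x; rewrite comp_lfunE !pair_lfunE /= -!comp_lfunE !vtxM.
by case: eqP => _; rewrite ?pair_lfunE // !lfunE.
Qed.

Lemma dsum_vtx1 : \sum_i pair_lfun (vtx M i) (vtx N i) = \1%VF.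
Proof.
apply/lfunP => x; rewrite sum_lfunE lfunE /=.
under eq_bigr do rewrite pair_lfunE.
rewrite [LHS]surjective_pairing !raddf_sum /= -!sum_lfunE !vtx1 !lfunE /=.
by case: x.
Qed.

Lemma dsum_arwE a :
  (pair_lfun (vtx M (src a)) (vtx N (src a)) \o pair_lfun (arw M a) (arw N a)
   \o pair_lfun (vtx M (tgt a)) (vtx N (tgt a)))%VF
  = pair_lfun (arw M a) (arw N a).
Proof.
apply/lfunP => x; rewrite !comp_lfunE !pair_lfunE /=.
by rewrite -2![X in (X, _)]comp_lfunE -2![X in (_, X)]comp_lfunE !arwE.
Qed.

Definition dsum : qmod k Q := QMod dsum_vtxM dsum_vtx1 dsum_arwE.

End DirectSum.

Definition no_projective_summand (k : fieldType) m (Q : quiver m)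
    (M : qmod k Q) : Prop :=
  forall X Y : qmod k Q, projective X -> qiso M (dsum X Y) -> \dim {:X} = 0%N.

Section Zero.
Variables (k : fieldType) (m : nat) (Q : quiver m).

Local Notation zero_end := (0 : 'End('rV[k]_0)).

Lemma zero_vtxM (i j : 'I_m) :
  (zero_end \o zero_end)%VF = if i == j then zero_end else 0.
Proof. by rewrite comp_lfun0r if_same. Qed.

Lemma zero_vtx1 : \sum_(i < m) zero_end = \1%VF.
Proof. by apply/lfunP => x; rewrite [LHS]thinmx0 [RHS]thinmx0. Qed.

Lemma zero_arwE (a : arrow Q) : (zero_end \o zero_end \o zero_end)%VF = zero_end.
Proof. by rewrite !comp_lfun0r. Qed.

Definition zero_mod : qmod k Q :=
  @QMod k m Q _ (fun=> 0) (fun=> 0) zero_vtxM zero_vtx1 zero_arwE.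

End Zero.

Section Simple.
Variables (k : fieldType) (m : nat) (Q : quiver m) (i : 'I_m).

Definition simple_vtx (j : 'I_m) : 'End(k^o) := if j == i then \1%VF else 0.

Lemma simple_vtxM j l :
  (simple_vtx j \o simple_vtx l)%VF = if j == l then simple_vtx j else 0.
Proof.
rewrite /simple_vtx; have [->|nji] := eqVneq j i.
  by rewrite comp_lfun1l eq_sym.
by rewrite comp_lfun0l if_same.
Qed.

Lemma simple_vtx1 : \sum_j simple_vtx j = \1%VF.
Proof.
rewrite (bigD1 i) //= {1}/simple_vtx eqxx big1 ?addr0 // => j.
by rewrite /simple_vtx => /negPf ->.
Qed.

Lemma simple_arwE (a : arrow Q) :
  (simple_vtx (src a) \o 0 \o simple_vtx (tgt a))%VF = 0.
Proof. by rewrite comp_lfun0r comp_lfun0l. Qed.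

Definition simple_mod : qmod k Q := QMod simple_vtxM simple_vtx1 simple_arwE.

End Simple.

Arguments simple_mod k {m} Q i.

(* Vector-space duality, from modules over the opposite quiver *)
Section Dual.
Variables (k : fieldType) (m : nat) (Q : quiver m) (M : qmod k (opq Q)).

Lemma precomp_comp (f g : 'End(M)) :
  (precomp k^o f \o precomp k^o g)%VF = precomp k^o (g \o f)%VF.
Proof. by apply/lfunP => h; rewrite comp_lfunE !precompE comp_lfunA. Qed.

Lemma dual_vtxM i j :
  (precomp k^o (vtx M i) \o precomp k^o (vtx M j))%VF
  = if i == j then precomp k^o (vtx M i) else 0.
Proof.
rewrite precomp_comp vtxM eq_sym; case: eqP => [-> //|_].
by apply/lfunP => h; rewrite precompE comp_lfun0r lfunE.
Qed.

Lemma dual_vtx1 : \sum_i precomp k^o (vtx M i) = \1%VF.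
Proof.
apply/lfunP => h; rewrite sum_lfunE lfunE /=.
under eq_bigr do rewrite precompE.
apply/lfunP => x; rewrite sum_lfunE.
under eq_bigr do rewrite comp_lfunE.
by rewrite -linear_sum -sum_lfunE vtx1 lfunE.
Qed.

Lemma dual_arwE (a : arrow Q) :
  (precomp k^o (vtx M (src a)) \o precomp k^o (arw M a)
   \o precomp k^o (vtx M (tgt a)))%VF = precomp k^o (arw M a).
Proof. by rewrite !precomp_comp -[in RHS](@arwE k m (opq Q) M a) comp_lfunA. Qed.

Definition qdual : qmod k Q := @QMod k m Q _ _ _ dual_vtxM dual_vtx1 dual_arwE.

End Dual.

(* The path algebra as a left module over itself, with its right
   multiplications.  A path is a starting vertex and a composable sequence of
   arrows; the bound m on the length excludes no path when Q is acyclic. *)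
Section PathAlgebra.
Variables (k : fieldType) (m : nat) (Q : quiver m).

Fixpoint walk (i : 'I_m) (s : seq (arrow Q)) : bool :=
  if s is a :: s' then (src a == i) && walk (tgt a) s' else true.

Definition qpath := {p : 'I_m * m.-bseq (arrow Q) | walk p.1 p.2}.

Definition pstart (p : qpath) : 'I_m := (val p).1.
Definition parrows (p : qpath) : seq (arrow Q) := (val p).2.
Definition pend (p : qpath) : 'I_m := last (pstart p) (map (@tgt m Q) (parrows p)).

Definition path_space : vectType k := {ffun qpath -> k^o}.

Definition lmul_vtx (i : 'I_m) : 'End(path_space) :=
  linfun (fun f : path_space =>
    [ffun p => if pstart p == i then f p else 0] : path_space).

Definition lmul_arw (a : arrow Q) : 'End(path_space) :=
  linfun (fun f : path_space =>
    [ffun p => \sum_(r | (pstart r == tgt a) && (parrows p == a :: parrows r)) f r]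
    : path_space).

Definition rmul_vtx (i : 'I_m) : 'End(path_space) :=
  linfun (fun f : path_space =>
    [ffun p => if pend p == i then f p else 0] : path_space).

Definition rmul_arw (a : arrow Q) : 'End(path_space) :=
  linfun (fun f : path_space =>
    [ffun p => \sum_(r | (pstart r == pstart p)
                         && (parrows p == rcons (parrows r) a)) f r]
    : path_space).

Lemma lmul_vtxE i f p : lmul_vtx i f p = if pstart p == i then f p else 0.
Proof.
rewrite linfunP ?ffunE // => c u v; apply/ffunP => r; rewrite !ffunE.
by case: eqP => _ //; rewrite scaler0 addr0.
Qed.

Lemma lmul_arwE a f p : lmul_arw a f p =
  \sum_(r | (pstart r == tgt a) && (parrows p == a :: parrows r)) f r.
Proof.
rewrite linfunP ?ffunE // => c u v; apply/ffunP => r; rewrite !ffunE.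
rewrite scaler_sumr -big_split /=.
by apply: eq_bigr => s _; rewrite !ffunE.
Qed.

Lemma rmul_vtxE i f p : rmul_vtx i f p = if pend p == i then f p else 0.
Proof.
rewrite linfunP ?ffunE // => c u v; apply/ffunP => r; rewrite !ffunE.
by case: eqP => _ //; rewrite scaler0 addr0.
Qed.

Lemma rmul_arwE a f p : rmul_arw a f p =
  \sum_(r | (pstart r == pstart p) && (parrows p == rcons (parrows r) a)) f r.
Proof.
rewrite linfunP ?ffunE // => c u v; apply/ffunP => r; rewrite !ffunE.
rewrite scaler_sumr -big_split /=.
by apply: eq_bigr => s _; rewrite !ffunE.
Qed.

Lemma lmul_vtxM i j :
  (lmul_vtx i \o lmul_vtx j)%VF = if i == j then lmul_vtx i else 0.
Proof.
apply/lfunP => f; apply/ffunP => p; rewrite comp_lfunE !lmul_vtxE.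
case: (eqVneq i j) => [<-|nij]; first by rewrite lmul_vtxE; case: eqP.
rewrite lfunE /= ffunE; case: eqP => // ->.
by rewrite (negPf nij).
Qed.

Lemma lmul_vtx1 : \sum_i lmul_vtx i = \1%VF.
Proof.
apply/lfunP => f; apply/ffunP => p; rewrite sum_lfunE lfunE /= sum_ffunE.
under eq_bigr do rewrite lmul_vtxE.
by rewrite -big_mkcond /= (big_pred1 (pstart p)) // => i; rewrite eq_sym.
Qed.

Lemma lmul_vtx_arw a :
  (lmul_vtx (src a) \o lmul_arw a \o lmul_vtx (tgt a))%VF = lmul_arw a.
Proof.
apply/lfunP => f; apply/ffunP => p; rewrite !comp_lfunE lmul_vtxE !lmul_arwE.
have -> : \sum_(r | (pstart r == tgt a) && (parrows p == a :: parrows r))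
            lmul_vtx (tgt a) f r
  = \sum_(r | (pstart r == tgt a) && (parrows p == a :: parrows r)) f r.
  by apply: eq_bigr => r /andP[/eqP e _]; rewrite lmul_vtxE e eqxx.
case: (eqVneq (pstart p) (src a)) => // np; rewrite big1 // => r.
case/andP=> _ /eqP ep; case/eqP: np.
have := valP p; rewrite -/(parrows p) -/(pstart p) ep /=.
by case/andP=> /eqP.
Qed.

Definition regular_mod : qmod k Q := QMod lmul_vtxM lmul_vtx1 lmul_vtx_arw.

End PathAlgebra.

(* Auslander-Reiten translation: tau M = D Tr M, where Tr M is the right module
   cokernel of Hom(P_0, A) -> Hom(P_1, A) for a minimal projective presentation
   P_1 -> P_0 -> M -> 0.  Right modules are modules over the opposite quiver. *)
Section Translation.
Variables (k : fieldType) (m : nat) (Q : quiver m).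
Local Notation A := (regular_mod k Q).

Definition minimal_presentation (P1 P0 M : qmod k Q)
    (p : 'Hom(P1, P0)) (r : 'Hom(P0, M)) : Prop :=
  [/\ projective P1 /\ projective P0,
      p \in homs P1 P0 /\ r \in homs P0 M,
      exact_at p r, limg r == fullv
    & superfluous (lker p) /\ superfluous (lker r)].

Definition is_transpose (M : qmod k Q) (T : qmod k (opq Q)) : Prop :=
  exists (P1 P0 : qmod k Q) (p : 'Hom(P1, P0)) (r : 'Hom(P0, M))
         (c : 'Hom('Hom(P1, A), T)),
    [/\ minimal_presentation p r,
        (c @: homs P1 A)%VS = fullv,
        (lker c :&: homs P1 A)%VS = (precomp A p @: homs P0 A)%VS,
        forall i h, h \in homs P1 A -> vtx T i (c h) = c (rmul_vtx k Q i \o h)%VF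
      & forall (a : arrow Q) h, h \in homs P1 A ->
          @arw k m (opq Q) T a (c h) = c (rmul_arw k a \o h)%VF].

Definition is_tau (M T : qmod k Q) : Prop :=
  exists2 Tr : qmod k (opq Q), is_transpose M Tr & qiso T (qdual Tr).

End Translation.

Section Ext.
Variables (k : fieldType) (m : nat) (Q : quiver m).
Implicit Types M N : qmod k Q.

(* Ext^1(M, N) is the cokernel of Hom(P, N) -> Hom(K, N), for any short exact
   sequence 0 -> K -> P -> M -> 0 with P projective. *)
Definition is_dim_ext1 M N (d : nat) : Prop :=
  exists (K P : qmod k Q) (i : 'Hom(K, P)) (p : 'Hom(P, M)),
    [/\ projective P, short_exact i p
      & d = (\dim (homs K N) - \dim (precomp N i @: homs P N))%N].

Definition dim_ext1 M N : nat := classical_sets.xget 0%N (is_dim_ext1 M N).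

Definition euler M N : int := (\dim (homs M N))%:Z - (dim_ext1 M N)%:Z.

Definition euler_vec (x y : 'cV[int]_m) : int :=
  \sum_i \sum_j x i 0 * y j 0 * euler (simple_mod k Q i) (simple_mod k Q j).

Definition sub_dimvec M (U : {vspace M}) : 'cV[int]_m :=
  \col_i (\dim (vtx M i @: U))%:Z.

Definition dimvec M : 'cV[int]_m := sub_dimvec (fullv : {vspace M}).

End Ext.

Section FiniteVspace.
Import VectorInternalTheory.
Variables (k : finFieldType) (V : vectType k).
HB.instance Definition _ := [Countable of {vspace V} by <:].
HB.instance Definition _ := [Finite of {vspace V} by <:].
End FiniteVspace.

Section FiniteField.
Variables (k : finFieldType) (m : nat) (Q : quiver m).
Implicit Types M P I : qmod k Q.

Definition Gr M (e : 'cV[int]_m) : {set {vspace M}} :=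
  [set U | submod U & sub_dimvec U == e].

Definition maximal_submod M (U : {vspace M}) : bool :=
  [&& submod U, U != fullv
    & [forall W : {vspace M}, submod W && (U <= W)%VS ==> (W == U) || (W == fullv)]].

Definition simple_submod M (U : {vspace M}) : bool :=
  [&& submod U, U != 0%VS
    & [forall W : {vspace M}, submod W && (W <= U)%VS ==> (W == U) || (W == 0%VS)]].

Definition rad M : {vspace M} :=
  (\bigcap_(U : {vspace M} | maximal_submod U) U)%VS.

Definition soc M : {vspace M} :=
  (\sum_(U : {vspace M} | simple_submod U) U)%VS.

Definition top_dimvec P : 'cV[int]_m := dimvec P - sub_dimvec (rad P).

(* P / rad P is isomorphic to soc I *)
Definition top_iso_soc P I : Prop :=
  exists f, [/\ f \in homs P I, lker f = rad P & limg f = soc I].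

End FiniteField.

(* The coefficient ring Z[q^(1/2), q^(-1/2)], q = #|k|, inside algC *)
Section Coefficients.
Variable k : finFieldType.

Definition sqrtq : algC := sqrtC (#|k|)%:R.

Definition Zq_pred : {pred algC} := fun x =>
  `[< exists s : seq (int * int), x = \sum_(t <- s) t.1%:~R * sqrtq ^ t.2 >].

Lemma sqrtq_neq0 : sqrtq != 0.
Proof. by rewrite sqrtC_eq0 pnatr_eq0 -lt0n; apply/card_gt0P; exists 0. Qed.

Lemma sqrtq_exp_in z : sqrtq ^ z \in Zq_pred.
Proof. by apply/asboolP; exists [:: (1, z)]; rewrite big_seq1 mul1r. Qed.

Lemma Zq_pred_subring : subring_closed Zq_pred.
Proof.
split; first by rewrite -(expr0z sqrtq) sqrtq_exp_in.
  move=> x y /asboolP[s ->] /asboolP[t ->]; apply/asboolP.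
  exists (s ++ [seq (- u.1, u.2) | u <- t]); rewrite big_cat big_map -sumrN /=.
  by congr (_ + _); apply: eq_bigr => u _; rewrite rmorphN mulNr.
move=> x y /asboolP[s ->] /asboolP[t ->]; apply/asboolP.
exists [seq (u.1 * v.1, u.2 + v.2) | u <- s, v <- t].
rewrite big_allpairs_dep mulr_suml; apply: eq_bigr => u _.
rewrite mulr_sumr; apply: eq_bigr => v _ /=.
by rewrite expfzDr ?sqrtq_neq0 // rmorphM mulrACA.
Qed.

HB.instance Definition _ := GRing.isSubringClosed.Build algC Zq_pred
  Zq_pred_subring.

Record Zq := MkZq { Zq_val : algC; _ : Zq_val \in Zq_pred }.

HB.instance Definition _ := [isSub for Zq_val].
HB.instance Definition _ := [Choice of Zq by <:].
HB.instance Definition _ := [SubChoice_isSubComNzRing of Zq by <:].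

Definition qhalf (z : int) : Zq := MkZq (sqrtq_exp_in z).

Lemma qhalfD x y : qhalf (x + y) = qhalf x * qhalf y.
Proof. by apply: val_inj; rewrite /= expfzDr ?sqrtq_neq0. Qed.

Lemma qhalf0 : qhalf 0 = 1. Proof. exact: val_inj. Qed.

End Coefficients.

Lemma biadditive_assoc (V : nmodType) (I : Type) (mul : V -> V -> V)
    (mulDl : left_distributive mul +%R) (mulDr : right_distributive mul +%R)
    (mul0l : left_zero 0 mul) (mul0r : right_zero 0 mul)
    (r s t : seq I) (u v w : I -> V) :
  (forall e f g, mul (u e) (mul (v f) (w g)) = mul (mul (u e) (v f)) (w g)) ->
  let x := \sum_(e <- r) u e in let y := \sum_(f <- s) v f in
  let z := \sum_(g <- t) w g in mul x (mul y z) = mul (mul x y) z.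
Proof.
move=> assoc /=.
have suml q (F : I -> V) b : mul (\sum_(i <- q) F i) b = \sum_(i <- q) mul (F i) b.
  by apply: (big_morph (mul^~ b)) => // c d; exact: mulDl.
have sumr q (F : I -> V) b : mul b (\sum_(i <- q) F i) = \sum_(i <- q) mul b (F i).
  by apply: (big_morph (mul b)) => // c d; exact: mulDr.
rewrite !(suml r); apply: eq_bigr => e _.
rewrite (suml s) !(sumr s) (suml s); apply: eq_bigr => f _.
by rewrite !(sumr t); apply: eq_bigr => g _; exact: assoc.
Qed.

(* The product X^e X^f = q^(form e f / 2) X^(e + f), extended bilinearly to the
   free Zq-module on the basis X^e, e in G. *)
Section TwistedProduct.
Variables (k : finFieldType) (G : zmodType) (form : G -> G -> int).
Hypothesis formDl : forall e1 e2 f, form (e1 + e2) f = form e1 f + form e2 f.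
Hypothesis formDr : forall e f1 f2, form e (f1 + f2) = form e f1 + form e f2.
Local Notation T := {malg (Zq k)[G]}.
Implicit Types (x y z : T) (e f g : G).

Definition Xpow e : T := (<< 1 *g e >>)%R.

Definition tw_mul x y : T :=
  \sum_(e <- msupp x) \sum_(f <- msupp y)
    (x@_e * y@_f * qhalf k (form e f)) *: Xpow (e + f).

Lemma tw_mulE (d1 d2 : {fset G}) x y :
  (msupp x `<=` d1)%fset -> (msupp y `<=` d2)%fset ->
  tw_mul x y = \sum_(e <- d1) \sum_(f <- d2)
    (x@_e * y@_f * qhalf k (form e f)) *: Xpow (e + f).
Proof.
move=> le1 le2; rewrite /tw_mul (big_fset_incl _ le1) /=.
  apply/eq_bigr=> e _; apply/big_fset_incl => // f _ /mcoeff_outdom ->.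
  by rewrite mulr0 mul0r scale0r.
move=> e _ /mcoeff_outdom xe.
by rewrite big1 // => f _; rewrite xe !mul0r scale0r.
Qed.

Lemma tw_mulDl : left_distributive tw_mul +%R.
Proof.
move=> x y z.
rewrite (tw_mulE (msuppD_le x y) (fsubset_refl _)).
rewrite (tw_mulE (fsubsetUl (msupp x) (msupp y)) (fsubset_refl _)).
rewrite (tw_mulE (fsubsetUr (msupp x) (msupp y)) (fsubset_refl _)).
rewrite -big_split /=; apply/eq_bigr=> e _.
rewrite -big_split /=; apply/eq_bigr=> f _.
by rewrite mcoeffD !mulrDl scalerDl.
Qed.

Lemma tw_mulDr : right_distributive tw_mul +%R.
Proof.
move=> z x y; rewrite (tw_mulE (fsubset_refl _) (msuppD_le x y)).
rewrite (tw_mulE (fsubset_refl _) (fsubsetUl (msupp x) (msupp y))).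
rewrite (tw_mulE (fsubset_refl _) (fsubsetUr (msupp x) (msupp y))).
rewrite -big_split /=; apply/eq_bigr=> e _.
rewrite -big_split /=; apply/eq_bigr=> f _.
by rewrite mcoeffD mulrDr mulrDl scalerDl.
Qed.

Lemma tw_mulZl c x y : tw_mul (c *: x) y = c *: tw_mul x y.
Proof.
rewrite (tw_mulE (msuppZ_le c x) (fsubset_refl _)) scaler_sumr.
apply: eq_bigr => e _; rewrite scaler_sumr; apply: eq_bigr => f _.
by rewrite mcoeffZ scalerA !mulrA.
Qed.

Lemma tw_mulZr c x y : tw_mul x (c *: y) = c *: tw_mul x y.
Proof.
rewrite (tw_mulE (fsubset_refl _) (msuppZ_le c y)) scaler_sumr.
apply: eq_bigr => e _; rewrite scaler_sumr; apply: eq_bigr => f _.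
by rewrite mcoeffZ scalerA !mulrA [x@_e * c]mulrC.
Qed.

Lemma tw_mulXX e f :
  tw_mul (Xpow e) (Xpow f) = qhalf k (form e f) *: Xpow (e + f).
Proof.
rewrite (tw_mulE msuppU_le msuppU_le) !big_seq_fset1 /Xpow !mcoeffUU.
by rewrite !mul1r.
Qed.

Lemma tw_mulZXX a b e f :
  tw_mul (a *: Xpow e) (b *: Xpow f) = (a * b * qhalf k (form e f)) *: Xpow (e + f).
Proof. by rewrite tw_mulZl tw_mulZr tw_mulXX scalerA scalerA. Qed.

Lemma Xpow_expand x : x = \sum_(e <- msupp x) x@_e *: Xpow e.
Proof.
rewrite {1}[x]monalgE; apply: eq_bigr => e _.
by apply/malgP => f; rewrite mcoeffZ !mcoeffU mulrnAr mulr1.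
Qed.

Lemma tw_mul0l : left_zero 0 tw_mul.
Proof. by move=> x; have := tw_mulZl 0 0 x; rewrite !scale0r. Qed.

Lemma tw_mul0r : right_zero 0 tw_mul.
Proof. by move=> x; have := tw_mulZr 0 x 0; rewrite !scale0r. Qed.

Lemma tw_mulAXX a b c e f g :
  tw_mul (a *: Xpow e) (tw_mul (b *: Xpow f) (c *: Xpow g))
  = tw_mul (tw_mul (a *: Xpow e) (b *: Xpow f)) (c *: Xpow g).
Proof.
apply: (etrans (congr1 (tw_mul _) (tw_mulZXX b c f g))).
apply: (etrans (tw_mulZXX a _ e (f + g))); apply: esym.
apply: (etrans (congr1 (tw_mul^~ _) (tw_mulZXX a b e f))).
apply: (etrans (tw_mulZXX _ c (e + f) g)); rewrite addrA formDl formDr.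
by rewrite (qhalfD k (form e f)) (qhalfD k (form e g)); congr (_ *: _); ring.
Qed.

Lemma tw_mulA : associative tw_mul.
Proof.
move=> x y z; rewrite [x]Xpow_expand [y]Xpow_expand [z]Xpow_expand.
apply: (biadditive_assoc tw_mulDl tw_mulDr tw_mul0l tw_mul0r) => e f g.
exact: tw_mulAXX.
Qed.

Lemma tw_mul1l : left_id (Xpow 0) tw_mul.
Proof.
move=> x; rewrite [x in LHS]Xpow_expand (big_morph _ (tw_mulDr _) (tw_mul0r _)).
rewrite [RHS]Xpow_expand; apply: eq_bigr => e _; rewrite tw_mulZr tw_mulXX add0r.
have -> : form 0 e = 0 by apply: (addrI (form 0 e)); rewrite -formDl !addr0.
by rewrite qhalf0 scale1r.
Qed.

Lemma tw_mul1r : right_id (Xpow 0) tw_mul.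
Proof.
move=> x; rewrite [x in LHS]Xpow_expand.
rewrite (big_morph (tw_mul^~ _) (fun u v => tw_mulDl u v _) (tw_mul0l _)).
rewrite [RHS]Xpow_expand; apply: eq_bigr => e _; rewrite tw_mulZl tw_mulXX addr0.
have -> : form e 0 = 0 by apply: (addrI (form e 0)); rewrite -formDr !addr0.
by rewrite qhalf0 scale1r.
Qed.

Lemma Xpow0_neq0 : Xpow 0 != 0.
Proof. by apply/eqP/malgP=> /(_ 0) /eqP; rewrite mcoeffUU mcoeff0 oner_eq0. Qed.

End TwistedProduct.

(* The alias records Lambda, on which the product depends. *)
Definition qtorus (k : finFieldType) m (Lam : 'M[int]_m) : Type :=
  {malg (Zq k)['cV[int]_m]}.

Section QuantumTorus.
Variables (k : finFieldType) (m : nat) (Lam : 'M[int]_m).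

Definition qform (x y : 'cV[int]_m) : int := (x^T *m Lam *m y) 0 0.

Lemma qformDl e1 e2 f : qform (e1 + e2) f = qform e1 f + qform e2 f.
Proof. by rewrite /qform linearD !mulmxDl mxE. Qed.

Lemma qformDr e f1 f2 : qform e (f1 + f2) = qform e f1 + qform e f2.
Proof. by rewrite /qform mulmxDr mxE. Qed.

Local Notation T := (qtorus k Lam).

HB.instance Definition _ := GRing.Lmodule.on T.
HB.instance Definition _ := GRing.Zmodule_isNzRing.Build T
  (tw_mulA qformDl qformDr)
  (tw_mul1l qformDl) (tw_mul1r qformDr)
  (@tw_mulDl k _ qform) (@tw_mulDr k _ qform) (@Xpow0_neq0 k _).
HB.instance Definition _ := GRing.Lmodule_isLalgebra.Build (Zq k) T
  (fun c x y => esym (tw_mulZl qform c x y)).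
HB.instance Definition _ := GRing.Lalgebra_isAlgebra.Build (Zq k) T
  (fun c x y => esym (tw_mulZr qform c x y)).

Lemma qtorus_mulXX e f :
  (Xpow k e : T) * Xpow k f = qhalf k (qform e f) *: (Xpow k (e + f) : T).
Proof. exact: tw_mulXX. Qed.

End QuantumTorus.

Section CalderoChapoton.
Variables (k : finFieldType) (m n : nat) (le_nm : (n <= m)%N) (Q : quiver m).
Variable Lam : 'M[int]_m.
Implicit Types M P : qmod k Q.

Definition Bmx : 'M[int]_(m, n) :=
  \matrix_(i, j) ((narrows Q i (widen_ord le_nm j))%:Z
                  - (narrows Q (widen_ord le_nm j) i)%:Z).

Definition Rmx : 'M[int]_(m, n) :=
  \matrix_(i, j) (dim_ext1 (simple_mod k Q i)
                           (simple_mod k Q (widen_ord le_nm j)))%:Z.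

Definition Imx : 'M[int]_(m, n) := pid_mx n.

(* Modules over the full subquiver on the first n vertices, regarded as modules
   over Q, are the modules vanishing at the other vertices. *)
Definition unfrozen M : Prop := forall i : 'I_m, (n <= i)%N -> vtx M i = 0.

Definition udimvec M : 'cV[int]_n :=
  \col_j dimvec M (widen_ord le_nm j) 0.

(* X_{M + P[1]} for M unfrozen and P projective.  The sum ranges over all e that
   can be the dimension vector of a submodule of M. *)
Definition CCshift M P : qtorus k Lam :=
  \sum_(e : {ffun 'I_n -> 'I_(\dim {:M}).+1})
    let ev : 'cV[int]_n := \col_j (e j)%:Z in
    ((#|Gr M (Imx *m ev)|)%:R
     * qhalf k (- euler_vec k Q (Imx *m ev) (Imx *m (udimvec M - ev))))
    *: (Xpow k (Bmx *m ev - (Imx - Rmx) *m udimvec M + top_dimvec P) : qtorus k Lam).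

Definition CC M : qtorus k Lam := CCshift M (zero_mod k Q).

End CalderoChapoton.

(* Main.v *)
(** Let D Ext^1(X, Y) be realised, via traces, as the space of families of maps
    g_a : Y_s(a) -> X_t(a), one for each arrow a, with sum_a X_a g_a = sum_a g_a Y_a.
    A subobject of X or a quotient of Y visibly gives a subspace, and tau X
    represents the functor Y |-> D Ext^1(X, Y).

    Sending a submodule W of E to the pair (U, V) of its intersection with N and
    its image in M, the fibre over (U, V) is empty or a torsor under Hom(V, N/U).
    As D Ext^1(M, N) is spanned by one family g, the fibre is empty exactly when g
    kills U and has its image in V, and then Ext^1(V, N/U) has dimension 1.
    Expanding X_N X_M as a sum over pairs (U, V), the pairs with nonempty fibre
    add up to the X_E term.  The other pairs are those with U inside D0 and V
    containing the kernel of a surjection M -> A0: if g corresponds to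
    f : N -> tau M, this surjection is induced by tau M -> tau A, which comes from
    a homomorphism M' -> A because tau is fully faithful on modules without
    projective summands.  These pairs correspond to pairs of submodules of D0 and
    A0, and the vanishing of Hom(D0, tau A0 + I) and Hom(A0, I) makes the powers
    of q agree. *)
From HB Require Import structures.
Require Import Defs.
From mathcomp Require Import all_boot all_order all_algebra all_field.
From mathcomp Require Import ring zify.
From mathcomp Require classical_sets.

Set Implicit Arguments.
Unset Strict Implicit.
Unset Printing Implicit Defensive.

Import GRing.Theory.
Local Open Scope ring_scope.

(** The obstacle is to match powers of q. The identity [Lambda (-B) = I] turns the values of
    [Lambda] in the product into Euler forms, apart from one constant common to all pairs. The
    remaining twist at (U, V) is q^<V, N/U>, and this is the size of the fibre over (U, V) as soon
    as Ext^1(V, N/U) = 0. So pairs with nonempty fibre agree with X_E term by term.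

    For the other pairs the key is the Coxeter relation <y, tau X> = -<X, y>, valid for X without
    projective summands. Applied to M' and A, it ties dim N - dim D0 to dim M - dim A0. It also
    gives full faithfulness of tau: maps X -> Z embed in D Ext^1(Z, tau X), and the relation makes
    the dimensions equal.

    The vanishing hypotheses enter in two ways. Hom(D0, tau A0) = 0 means Ext^1(A0, D0) = 0, so
    every pair of submodules of D0 and A0 has a fibre of known size in the direct sum. Hom(D0, I) =
    Hom(A0, I) = 0 passes to submodules because I is injective, and kills the Euler forms <U, I> and
    <V, I>. *)

Definition lfE := (comp_lfunE, add_lfunE, opp_lfunE, scale_lfunE, zero_lfunE,
  id_lfunE, sum_lfunE).

(** * Linear algebra *)

Section Trace.
Import VectorInternalTheory.
Variable k : fieldType.
Implicit Types U V W : vectType k.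

Definition ltrace V (f : 'End(V)) : k := \tr (f2mx f).

Lemma v2r_lfun U V (f : 'Hom(U, V)) x : v2r (f x) = v2r x *m f2mx f.
Proof. by rewrite unlock /= r2vK. Qed.

Lemma f2mx_comp U V W (g : 'Hom(V, W)) (f : 'Hom(U, V)) :
  f2mx (g \o f)%VF = f2mx f *m f2mx g.
Proof.
apply/row_matrixP=> i; rewrite !rowE mulmxA -[delta_mx 0 i]r2vK.
by rewrite -!v2r_lfun comp_lfunE.
Qed.

Lemma ltraceC U V (f : 'Hom(U, V)) (g : 'Hom(V, U)) :
  ltrace (f \o g)%VF = ltrace (g \o f)%VF.
Proof. by rewrite /ltrace !f2mx_comp mxtrace_mulC. Qed.

Lemma f2mx_lin U V (a : k) (f g : 'Hom(U, V)) :
  f2mx (a *: f + g) = a *: f2mx f + f2mx g.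
Proof.
apply/row_matrixP=> i; rewrite !rowE -[delta_mx 0 i]r2vK mulmxDr -scalemxAr.
by rewrite -!v2r_lfun -linearP !lfE.
Qed.

Lemma ltrace_is_scalar V : scalar (@ltrace V).
Proof. by move=> a f g; rewrite /ltrace f2mx_lin linearP. Qed.

HB.instance Definition _ V :=
  GRing.isLinear.Build k 'End(V) k _ (@ltrace V) (@ltrace_is_scalar V).

(** Composing with the elementary matrix [delta_mx j i] makes the trace read off the entry (i, j) of
    the matrix of [g]. *)
Lemma ltrace_nondeg U V (g : 'Hom(V, U)) :
  (forall z : 'Hom(U, V), ltrace (g \o z)%VF = 0) -> g = 0.
Proof.
move=> tr0; suff g_eq0 : f2mx g = 0.
  by apply/lfunP=> x; apply: v2r_inj; rewrite v2r_lfun g_eq0 mulmx0 lfE linear0.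
apply/matrixP=> i j; rewrite [RHS]mxE.
have := tr0 (Hom (delta_mx j i)); rewrite ltraceC /ltrace f2mx_comp.
rewrite -(mul_delta_mx (0 : 'I_1)) mulmxA mxtrace_mulC trace_mx11 mulmxA -rowE.
by rewrite -colE !mxE.
Qed.
End Trace.

(** * Annihilators under a perfect pairing *)

Section Annihilator.
Variables (k : fieldType) (V W : vectType k) (b : 'Hom(V, 'Hom(W, k^o))).
Hypotheses (b_inj : lker b = 0%VS) (dimVW : \dim {:V} = \dim {:W}).

Definition annv (B : {vspace W}) : {vspace V} :=
  lker (precomp k^o (linfun (@vsval k W B)) \o b)%VF.

Lemma annvP (B : {vspace W}) g : reflect (forall z, z \in B -> b g z = 0) (g \in annv B).
Proof.
rewrite memv_ker comp_lfunE precompE; apply: (iffP eqP) => [e z zB|h].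
  by have /lfunP/(_ (Subvs zB)) := e; rewrite !lfE lfunE.
by apply/lfunP => z; rewrite !lfE lfunE /= h // subvsP.
Qed.

(** Rank-nullity for the restriction [r] of functionals to [B]. It is onto because a functional on
    [B] extends to [W] through a projection, and [b] reaches every functional on [W] by equality of
    dimensions. *)
Lemma dim_annv (B : {vspace W}) : (\dim (annv B) + \dim B = \dim {:W})%N.
Proof.
set r := (precomp k^o (linfun (@vsval k W B)) \o b)%VF.
have b_onto : limg b = fullv.
  apply/eqP; rewrite eqEdim subvf /= limg_dim_eq ?b_inj ?capv0 //.
  by rewrite dimVW !dimvf /dim /= muln1.
have r_onto : limg r = fullv.
  apply/eqP; rewrite eqEsubv subvf; apply/subvP => h _.
  apply/memv_imgP; pose h' := (h \o linfun (@vsproj k W B))%VF.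
  have /memv_imgP[g _ eg] : h' \in limg b by rewrite b_onto memvf.
  exists g; rewrite ?memvf // comp_lfunE precompE -eg; apply/lfunP => z.
  by rewrite !lfE !lfunE /= vsvalK.
have := limg_ker_dim r fullv; rewrite capfv r_onto dimVW !dimvf /= => <-.
by congr addn; rewrite /dim /= muln1.
Qed.

(** The double annihilator: adding such a [z] to [B] does not shrink the annihilator, so by
    [dim_annv] it does not enlarge [B]. *)
Lemma annv_sep (B : {vspace W}) z : (forall g, g \in annv B -> b g z = 0) -> z \in B.
Proof.
move=> h; have sub : (annv B <= annv (B + <[z]>))%VS.
  apply/subvP => g gB; apply/annvP => w /memv_addP[x xB [y /vlineP[c ->] ->]].
  by rewrite linearD linearZ /= h // scaler0 addr0; apply/annvP: x xB.
have := dimvS sub; have := dim_annv B; have := dim_annv (B + <[z]>).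
move=> e1 e2 e3; have : (\dim (B + <[z]>) <= \dim B)%N.
  by rewrite -(leq_add2l (\dim (annv B))) e2 -e1 leq_add2r.
move=> e4; have /eqP -> : B == (B + <[z]>)%VS by rewrite eqEdim addvSl.
by rewrite memvE addvSr.
Qed.

End Annihilator.

(** * Ranks of idempotents *)

Section Ranks.
Variable k : fieldType.
Implicit Types U V : vectType k.

(** For idempotents this projects Hom(U, V) onto one block; it serves to cut out maps that respect
    the grading by vertices. *)
Definition sandwich U V (e : 'End(V)) (e' : 'End(U)) : 'End('Hom(U, V)) :=
  (postcomp U e \o precomp V e')%VF.

Lemma sandwichE U V (e : 'End(V)) (e' : 'End(U)) z :
  sandwich e e' z = (e \o z \o e')%VF.
Proof. by rewrite comp_lfunE precompE postcompE comp_lfunA. Qed.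

(** [F] embeds the space of maps from [limg e'] to [limg e], and has the same image as the
    sandwich. *)
Lemma dim_sandwich U V (e : 'End(V)) (e' : 'End(U)) :
  (e \o e = e)%VF -> (e' \o e' = e')%VF ->
  (\dim (limg (sandwich e e')) = \dim (limg e) * \dim (limg e'))%N.
Proof.
move=> ee ee'.
pose iv := linfun (@vsval k V (limg e)); pose pv := linfun (@vsproj k V (limg e)).
pose pu := linfun (@vsproj k U (limg e')); pose iu := linfun (@vsval k U (limg e')).
have ein (z : V) : z \in limg e -> e z = z.
  by case/memv_imgP => y _ ->; rewrite -comp_lfunE ee.
have ein' (z : U) : z \in limg e' -> e' z = z.
  by case/memv_imgP => y _ ->; rewrite -comp_lfunE ee'.
pose F := (postcomp U iv \o precomp _ (pu \o e'))%VF.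
have FE h : F h = (iv \o h \o (pu \o e'))%VF.
  by rewrite comp_lfunE precompE postcompE comp_lfunA.
have F0 : lker F = 0%VS.
  apply/eqP; rewrite -subv0; apply/subvP => h.
  rewrite memv_ker FE memv0 => /eqP/lfunP h0; apply/eqP/lfunP => x.
  have := h0 (iu x); rewrite !lfE !lfunE /= ein' ?subvsP // vsvalK => e0.
  by apply: subvs_inj; rewrite e0.
have -> : limg (sandwich e e') = limg F.
  apply/eqP; rewrite eqEsubv; apply/andP; split; apply/subvP => z /memv_imgP[h _ ->].
    rewrite sandwichE; apply/memv_imgP.
    exists (pv \o (e \o h) \o iu)%VF; rewrite ?memvf // FE; apply/lfunP => x.
    by rewrite !lfE !lfunE /= !vsprojK ?memv_img ?memvf //.
  rewrite FE; apply/memv_imgP; exists (iv \o h \o (pu \o e'))%VF; rewrite ?memvf //.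
  rewrite sandwichE; apply/lfunP => x; rewrite !lfE !lfunE /= ein ?subvsP //.
  by congr (vsval (h _)); rewrite -[e' (e' x)]comp_lfunE ee'.
by rewrite limg_dim_eq ?F0 ?capv0 // dimvf /dim /= mulnC.
Qed.

Lemma dim_sum_idem (I : finType) V (p : I -> 'End(V)) :
  (forall i j, (p i \o p j)%VF = if i == j then p i else 0) ->
  (\dim (limg (\sum_i p i)%R) = \sum_i \dim (limg (p i)))%N.
Proof.
move=> pp; have -> : limg (\sum_i p i)%R = (\sum_i limg (p i))%VS.
  apply/eqP; rewrite eqEsubv; apply/andP; split.
    apply/subvP => z /memv_imgP[x _ ->]; rewrite sum_lfunE.
    by apply: memv_sumr => i _; rewrite memv_img ?memvf.
  apply/subv_sumP => i _; apply/subvP => z /memv_imgP[x _ ->].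
  apply/memv_imgP; exists (p i x); rewrite ?memvf // sum_lfunE (bigD1 i) //=.
  rewrite -comp_lfunE pp eqxx big1 ?addr0 // => j /negPf nji.
  by rewrite -comp_lfunE pp nji lfE.
have /directvP //= : directv (\sum_i limg (p i)).
apply/directv_sum_independent => us uin us0 i _.
have uE j : p j (us j) = us j.
  by have /memv_imgP[x _ ->] := uin j isT; rewrite -comp_lfunE pp eqxx.
have /(congr1 (p i)) := us0; rewrite linear_sum linear0 (bigD1 i) //= uE.
rewrite big1 ?addr0 // => j; rewrite eq_sym => /negPf nij.
by rewrite -uE -comp_lfunE pp nij lfE.
Qed.

Definition ffun_lfun (I : finType) V (s : I -> 'End(V)) : 'End({ffun I -> V}) :=
  linfun (fun z : {ffun I -> V} => [ffun i => s i (z i)]).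

Lemma ffun_lfunE (I : finType) V (s : I -> 'End(V)) z i :
  ffun_lfun s z i = s i (z i).
Proof.
rewrite linfunP ?ffunE // => c u v; apply/ffunP => j.
by rewrite !ffunE linearP.
Qed.

Definition ffun_inj (I : finType) V (i : I) : 'Hom(V, {ffun I -> V}) :=
  linfun (fun v : V => [ffun j => if j == i then v else 0]).

Lemma ffun_injE (I : finType) V (i : I) (v : V) j :
  ffun_inj V i v j = if j == i then v else 0.
Proof.
rewrite linfunP ?ffunE // => c u w; apply/ffunP => l.
by rewrite !ffunE; case: eqP => // _; rewrite scaler0 addr0.
Qed.

(** The operators [p i], which act by [s i] in coordinate [i] and by 0 elsewhere, are orthogonal
    idempotents with sum [ffun_lfun s]. *)
Lemma dim_ffun_lfun (I : finType) V (s : I -> 'End(V)) :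
  (forall i, s i \o s i = s i)%VF ->
  (\dim (limg (ffun_lfun s)) = \sum_i \dim (limg (s i)))%N.
Proof.
move=> ss; pose p i := ffun_lfun (fun j => if j == i then s j else 0).
have pE i z j : p i z j = if j == i then s j (z j) else 0.
  by rewrite ffun_lfunE; case: eqP => // _; rewrite lfE.
have -> : ffun_lfun s = \sum_i p i.
  apply/lfunP => z; apply/ffunP => j; rewrite lfE sum_ffunE ffun_lfunE.
  rewrite (bigD1 j) //= pE eqxx big1 ?addr0 // => i; rewrite eq_sym => /negPf nij.
  by rewrite pE nij.
rewrite dim_sum_idem => [|i j].
  apply: eq_bigr => i _.
  have -> : limg (p i) = (ffun_inj V i @: limg (s i))%VS.
    apply/eqP; rewrite eqEsubv; apply/andP; split.
      apply/subvP => z /memv_imgP[x _ ->].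
      apply/memv_imgP; exists (s i (x i)); rewrite ?memv_img ?memvf //.
      by apply/ffunP => j; rewrite pE ffun_injE; case: eqP => // ->.
    rewrite -limg_comp; apply/subvP => z /memv_imgP[x _ ->].
    apply/memv_imgP; exists (ffun_inj V i x); rewrite ?memvf //.
    by apply/ffunP => j; rewrite pE comp_lfunE !ffun_injE; case: eqP => // ->.
  rewrite limg_dim_eq //; apply/eqP; rewrite -subv0; apply: subv_trans (capvSr _ _) _.
  apply/subvP => x; rewrite memv_ker memv0 => /eqP/ffunP/(_ i).
  by rewrite ffun_injE eqxx ffunE => ->.
apply/lfunP => z; apply/ffunP => l; rewrite comp_lfunE !pE.
case: (eqVneq i j) => [<-|nij].
  by rewrite pE; case: eqP => // _; rewrite -comp_lfunE ss.
rewrite lfE ffunE; case: eqP => // ->; rewrite (negPf nij) linear0 //.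
Qed.

End Ranks.

Section TracePairing.
Variables (k : fieldType) (I : finType) (U V : vectType k).
Local Notation C := {ffun I -> 'Hom(U, V)}.
Local Notation G := {ffun I -> 'Hom(V, U)}.

Definition tpair : 'Hom(G, 'Hom(C, k^o)) :=
  linfun (fun g : G => linfun (fun z : C =>
    \sum_i ltrace (g i \o z i)%VF : k^o)).

Lemma tpairE (g : G) (z : C) : tpair g z = \sum_i ltrace (g i \o z i)%VF.
Proof.
have lin1 (h : G) : linear (fun z : C => \sum_i ltrace (h i \o z i)%VF : k^o).
  move=> c u v; rewrite scaler_sumr -big_split; apply: eq_bigr => i _ /=.
  by rewrite !ffunE comp_lfunDr -comp_lfunZr linearP.
rewrite /tpair linfunP ?linfunP // => c u v; apply/lfunP => w.
rewrite !lfE !linfunP // scaler_sumr -big_split; apply: eq_bigr => i _ /=.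
by rewrite !ffunE comp_lfunDl -comp_lfunZl linearP.
Qed.

Lemma tpair_inj : lker tpair = 0%VS.
Proof.
apply/eqP; rewrite -subv0; apply/subvP => g; rewrite memv_ker memv0 => /eqP g0.
apply/eqP/ffunP => i; rewrite ffunE; apply: ltrace_nondeg => z.
have /lfunP/(_ (ffun_inj _ i z)) := g0; rewrite tpairE lfE (bigD1 i) //=.
rewrite ffun_injE eqxx big1 ?addr0 // => j /negPf nji.
by rewrite ffun_injE nji comp_lfun0r linear0.
Qed.

Lemma dim_tpair : \dim {:G} = \dim {:C}.
Proof. by rewrite !dimvf /dim /= /dim /= [(dim U * _)%N]mulnC. Qed.

End TracePairing.

(** * Modules and the dual of Ext^1 *)

Section Basics.
Variables (k : fieldType) (m : nat) (Q : quiver m).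
Implicit Types X Y Z : qmod k Q.

Lemma vtx_vtx X i j x : vtx X i (vtx X j x) = if i == j then vtx X i x else 0.
Proof. by rewrite -comp_lfunE vtxM; case: eqP; rewrite ?lfE. Qed.

Lemma vtx_id X i x : vtx X i (vtx X i x) = vtx X i x.
Proof. by rewrite vtx_vtx eqxx. Qed.

Lemma sum_vtx X x : \sum_i vtx X i x = x.
Proof. by rewrite -sum_lfunE vtx1 lfE. Qed.

Lemma vtx_src X a x : vtx X (src a) (arw X a x) = arw X a x.
Proof. by rewrite -[in LHS]arwE -[in RHS]arwE !lfE vtx_id. Qed.

Lemma arw_tgt X a x : arw X a (vtx X (tgt a) x) = arw X a x.
Proof. by rewrite -[in LHS]arwE -[in RHS]arwE !lfE vtx_id. Qed.

Lemma vtx_arw X i a x : vtx X i (arw X a x) = if i == src a then arw X a x else 0.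
Proof. by rewrite -[in LHS]vtx_src vtx_vtx; case: eqP => // ->; rewrite vtx_src. Qed.

Lemma arw_vtx X a i x : arw X a (vtx X i x) = if i == tgt a then arw X a x else 0.
Proof.
rewrite -[in LHS]arw_tgt vtx_vtx eq_sym.
by case: eqP => [|_]; rewrite ?arw_tgt ?linear0.
Qed.

Lemma homs_vtx X Y f i x : f \in homs X Y -> f (vtx X i x) = vtx Y i (f x).
Proof. by case/homsP => h _; rewrite -!comp_lfunE h. Qed.

Lemma homs_arw X Y f a x : f \in homs X Y -> f (arw X a x) = arw Y a (f x).
Proof. by case/homsP => _ h; rewrite -!comp_lfunE h. Qed.

Lemma homsI X Y (f : 'Hom(X, Y)) :
  (forall i x, f (vtx X i x) = vtx Y i (f x)) ->
  (forall a x, f (arw X a x) = arw Y a (f x)) -> f \in homs X Y.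
Proof.
by move=> hv ha; apply/homsP; split=> [i|a]; apply/lfunP => x; rewrite !lfE.
Qed.

Lemma homs_comp X Y Z f g :
  g \in homs Y Z -> f \in homs X Y -> (g \o f)%VF \in homs X Z.
Proof.
move=> gh fh; apply: homsI => [i|a] x; rewrite !lfE.
  by rewrite (homs_vtx _ _ fh) (homs_vtx _ _ gh).
by rewrite (homs_arw _ _ fh) (homs_arw _ _ gh).
Qed.

Lemma homs_id X : \1%VF \in homs X X.
Proof. by apply: homsI => *; rewrite !lfE. Qed.

(** Ringel's formula for the Euler form. The target comes first because [arw a] maps the space at
    [tgt a] to the space at [src a]. Bilinearity is visible here, and [eulerE] compares this form
    with [euler]. *)
Definition chi (x y : 'cV[int]_m) : int :=
  \sum_i x i 0 * y i 0 - \sum_(a : arrow Q) x (tgt a) 0 * y (src a) 0.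

Lemma chiDl x x' y : chi (x + x') y = chi x y + chi x' y.
Proof.
rewrite /chi [RHS]addrACA -opprD -!big_split /=; congr (_ - _).
  by apply: eq_bigr => i _; rewrite mxE mulrDl.
by apply: eq_bigr => i _; rewrite mxE mulrDl.
Qed.

Lemma chiDr x y y' : chi x (y + y') = chi x y + chi x y'.
Proof.
rewrite /chi [RHS]addrACA -opprD -!big_split /=; congr (_ - _).
  by apply: eq_bigr => i _; rewrite mxE mulrDr.
by apply: eq_bigr => i _; rewrite mxE mulrDr.
Qed.

Lemma chi0l y : chi 0 y = 0.
Proof. by apply: (addrI (chi 0 y)); rewrite -chiDl !addr0. Qed.

Lemma chi0r x : chi x 0 = 0.
Proof. by apply: (addrI (chi x 0)); rewrite -chiDr !addr0. Qed.

Lemma chiNl x y : chi (- x) y = - chi x y.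
Proof. by apply: (addrI (chi x y)); rewrite -chiDl !subrr chi0l. Qed.

Lemma chiNr x y : chi x (- y) = - chi x y.
Proof. by apply: (addrI (chi x y)); rewrite -chiDr !subrr chi0r. Qed.

Lemma chiBl x x' y : chi (x - x') y = chi x y - chi x' y.
Proof. by rewrite chiDl chiNl. Qed.

Lemma chiBr x y y' : chi x (y - y') = chi x y - chi x y'.
Proof. by rewrite chiDr chiNr. Qed.

Lemma chiZl c x y : chi (c *: x) y = c * chi x y.
Proof.
rewrite /chi mulrBr !mulr_sumr; congr (_ - _).
  by apply: eq_bigr => i _; rewrite [(c *: x) _ _]mxE mulrA.
by apply: eq_bigr => i _; rewrite [(c *: x) _ _]mxE mulrA.
Qed.

Lemma chiZr c x y : chi x (c *: y) = c * chi x y.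
Proof.
rewrite /chi mulrBr !mulr_sumr; congr (_ - _).
  by apply: eq_bigr => i _; rewrite [(c *: y) _ _]mxE mulrCA.
by apply: eq_bigr => i _; rewrite [(c *: y) _ _]mxE mulrCA.
Qed.

Lemma chi_deltal x y : chi x y = \sum_i x i 0 * chi (delta_mx i 0) y.
Proof.
rewrite [x in LHS]matrix_sum_delta; under eq_bigr do rewrite big_ord1.
apply: etrans (big_morph (chi^~ y) (fun u v => chiDl u v y) (chi0l y) _ _ _) _.
by apply: eq_bigr => i _; exact: chiZl.
Qed.

Lemma chi_deltar x y : chi x y = \sum_i y i 0 * chi x (delta_mx i 0).
Proof.
rewrite [y in LHS]matrix_sum_delta; under eq_bigr do rewrite big_ord1.
apply: etrans (big_morph (chi x) (fun u v => chiDr x u v) (chi0r x) _ _ _) _.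
by apply: eq_bigr => i _; exact: chiZr.
Qed.

End Basics.

(** * Cocycles, coboundaries and the dual of Ext^1 *)

Section Dext.
Variables (k : fieldType) (m : nat) (Q : quiver m) (X Y : qmod k Q).

Definition graded (f : 'Hom(X, Y)) := forall i x, f (vtx X i x) = vtx Y i (f x).

(* The possible off-diagonal corners of the arrows of an extension of X by Y with
   underlying graded space Y * X. *)
Definition cocycle (z : {ffun arrow Q -> 'Hom(X, Y)}) :=
  forall a x, vtx Y (src a) (z a (vtx X (tgt a) x)) = z a x.

Definition cocyc_proj : 'End({ffun arrow Q -> 'Hom(X, Y)}) :=
  ffun_lfun (fun a => sandwich (vtx Y (src a)) (vtx X (tgt a))).

Lemma cocyc_projE z a x :
  cocyc_proj z a x = vtx Y (src a) (z a (vtx X (tgt a) x)).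
Proof. by rewrite ffun_lfunE sandwichE !lfE. Qed.

(** The factors [vtx] make this a map from all linear maps to cocycles. Only the graded part of [f]
    matters ([cobd_grading_proj]), and on graded maps it is the commutator with the arrows. *)
Definition cobd : 'Hom('Hom(X, Y), {ffun arrow Q -> 'Hom(X, Y)}) :=
  linfun (fun f : 'Hom(X, Y) => [ffun a : arrow Q =>
    ((vtx Y (src a) \o f \o arw X a) - (arw Y a \o f \o vtx X (tgt a)))%VF]).

Lemma cobdE f a x :
  cobd f a x = vtx Y (src a) (f (arw X a x)) - arw Y a (f (vtx X (tgt a) x)).
Proof.
rewrite linfunP ?ffunE ?lfE // => c u v; apply/ffunP => b; apply/lfunP => y.
by rewrite !ffunE !lfE (linearP (vtx Y _)) (linearP (arw Y b)) scalerBr opprD addrACA.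
Qed.

Lemma graded_cobdE f a x :
  graded f -> cobd f a x = f (arw X a x) - arw Y a (f x).
Proof. by move=> fg; rewrite cobdE -fg vtx_src fg arw_tgt. Qed.

Definition grading_proj : 'End('Hom(X, Y)) :=
  \sum_i sandwich (vtx Y i) (vtx X i).

Lemma grading_projE f x : grading_proj f x = \sum_i vtx Y i (f (vtx X i x)).
Proof.
by rewrite !lfE; apply: eq_bigr => i _; rewrite sandwichE !lfE.
Qed.

Lemma grading_proj_graded f : graded (grading_proj f).
Proof.
move=> j x; rewrite !grading_projE linear_sum; apply: eq_bigr => i _ /=.
have [->|nij] := eqVneq i j; first by rewrite !vtx_id.
by rewrite !vtx_vtx [j == i]eq_sym (negPf nij) !linear0.
Qed.

Lemma grading_projK f : graded f -> grading_proj f = f.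
Proof.
move=> fg; apply/lfunP => x; rewrite grading_projE -[RHS]sum_vtx.
by apply: eq_bigr => i _; rewrite fg vtx_id.
Qed.

Lemma cobd_grading_proj f : cobd (grading_proj f) = cobd f.
Proof.
apply/ffunP => a; apply/lfunP => x; rewrite graded_cobdE; last exact: grading_proj_graded.
rewrite cobdE !grading_projE linear_sum (bigD1 (src a)) //= vtx_src big1; last first.
  by move=> j /negPf nj; rewrite vtx_arw nj !linear0.
rewrite (bigD1 (tgt a)) //= arw_tgt big1 ?addr0 // => j /negPf nj.
by rewrite arw_vtx nj.
Qed.

(* The dual of Ext^1(X, Y) = cocycles / coboundaries, realised through the
   trace form by families of maps going backwards. *)
Definition dext : {vspace {ffun arrow Q -> 'Hom(Y, X)}} :=
  annv (tpair _ X Y) (lker cocyc_proj + limg cobd)%VS.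

Lemma cocyc_proj_id z : cocycle z -> cocyc_proj z = z.
Proof. by move=> h; apply/ffunP => a; apply/lfunP => x; rewrite cocyc_projE h. Qed.

Lemma cocyc_proj_cocycle z : cocycle (cocyc_proj z).
Proof. by move=> a x; rewrite !cocyc_projE !vtx_id. Qed.

Lemma cobd_cocycle f : cocycle (cobd f).
Proof.
move=> a x; rewrite !cobdE linearB /= vtx_id arw_tgt vtx_src vtx_id.
by [].
Qed.

(** Cyclicity of the trace moves [f] to the right end of each summand, so that vanishing on all
    coboundaries becomes one identity of maps [Y -> X]. *)
Lemma tpair_cobd g f : tpair _ X Y g (cobd f) =
  ltrace ((\sum_a ((arw X a \o g a \o vtx Y (src a))
                    - (vtx X (tgt a) \o g a \o arw Y a))) \o f)%VF.
Proof.
rewrite tpairE; set S := (X in ltrace (X \o f)%VF).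
have -> : (S \o f)%VF = \sum_a (((arw X a \o g a \o vtx Y (src a))
    - (vtx X (tgt a) \o g a \o arw Y a)) \o f)%VF.
  by apply/lfunP => x; rewrite !lfE; apply: eq_bigr => a _; rewrite !lfE.
rewrite linear_sum; apply: eq_bigr => a _ /=.
have -> : cobd f a = ((vtx Y (src a) \o f \o arw X a) - (arw Y a \o f \o vtx X (tgt a)))%VF.
  by apply/lfunP => x; rewrite cobdE !lfE.
rewrite comp_lfunDr comp_lfunDl comp_lfunNr comp_lfunNl !linearB /=; congr (_ - _).
  by rewrite comp_lfunA ltraceC !comp_lfunA.
by rewrite comp_lfunA ltraceC !comp_lfunA.
Qed.

(** Annihilating the kernel of [cocyc_proj] makes each [g a] homogeneous, from [src a] to [tgt a].
    Annihilating coboundaries gives the second condition, by [tpair_cobd] and nondegeneracy of the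
    trace. *)
Lemma dextP (g : {ffun arrow Q -> 'Hom(Y, X)}) : reflect
  ((forall a y, vtx X (tgt a) (g a (vtx Y (src a) y)) = g a y) /\
   (forall y, \sum_a arw X a (g a y) = \sum_a g a (arw Y a y)))
  (g \in dext).
Proof.
apply: (iffP (annvP _ _ _)) => [h|[h1 h2] _ /memv_addP[z z0 [_ /memv_imgP[f _ ->] ->]]].
  have h1 a y : vtx X (tgt a) (g a (vtx Y (src a) y)) = g a y.
    apply/eqP; rewrite eq_sym -subr_eq0; apply/eqP.
    pose d := (g a - (vtx X (tgt a) \o g a \o vtx Y (src a)))%VF.
    suff d0 : d = 0 by have /lfunP/(_ y) := d0; rewrite !lfE.
    apply: ltrace_nondeg => z.
    (* The part of [z] outside the block of [a] lies in the kernel of [cocyc_proj], so [g] must kill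
       it. *)
    pose w := ffun_inj _ a (z - (vtx Y (src a) \o z \o vtx X (tgt a)))%VF.
    have : tpair _ X Y g w = 0.
      apply: h; apply: (subvP (addvSl _ _)); rewrite memv_ker; apply/eqP/ffunP => b.
      apply/lfunP => x; rewrite cocyc_projE ffun_injE ffunE.
      by case: eqP => [->|_]; rewrite !lfE ?linear0 // linearB /= !vtx_id subrr.
    rewrite tpairE (bigD1 a) //= big1 => [|b /negPf nb]; last first.
      by rewrite ffun_injE nb comp_lfun0r linear0.
    rewrite addr0 ffun_injE eqxx comp_lfunDr comp_lfunNr linearB /= => /eqP.
    rewrite subr_eq0 => /eqP e; rewrite comp_lfunDl comp_lfunNl linearB /= e.
    by rewrite -!comp_lfunA ![ltrace (vtx _ _ \o _)%VF]ltraceC !comp_lfunA subrr.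
  split=> // y.
  pose S := \sum_a ((arw X a \o g a \o vtx Y (src a))
                     - (vtx X (tgt a) \o g a \o arw Y a))%VF.
  have /lfunP/(_ y) : S = 0.
    apply: ltrace_nondeg => f; rewrite -tpair_cobd; apply: h.
    by apply: (subvP (addvSr _ _)); rewrite memv_img ?memvf.
  rewrite !lfE => e; apply/subr0_eq; rewrite -sumrB; apply: etrans e.
  apply: eq_bigr => a _.
  rewrite !lfE; congr (_ - _).
    by rewrite -[in LHS]h1 arw_tgt -[in RHS]h1 vtx_id arw_tgt.
  by rewrite -[in LHS]h1 vtx_src.
rewrite linearD /= tpair_cobd (_ : \sum_a _ = 0); last first.
  apply/lfunP => y; rewrite !lfE; rewrite -[RHS](subrr (\sum_a arw X a (g a y))).
  rewrite {2}h2 -sumrB; apply: eq_bigr => a _; rewrite !lfE; congr (_ - _).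
    by rewrite -[in RHS]h1 arw_tgt -[in LHS]h1 vtx_id arw_tgt.
  by rewrite -[in RHS]h1 vtx_src.
rewrite comp_lfun0l linear0 addr0 tpairE big1 // => a _.
have -> : g a = (vtx X (tgt a) \o (g a \o vtx Y (src a)))%VF.
  by apply/lfunP => y; rewrite !lfE h1.
rewrite -comp_lfunA ltraceC -!comp_lfunA; move: z0; rewrite memv_ker => /eqP/ffunP/(_ a) e.
rewrite (_ : (vtx Y (src a) \o (z a \o vtx X (tgt a)))%VF = 0) ?comp_lfun0r ?linear0 //.
by apply/lfunP => x; have /lfunP/(_ x) := e; rewrite cocyc_projE !ffunE !lfE.
Qed.

Lemma tpair_dext_cobd g f : g \in dext -> tpair _ X Y g (cobd f) = 0.
Proof.
move=> gD; have /annvP := gD; apply; apply: (subvP (addvSr _ _)).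
by rewrite memv_img ?memvf.
Qed.

(** By the double annihilator, [z] is a coboundary up to the kernel of [cocyc_proj]; applying that
    projection removes the error. *)
Lemma dext_sep z : cocycle z ->
  (forall g, g \in dext -> tpair _ X Y g z = 0) -> exists2 f, graded f & z = cobd f.
Proof.
move=> zc h; have := annv_sep (tpair_inj _ X Y) (dim_tpair _ X Y) h.
case/memv_addP => u; rewrite memv_ker => /eqP u0 [_ /memv_imgP[f _ ->] zE].
exists (grading_proj f); first exact: grading_proj_graded.
rewrite cobd_grading_proj -(cocyc_proj_id zc) zE linearD /= u0 add0r.
exact/cocyc_proj_id/cobd_cocycle.
Qed.

End Dext.

(** * The Euler characteristic of Hom and Ext^1 *)

Section EulerForm.
Variables (k : fieldType) (m : nat) (Q : quiver m).
Implicit Types X Y : qmod k Q.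

Lemma dimvecE X i : dimvec X i 0 = (\dim (limg (vtx X i)))%:Z.
Proof. by rewrite mxE. Qed.

Lemma homs_graded_cobd X Y f :
  (f \in homs X Y) = (f \in limg (grading_proj X Y) :&: lker (cobd X Y))%VS.
Proof.
apply/idP/memv_capP => [fh|[/memv_imgP[u _ fE]]].
  have fg : graded f by move=> i x; rewrite (homs_vtx _ _ fh).
  split; first by rewrite -[f]grading_projK // memv_img ?memvf.
  rewrite memv_ker; apply/eqP/ffunP => a; apply/lfunP => x.
  by rewrite graded_cobdE // (homs_arw _ _ fh) subrr ffunE lfE.
have fg : graded f by rewrite fE; exact: grading_proj_graded.
rewrite memv_ker => /eqP/ffunP f0; apply: homsI => [i x|a x]; first exact: fg.
have /lfunP/(_ x) := f0 a; rewrite graded_cobdE // ffunE lfE.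
by move/eqP; rewrite subr_eq0 => /eqP.
Qed.

Lemma dim_cobd X Y :
  (\dim (homs X Y) + \dim (limg (cobd X Y)) =
  \sum_i \dim (limg (vtx X i)) * \dim (limg (vtx Y i)))%N.
Proof.
have -> : homs X Y = (limg (grading_proj X Y) :&: lker (cobd X Y))%VS.
  by apply/vspaceP => f; rewrite homs_graded_cobd.
have -> : limg (cobd X Y) = (cobd X Y @: limg (grading_proj X Y))%VS.
  apply/eqP; rewrite eqEsubv (limgS _ (subvf (limg (grading_proj X Y)))) andbT.
  apply/subvP => z /memv_imgP[f _ ->].
  by rewrite -cobd_grading_proj !memv_img ?memvf.
rewrite limg_ker_dim dim_sum_idem; last first.
  move=> i j; apply/lfunP => f; apply/lfunP => x.
  rewrite comp_lfunE !sandwichE !lfE !vtx_vtx.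
  by have [->|nij] := eqVneq i j; rewrite ?sandwichE ?eqxx ?lfE //= vtx_vtx ?eqxx.
by apply: eq_bigr => i _; rewrite dim_sandwich ?vtxM ?eqxx // mulnC.
Qed.

Lemma dim_dext X Y : (\dim (dext X Y) + \dim (limg (cobd X Y)) =
  \sum_(a : arrow Q) \dim (limg (vtx X (tgt a))) * \dim (limg (vtx Y (src a))))%N.
Proof.
have := dim_annv (tpair_inj _ X Y) (dim_tpair _ X Y)
  (lker (cocyc_proj X Y) + limg (cobd X Y))%VS.
rewrite -/(dext X Y) dimv_disjoint_sum; last first.
  apply/eqP; rewrite -subv0; apply/subvP => z /memv_capP[].
  rewrite memv_ker => /eqP z0 /memv_imgP[f _ zE].
  by rewrite memv0 -z0 zE cocyc_proj_id //; exact: cobd_cocycle.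
rewrite -(limg_ker_dim (cocyc_proj X Y) fullv) capfv addnCA => /addnI ->.
rewrite dim_ffun_lfun => [|a]; last first.
  by apply/lfunP => f; apply/lfunP => x; rewrite comp_lfunE !sandwichE !lfE !vtx_id.
by apply: eq_bigr => a _; rewrite dim_sandwich ?vtxM ?eqxx // mulnC.
Qed.

(** Hom and, up to duality, Ext^1 are the kernel and cokernel of [cobd] from graded maps to
    cocycles. Its rank cancels, and the dimensions of these two spaces are the two sums in [chi]. *)
Lemma homs_dext_chi X Y :
  (\dim (homs X Y))%:Z - (\dim (dext X Y))%:Z = chi Q (dimvec X) (dimvec Y).
Proof.
rewrite /chi; have := dim_cobd X Y; have := dim_dext X Y.
move=> /(congr1 Posz); rewrite PoszD => e1 /(congr1 Posz); rewrite PoszD => e2.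
have -> : \sum_i dimvec X i 0 * dimvec Y i 0
    = Posz (\sum_i \dim (limg (vtx X i)) * \dim (limg (vtx Y i)))%N.
  by rewrite -natz natr_sum; apply: eq_bigr => i _; rewrite natz !dimvecE PoszM.
have -> : \sum_(a : arrow Q) dimvec X (tgt a) 0 * dimvec Y (src a) 0
    = Posz (\sum_(a : arrow Q) \dim (limg (vtx X (tgt a))) * \dim (limg (vtx Y (src a))))%N.
  by rewrite -natz natr_sum; apply: eq_bigr => i _; rewrite natz !dimvecE PoszM.
by rewrite -e1 -e2; ring.
Qed.

End EulerForm.

(** * Submodules and quotients as modules *)

Section Submodules.
Variables (k : fieldType) (m : nat) (Q : quiver m).
Implicit Types X Y Z : qmod k Q.

Lemma submodP X (U : {vspace X}) : reflect
  ((forall i u, u \in U -> vtx X i u \in U) /\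
   (forall a u, u \in U -> arw X a u \in U)) (submod U).
Proof.
apply: (iffP andP) => [[/forallP h1 /forallP h2]|[h1 h2]].
  by split=> [i|a] u uU; [apply: (subvP (h1 i))|apply: (subvP (h2 a))]; rewrite memv_img.
by split; apply/forallP => i; apply/subvP => _ /memv_imgP[u uU ->]; auto.
Qed.

Lemma submod_vtx X (U : {vspace X}) i u : submod U -> u \in U -> vtx X i u \in U.
Proof. by case/submodP => h _; exact: h. Qed.

Lemma submod_arw X (U : {vspace X}) a u : submod U -> u \in U -> arw X a u \in U.
Proof. by case/submodP => _; exact. Qed.

Lemma submod_lker X Y f : f \in homs X Y -> submod (lker f).
Proof.
move=> fh; apply/submodP; split=> [i|a] u; rewrite !memv_ker => /eqP u0.
  by rewrite (homs_vtx _ _ fh) u0 linear0.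
by rewrite (homs_arw _ _ fh) u0 linear0.
Qed.

Lemma submod_img X Y f (U : {vspace X}) :
  f \in homs X Y -> submod U -> submod (f @: U)%VS.
Proof.
move=> fh Us; apply/submodP; split=> [i|a] _ /memv_imgP[u uU ->].
  by rewrite -(homs_vtx _ _ fh) memv_img // submod_vtx.
by rewrite -(homs_arw _ _ fh) memv_img // submod_arw.
Qed.

Lemma submod_preim X Y f (V : {vspace Y}) :
  f \in homs X Y -> submod V -> submod (f @^-1: V)%VS.
Proof.
move=> fh Vs; apply/submodP; split=> [i|a] u; rewrite -!memv_preim => uV.
  by rewrite (homs_vtx _ _ fh) submod_vtx.
by rewrite (homs_arw _ _ fh) submod_arw.
Qed.

Lemma submod_full X : submod (fullv : {vspace X}).
Proof. by apply/submodP; split=> *; exact: memvf. Qed.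

Lemma img_vtx X Y f (U : {vspace X}) i :
  f \in homs X Y -> (vtx Y i @: (f @: U) = f @: (vtx X i @: U))%VS.
Proof.
by move=> fh; rewrite -!limg_comp; have /homsP[/(_ i) ->] := fh.
Qed.

Lemma sub_dimvec_img X Y f (U : {vspace X}) : f \in homs X Y -> submod U ->
  sub_dimvec U = sub_dimvec (U :&: lker f)%VS + sub_dimvec (f @: U)%VS.
Proof.
move=> fh Us; apply/colP => i; rewrite !mxE img_vtx // -PoszD.
rewrite -(limg_ker_dim f (vtx X i @: U)).
rewrite (_ : (_ :&: lker f)%VS = (vtx X i @: (U :&: lker f))%VS) //.
apply/vspaceP => x; apply/memv_capP/memv_imgP => [[/memv_imgP[u uU xE] xf]|[u uV xE]].
  exists x; last by rewrite xE vtx_id.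
  by rewrite memv_cap xf andbT xE submod_vtx.
move: uV; rewrite memv_cap => /andP[uU uf]; rewrite xE memv_img //.
by rewrite submod_vtx // (submod_lker fh).
Qed.

Lemma sub_dimvec0 X : sub_dimvec (0 : {vspace X})%VS = 0.
Proof. by apply/colP => i; rewrite !mxE limg0 dimv0. Qed.

Lemma sub_dimvec_inj_img X Y f (U : {vspace X}) : f \in homs X Y -> submod U ->
  lker f = 0%VS -> sub_dimvec (f @: U)%VS = sub_dimvec U.
Proof.
by move=> fh Us f0; rewrite (sub_dimvec_img fh Us) f0 capv0 sub_dimvec0 add0r.
Qed.

Lemma dimvec_ker_img X Y f : f \in homs X Y ->
  dimvec X = sub_dimvec (lker f) + sub_dimvec (limg f).
Proof.
by move=> fh; rewrite /dimvec (sub_dimvec_img fh (submod_full X)) capfv.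
Qed.

Lemma dimvec_short_exact X Y Z (f : 'Hom(X, Y)) (g : 'Hom(Y, Z)) :
  short_exact f g -> dimvec Y = dimvec X + dimvec Z.
Proof.
case=> fh gh /eqP f0 /eqP fg /eqP g1.
by rewrite (dimvec_ker_img gh) -fg g1 (sub_dimvec_inj_img fh) ?submod_full.
Qed.

(* The subquotient structure induced on W by maps W -> X -> W composing to the
   identity. *)
Section Transport.
Variables (X : qmod k Q) (W : vectType k) (inc : 'Hom(W, X)) (ret : 'Hom(X, W)).

Definition generator (x : 'End(X)) := (exists i, x = vtx X i) \/ (exists a, x = arw X a).

Hypothesis retK : cancel inc ret.
Hypothesis ret_gen : forall x y w, generator x -> generator y ->
  ret (x (inc (ret (y (inc w))))) = ret (x (y (inc w))).

Let gv i : generator (vtx X i). Proof. by left; exists i. Qed.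
Let ga a : generator (arw X a). Proof. by right; exists a. Qed.

Lemma transport_vtxM i j :
  ((ret \o vtx X i \o inc) \o (ret \o vtx X j \o inc))%VF
  = if i == j then (ret \o vtx X i \o inc)%VF else 0.
Proof.
apply/lfunP => w; rewrite !lfE ret_gen // vtx_vtx.
by case: eqP => _; rewrite ?linear0 ?lfE.
Qed.

Lemma transport_vtx1 : \sum_i (ret \o vtx X i \o inc)%VF = \1%VF.
Proof.
apply/lfunP => w; rewrite !lfE -[RHS]retK -[inc w in RHS]sum_vtx linear_sum.
by apply: eq_bigr => i _; rewrite !lfE.
Qed.

Lemma transport_arwE (a : arrow Q) :
  ((ret \o vtx X (src a) \o inc) \o (ret \o arw X a \o inc)
    \o (ret \o vtx X (tgt a) \o inc))%VF = (ret \o arw X a \o inc)%VF.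
Proof.
by apply/lfunP => w; rewrite !lfE [ret (arw _ _ _)]ret_gen // arw_tgt ret_gen // vtx_src.
Qed.

Definition transport_mod : qmod k Q :=
  QMod transport_vtxM transport_vtx1 transport_arwE.

Lemma transport_vtx_app i w : vtx transport_mod i w = ret (vtx X i (inc w)).
Proof. by rewrite /= !lfE. Qed.

Lemma transport_arw_app a w : arw transport_mod a w = ret (arw X a (inc w)).
Proof. by rewrite /= !lfE. Qed.

End Transport.

Lemma submod_gen X (U : {vspace X}) x u :
  submod U -> generator x -> u \in U -> x u \in U.
Proof.
by move=> Us [[i ->]|[a ->]] uU; [exact: submod_vtx | exact: submod_arw].
Qed.

Lemma submod_model X (U : {vspace X}) : submod U ->
  exists (V : qmod k Q) (j : 'Hom(V, X)), [/\ j \in homs V X, lker j = 0%VS & limg j = U].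
Proof.
move=> Us; pose inc := linfun (@vsval k X U); pose ret := linfun (@vsproj k X U).
have incE w : inc w = vsval w by rewrite lfunE.
have retE w : ret w = vsproj U w by rewrite lfunE.
have retK : cancel inc ret by move=> w; rewrite incE retE vsvalK.
have incU w : inc w \in U by rewrite incE subvsP.
have incK x : x \in U -> inc (ret x) = x by move=> xU; rewrite incE retE vsprojK.
have ret_gen x y w : generator x -> generator y ->
    ret (x (inc (ret (y (inc w))))) = ret (x (y (inc w))).
  by move=> _ gy; rewrite (incK (y _)) // submod_gen.
exists (transport_mod retK ret_gen), inc; split.
- apply: homsI => [i|a] w; rewrite (transport_vtx_app, transport_arw_app) incK //.
    exact: submod_vtx.
  exact: submod_arw.
- apply/eqP; rewrite -subv0; apply/subvP => w; rewrite memv_ker memv0 => /eqP w0.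
  by rewrite -[w]retK w0 linear0.
- apply/eqP; rewrite eqEsubv; apply/andP; split; apply/subvP => x.
    by case/memv_imgP => w _ ->.
  by move=> xU; rewrite -[x]incK // memv_img ?memvf.
Qed.

(** The quotient is put on a complement of [U]. The map [ret] removes the component in [U] and so
    has kernel [U]; the generators descend because they preserve [U]. *)
Lemma quotient_model X (U : {vspace X}) : submod U ->
  exists (Z : qmod k Q) (p : 'Hom(X, Z)), [/\ p \in homs X Z, limg p = fullv & lker p = U].
Proof.
move=> Us; pose W := (U^C)%VS.
pose inc := linfun (@vsval k X W).
pose pr := (\1 - projv U)%VF; pose ret := (linfun (@vsproj k X W) \o pr)%VF.
have prE x : pr x = x - projv U x by rewrite !lfE.
have incE w : inc w = vsval w by rewrite lfunE.
have retE x : inc (ret x) = pr x.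
  by rewrite incE lfE lfunE /= vsprojK // prE memv_projC.
have inc_inj : injective inc by move=> u v; rewrite !incE; exact: subvs_inj.
have retK : cancel inc ret.
  move=> w; apply: inc_inj; rewrite retE prE.
  have : inc w \in lker (projv U) by rewrite lker_proj incE subvsP.
  by rewrite memv_ker => /eqP ->; rewrite subr0.
have ret0 u : (ret u == 0) = (u \in U).
  apply/eqP/idP => [u0|uU].
    have /eqP := retE u; rewrite u0 linear0 prE eq_sym subr_eq0 => /eqP ->.
    exact: memv_proj.
  by apply: inc_inj; rewrite retE prE projv_id // subrr linear0.
have ret_gen' x y : generator x -> ret (x (inc (ret y))) = ret (x y).
  move=> gx; apply/eqP; rewrite -subr_eq0 -!linearB ret0 submod_gen //.
  by rewrite retE prE addrAC subrr sub0r memvN memv_proj.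
have ret_gen x y w : generator x -> generator y ->
    ret (x (inc (ret (y (inc w))))) = ret (x (y (inc w))).
  by move=> gx _; rewrite ret_gen'.
exists (transport_mod retK ret_gen), ret; split.
- apply: homsI => [i|a] x; rewrite (transport_vtx_app, transport_arw_app) ret_gen' //.
    by left; exists i.
  by right; exists a.
- apply/eqP; rewrite eqEsubv subvf; apply/subvP => w _.
  by rewrite -[w]retK memv_img ?memvf.
- by apply/vspaceP => x; rewrite memv_ker ret0.
Qed.

Lemma dimvec_model X Y (j : 'Hom(X, Y)) :
  j \in homs X Y -> lker j = 0%VS -> sub_dimvec (limg j) = dimvec X.
Proof. by move=> jh j0; rewrite sub_dimvec_inj_img ?submod_full. Qed.

Lemma dimvec_quotient X Y (p : 'Hom(X, Y)) :
  p \in homs X Y -> limg p = fullv -> dimvec Y = dimvec X - sub_dimvec (lker p).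
Proof. by move=> ph p1; rewrite (dimvec_ker_img ph) p1 addrC addKr. Qed.

Lemma hom_factor_inj X Y Z (j : 'Hom(Y, Z)) (f : 'Hom(X, Z)) :
  j \in homs Y Z -> lker j = 0%VS -> f \in homs X Z -> (limg f <= limg j)%VS ->
  exists2 h, h \in homs X Y & f = (j \o h)%VF.
Proof.
move=> jh /eqP j0 fh le; have jK x : j ((j^-1)%VF (f x)) = f x.
  by rewrite limg_lfunVK // (subvP le) ?memv_img ?memvf.
have ji : injective j by apply/lker0P.
exists (j^-1 \o f)%VF; last by apply/lfunP => x; rewrite !lfE jK.
apply: homsI => [i|a] x; apply: ji; rewrite !lfE jK.
  by rewrite (homs_vtx _ _ jh) jK (homs_vtx _ _ fh).
by rewrite (homs_arw _ _ jh) jK (homs_arw _ _ fh).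
Qed.

Lemma lfun_factor_surj (U V W : vectType k) (p : 'Hom(U, V)) (f : 'Hom(U, W)) :
  limg p = fullv -> (lker p <= lker f)%VS -> f = (f \o p^-1 \o p)%VF.
Proof.
move=> p1 le; apply/lfunP => x; rewrite !lfE; apply/eqP.
rewrite -subr_eq0 -linearB -memv_ker (subvP le) // memv_ker linearB /=.
by rewrite limg_lfunVK ?subrr // p1 memvf.
Qed.

Lemma hom_factor_surj X Y Z (p : 'Hom(X, Y)) (f : 'Hom(X, Z)) :
  p \in homs X Y -> limg p = fullv -> f \in homs X Z -> (lker p <= lker f)%VS ->
  exists2 h, h \in homs Y Z & f = (h \o p)%VF.
Proof.
move=> ph p1 fh le; have fE := lfun_factor_surj p1 le.
exists (f \o p^-1)%VF; last exact: fE.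
have pE y : exists x, y = p x.
  by have := memvf y; rewrite -p1 => /memv_imgP[x _ ->]; exists x.
have fp x : (f \o p^-1)%VF (p x) = f x by rewrite -comp_lfunE -fE.
apply: homsI => [i|a] y; have [x ->] := pE y.
  by rewrite -(homs_vtx _ _ ph) !fp (homs_vtx _ _ fh).
by rewrite -(homs_arw _ _ ph) !fp (homs_arw _ _ fh).
Qed.

Lemma hom_image X Y (f : 'Hom(X, Y)) : f \in homs X Y ->
  exists (L : qmod k Q) (j : 'Hom(L, Y)) (q : 'Hom(X, L)),
  [/\ j \in homs L Y, lker j = 0%VS & limg j = limg f] /\
  [/\ q \in homs X L, limg q = fullv & forall x, f x = j (q x)].
Proof.
move=> fh; have [L [j [jh j0 jE]]] := submod_model (submod_img fh (submod_full X)).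
have [|q qh fE] := hom_factor_inj jh j0 fh; first by rewrite jE.
have fq x : f x = j (q x) by rewrite fE lfE.
exists L, j, q; split; split=> //.
apply/eqP; rewrite eqEsubv subvf; apply/subvP => y _.
have : j y \in limg f by rewrite -jE memv_img ?memvf.
case/memv_imgP => x _; have /eqP/lker0P ji := j0; rewrite fq => /ji ->.
by rewrite memv_img ?memvf.
Qed.

Lemma short_exact_lker X Y (p : 'Hom(X, Y)) : p \in homs X Y -> limg p = fullv ->
  exists (K : qmod k Q) (i : 'Hom(K, X)), short_exact i p.
Proof.
move=> ph p1; have [K [i [ih i0 iE]]] := submod_model (submod_lker ph).
by exists K, i; split=> //; rewrite ?i0 ?p1 // /exact_at iE.
Qed.

End Submodules.

(** * Functoriality of D Ext^1, and classes of extensions *)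

Section Functoriality.
Variables (k : fieldType) (m : nat) (Q : quiver m).
Implicit Types X Y Z V E M N : qmod k Q.

(** With [pre], this makes [dext X Y] covariant in [X] and contravariant in [Y], dually to Ext^1;
    [tpair_post] and [tpair_pre] are the adjunctions with the action on cocycles. *)
Definition post (U V W : vectType k) (I : finType) (p : 'Hom(V, W))
  (g : {ffun I -> 'Hom(U, V)}) : {ffun I -> 'Hom(U, W)} := [ffun a => (p \o g a)%VF].

Definition pre (U V W : vectType k) (I : finType) (g : {ffun I -> 'Hom(V, W)})
  (p : 'Hom(U, V)) : {ffun I -> 'Hom(U, W)} := [ffun a => (g a \o p)%VF].

Lemma postE (U V W : vectType k) (I : finType) (p : 'Hom(V, W))
  (g : {ffun I -> 'Hom(U, V)}) a x : post p g a x = p (g a x).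
Proof. by rewrite ffunE lfE. Qed.

Lemma preE (U V W : vectType k) (I : finType) (g : {ffun I -> 'Hom(V, W)})
  (p : 'Hom(U, V)) a x : pre g p a x = g a (p x).
Proof. by rewrite ffunE lfE. Qed.

Lemma ffunlP (U V : vectType k) (I : finType) (g h : {ffun I -> 'Hom(U, V)}) :
  (forall a x, g a x = h a x) -> g = h.
Proof. by move=> e; apply/ffunP => a; apply/lfunP => x. Qed.

Lemma dextE1 X Y g a y : g \in dext X Y -> vtx X (tgt a) (g a (vtx Y (src a) y)) = g a y.
Proof. by case/dextP => h _; exact: h. Qed.

Lemma dextE2 X Y g y : g \in dext X Y ->
  \sum_a arw X a (g a y) = \sum_a g a (arw Y a y).
Proof. by case/dextP => _; exact. Qed.

Lemma dext_post X X' Y (p : 'Hom(X, X')) g :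
  p \in homs X X' -> g \in dext X Y -> post p g \in dext X' Y.
Proof.
move=> ph gD; apply/dextP; split=> [a y|y].
  by rewrite !postE -(homs_vtx _ _ ph) (dextE1 _ _ gD).
under eq_bigr do rewrite postE -(homs_arw _ _ ph).
by under [RHS]eq_bigr do rewrite postE; rewrite -!linear_sum (dextE2 _ gD).
Qed.

Lemma dext_pre X Y Y' (p : 'Hom(Y', Y)) g :
  p \in homs Y' Y -> g \in dext X Y -> pre g p \in dext X Y'.
Proof.
move=> ph gD; apply/dextP; split=> [a y|y].
  by rewrite !preE (homs_vtx _ _ ph) (dextE1 _ _ gD).
under eq_bigr do rewrite preE; rewrite (dextE2 _ gD).
by apply: eq_bigr => a _; rewrite preE (homs_arw _ _ ph).
Qed.

Lemma dext_factor_inj X X' Y (j : 'Hom(X, X')) g :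
  j \in homs X X' -> lker j = 0%VS -> g \in dext X' Y ->
  (forall a, limg (g a) <= limg j)%VS -> exists2 g', g' \in dext X Y & g = post j g'.
Proof.
move=> jh /eqP j0 gD le; have jK a y : j ((j^-1)%VF (g a y)) = g a y.
  by rewrite limg_lfunVK // (subvP (le a)) ?memv_img ?memvf.
have ji : injective j by apply/lker0P.
exists (post (j^-1)%VF g); last by apply: ffunlP => a y; rewrite !postE jK.
apply/dextP; split=> [a y|y]; apply: ji.
  by rewrite !postE (homs_vtx _ _ jh) !jK (dextE1 _ _ gD).
rewrite !linear_sum /=; under eq_bigr do rewrite (homs_arw _ _ jh) postE jK.
by rewrite (dextE2 _ gD); apply: eq_bigr => a _; rewrite postE jK.
Qed.

Lemma dext_factor_surj X Y Z (p : 'Hom(Y, Z)) g :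
  p \in homs Y Z -> limg p = fullv -> g \in dext X Y ->
  (forall a, lker p <= lker (g a))%VS -> exists2 g', g' \in dext X Z & g = pre g' p.
Proof.
move=> ph p1 gD le; have gE a := lfun_factor_surj p1 (le a).
have pK y : exists x, y = p x.
  by have := memvf y; rewrite -p1 => /memv_imgP[x _ ->]; exists x.
have gp a x : pre g (p^-1)%VF a (p x) = g a x.
  by rewrite preE [in RHS]gE !lfE.
exists (pre g (p^-1)%VF); last by apply: ffunlP => a x; rewrite preE gp.
apply/dextP; split=> [a y|y]; have [x ->] := pK y.
  by rewrite -(homs_vtx _ _ ph) !gp (dextE1 _ _ gD).
under eq_bigr do rewrite gp; rewrite (dextE2 _ gD).
by apply: eq_bigr => a _; rewrite -(homs_arw _ _ ph) gp.
Qed.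

Lemma post_inj (U V W : vectType k) (I : finType) (j : 'Hom(V, W)) :
  lker j = 0%VS -> injective (post j : {ffun I -> 'Hom(U, V)} -> _).
Proof.
move=> /eqP /lker0P ji g h e; apply: ffunlP => a x; apply: ji.
by have /ffunP/(_ a)/lfunP/(_ x) := e; rewrite !postE.
Qed.

Lemma tpair_post (I : finType) (U V W : vectType k) (p : 'Hom(V, W))
    (g : {ffun I -> 'Hom(U, V)}) (z : {ffun I -> 'Hom(W, U)}) :
  tpair _ _ _ (post p g) z = tpair _ _ _ g (pre z p).
Proof.
rewrite !tpairE; apply: eq_bigr => a _.
by rewrite !ffunE -comp_lfunA ltraceC comp_lfunA.
Qed.

Lemma tpair_pre (I : finType) (U V W : vectType k) (p : 'Hom(U, V))
    (g : {ffun I -> 'Hom(V, W)}) (z : {ffun I -> 'Hom(W, U)}) :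
  tpair _ _ _ (pre g p) z = tpair _ _ _ g (post p z).
Proof. by rewrite !tpairE; apply: eq_bigr => a _; rewrite !ffunE comp_lfunA. Qed.

(** Every family is a cocycle plus an element of the kernel of [cocyc_proj], and [g] kills the
    latter by definition. *)
Lemma dext_eq0 X Y g : g \in dext X Y ->
  (forall z, cocycle z -> tpair _ X Y g z = 0) -> g = 0.
Proof.
move=> gD h; apply/eqP; rewrite -memv0 -(tpair_inj _ X Y) memv_ker; apply/eqP/lfunP => z.
rewrite lfE -[z](subrK (cocyc_proj X Y z)) linearD /= (h (cocyc_proj X Y z));
  last exact: cocyc_proj_cocycle.
rewrite addr0; move/annvP: gD; apply; apply: (subvP (addvSl _ _)).
by rewrite memv_ker linearB /= (cocyc_proj_id (cocyc_proj_cocycle z)) subrr.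
Qed.

Lemma cocycle_pre X X' Y (z : {ffun arrow Q -> 'Hom(X, Y)}) (p : 'Hom(X', X)) :
  cocycle z -> p \in homs X' X -> @cocycle _ _ _ X' Y (pre z p).
Proof. by move=> zc ph a x; rewrite !preE (homs_vtx _ _ ph) zc. Qed.

Lemma cocycle_post X Y Y' (z : {ffun arrow Q -> 'Hom(X, Y)}) (p : 'Hom(Y, Y')) :
  cocycle z -> p \in homs Y Y' -> @cocycle _ _ _ X Y' (post p z).
Proof. by move=> zc ph a x; rewrite !postE -(homs_vtx _ _ ph) zc. Qed.

Lemma graded_section E M (p : 'Hom(E, M)) : p \in homs E M -> limg p = fullv ->
  exists2 s : 'Hom(M, E), graded s & forall x, p (s x) = x.
Proof.
move=> ph p1; exists (grading_proj _ _ (p^-1)%VF); first exact: grading_proj_graded.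
move=> x; rewrite grading_projE linear_sum -[RHS]sum_vtx; apply: eq_bigr => i _ /=.
by rewrite (homs_vtx _ _ ph) limg_lfunVK ?p1 ?memvf // vtx_id.
Qed.

(** [z] measures how far the graded section [s] is from a homomorphism; it represents the class of
    the extension in Ext^1(M, N). *)
Definition ext_cocycle N E M (i : 'Hom(N, E)) (s : 'Hom(M, E))
    (z : {ffun arrow Q -> 'Hom(M, N)}) :=
  forall a x, i (z a x) = arw E a (s x) - s (arw M a x).

Lemma ext_cocycle_ex N E M (i : 'Hom(N, E)) (p : 'Hom(E, M)) (s : 'Hom(M, E)) :
  short_exact i p -> graded s -> (forall x, p (s x) = x) ->
  exists2 z, @cocycle _ _ _ M N z & ext_cocycle i s z.
Proof.
case=> ih ph i0 /eqP ip _ sg ps.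
pose z := [ffun a : arrow Q => (i^-1 \o ((arw E a \o s) - (s \o arw M a)))%VF].
have zE : ext_cocycle i s z.
  move=> a x; rewrite ffunE !lfE limg_lfunVK // ip memv_ker linearB /= ps.
  by rewrite (homs_arw _ _ ph) ps subrr.
exists z => // a x; have /lker0P := i0; apply.
by rewrite (homs_vtx _ _ ih) !zE linearB /= vtx_src sg !arw_tgt -sg vtx_src.
Qed.

(** [q] extends to [E] exactly when the pushout of the extension along [q] splits. The class of this
    pushout is [post q z], and it vanishes when every element of [dext M Z] kills it. *)
Lemma ext_retractP N E M Z (i : 'Hom(N, E)) (p : 'Hom(E, M)) (s : 'Hom(M, E)) z
    (q : 'Hom(N, Z)) :
  short_exact i p -> graded s -> (forall x, p (s x) = x) -> cocycle z ->
  ext_cocycle i s z -> q \in homs N Z ->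
  (exists2 r, r \in homs E Z & (r \o i)%VF = q) <->
  (forall g, g \in dext M Z -> tpair _ M Z g (post q z) = 0).
Proof.
move=> [ih ph /lker0P i_inj /eqP ip _] sg ps zc zE qh; split.
  case=> r rh rq g gD; rewrite (_ : post q z = cobd M Z (- (r \o s)%VF)) ?tpair_dext_cobd //.
  apply: ffunlP => a x; rewrite postE -rq graded_cobdE; last first.
    by move=> j y; rewrite !lfE sg (homs_vtx _ _ rh) linearN.
  by rewrite !lfE zE linearB /= (homs_arw _ _ rh) linearN opprK addrC.
move=> h; have [t tg tE] := dext_sep (cocycle_post zc qh) h.
have [u uE] : exists u : 'Hom(E, N), forall x, i (u x) = x - s (p x).
  exists (i^-1 \o (\1 - (s \o p)))%VF => x.
  by rewrite !lfE limg_lfunVK // ip memv_ker linearB /= ps subrr.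
have pi x : p (i x) = 0 by apply/eqP; rewrite -memv_ker -ip memv_img ?memvf.
(* [u] is the linear retraction belonging to [s]. Since [post q z = cobd t], subtracting [t]
   corrects the failure of [q \o u] to commute with the arrows. *)
pose r := ((q \o u) - (t \o p))%VF.
have ri x : r (i x) = q x.
  rewrite !lfE pi linear0 subr0; congr (q _); apply: i_inj.
  by rewrite uE pi linear0 subr0.
have us x : u (s x) = 0 by apply: i_inj; rewrite uE ps subrr linear0.
have rs x : r (s x) = - t x by rewrite !lfE ps us linear0 sub0r.
have rE x : exists n y, x = i n + s y.
  by exists (u x), (p x); rewrite uE subrK.
exists r; last by apply/lfunP => x; rewrite lfE ri.
apply: homsI => [j|a] x; have [n [y ->]] := rE x; rewrite !linearD /= ri rs.
  by rewrite -(homs_vtx _ _ ih) ri -sg rs (homs_vtx _ _ qh) tg linearN.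
have -> : arw E a (s y) = i (z a y) + s (arw M a y) by rewrite zE subrK.
rewrite linearD /= -(homs_arw _ _ ih) !ri rs (homs_arw _ _ qh); congr (_ + _).
have /ffunP/(_ a)/lfunP/(_ y) := tE; rewrite postE graded_cobdE // => ->.
by rewrite linearN addrAC subrr sub0r.
Qed.

(** Dual to [ext_retractP]: the pullback along [h] has class [pre z h], and if this is [cobd t] then
    [s \o h] corrected by [i \o t] is a homomorphism. *)
Lemma ext_liftP N E M V (i : 'Hom(N, E)) (p : 'Hom(E, M)) (s : 'Hom(M, E)) z
    (h : 'Hom(V, M)) :
  short_exact i p -> graded s -> (forall x, p (s x) = x) -> cocycle z ->
  ext_cocycle i s z -> h \in homs V M ->
  (forall g, g \in dext V N -> tpair _ V N g (pre z h) = 0) ->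
  exists2 l, l \in homs V E & (p \o l)%VF = h.
Proof.
move=> [ih ph /lker0P i_inj /eqP ip _] sg ps zc zE hh h0.
have [t tg tE] := dext_sep (cocycle_pre zc hh) h0.
have pi x : p (i x) = 0 by apply/eqP; rewrite -memv_ker -ip memv_img ?memvf.
exists ((s \o h) + (i \o t))%VF; last first.
  by apply/lfunP => x; rewrite !lfE linearD /= ps pi addr0.
apply: homsI => [j|a] x; rewrite !lfE.
  by rewrite (homs_vtx _ _ hh) sg tg (homs_vtx _ _ ih) linearD.
have /ffunP/(_ a)/lfunP/(_ x)/(congr1 i) := tE; rewrite preE zE graded_cobdE //.
rewrite linearB /= (homs_arw _ _ ih) (homs_arw _ _ hh) linearD /= => e.
by rewrite -[i (t (arw V a x))](subrK (arw E a (i (t x)))) -e addrA (addrC (s _)) subrK.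
Qed.

End Functoriality.

Section ExtensionModule.
Variables (k : fieldType) (m : nat) (Q : quiver m) (X Y : qmod k Q).
Variables (z : {ffun arrow Q -> 'Hom(X, Y)}) (zc : cocycle z).

Definition ext_arw (a : arrow Q) : 'End((Y * X)%type) :=
  linfun (fun w : (Y * X)%type => (arw Y a w.1 + z a w.2, arw X a w.2)).

Lemma ext_arwE a w : ext_arw a w = (arw Y a w.1 + z a w.2, arw X a w.2).
Proof.
rewrite linfunP // => c u v /=; rewrite (linearP (arw Y a)) (linearP (z a)).
rewrite (linearP (arw X a)); congr (_, _).
by rewrite /= scalerDr addrACA.
Qed.

Lemma ext_arw_vtx (a : arrow Q) :
  (vtx (dsum Y X) (src a) \o ext_arw a \o vtx (dsum Y X) (tgt a))%VF = ext_arw a.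
Proof.
apply/lfunP => w; rewrite !comp_lfunE /= !pair_lfunE !ext_arwE /=.
by rewrite linearD /= vtx_src arw_tgt zc vtx_src arw_tgt.
Qed.

Definition ext_mod : qmod k Q :=
  @QMod k m Q (Y * X)%type (vtx (dsum Y X)) ext_arw
    (dsum_vtxM Y X) (dsum_vtx1 Y X) ext_arw_vtx.

End ExtensionModule.

(** * Projective and injective modules *)

Section Projectives.
Variables (k : fieldType) (m : nat) (Q : quiver m).
Implicit Types X Y Z V E M N P : qmod k Q.

Lemma vspace0P (V : vectType k) (U : {vspace V}) :
  (forall u, u \in U -> u = 0) -> U = 0%VS.
Proof.
move=> h; apply/eqP; rewrite -subv0; apply/subvP => u /h ->.
exact: mem0v.
Qed.

Section ExtensionMaps.
Variables (X Y : qmod k Q) (z : {ffun arrow Q -> 'Hom(X, Y)}) (zc : cocycle z).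
Local Notation E := (ext_mod zc).

Definition ext_snd : 'Hom(E, X) := linfun (fun w : (Y * X)%type => w.2).
Definition ext_inl : 'Hom(Y, E) := linfun (fun y : Y => (y, 0) : (Y * X)%type).

Lemma ext_sndE w : ext_snd w = w.2. Proof. by rewrite linfunP. Qed.
Lemma ext_inlE y : ext_inl y = (y, 0).
Proof.
by rewrite linfunP // => c u v; congr (_, _); rewrite /= scaler0 addr0.
Qed.

Lemma ext_snd_hom : ext_snd \in homs E X.
Proof.
apply: homsI => [i|a] w; rewrite !ext_sndE /=; first by rewrite pair_lfunE.
by rewrite ext_arwE.
Qed.

Lemma ext_inl_hom : ext_inl \in homs Y E.
Proof.
apply: homsI => [i|a] w; rewrite !ext_inlE /=; first by rewrite pair_lfunE linear0.
by rewrite ext_arwE /= !linear0 addr0.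
Qed.

End ExtensionMaps.

(** A cocycle [z] defines an extension [ext_mod] of [P]. Projectivity gives it a section, whose
    first component [t] satisfies [z = cobd t]. *)
Lemma projective_dext P Y : projective P -> dext P Y = 0%VS.
Proof.
move=> Pp; apply: vspace0P => g gD; apply: (dext_eq0 gD) => z zc.
have s1 : limg (ext_snd zc) = fullv.
  apply/eqP; rewrite eqEsubv subvf; apply/subvP => x _; apply/memv_imgP.
  by exists (0, x); rewrite ?memvf // ext_sndE.
have [s sh sE] := Pp _ _ _ _ (ext_snd_hom zc) s1 (homs_id P).
have s2 x : (s x).2 = x by have /lfunP/(_ x) := sE; rewrite lfE ext_sndE lfE.
have lin : linear (fun x => (s x).1) by move=> c u v; rewrite linearP.
pose t := linfun (fun x => (s x).1); have tE x : t x = (s x).1 by rewrite linfunP.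
rewrite (_ : z = cobd P Y t) ?tpair_dext_cobd //.
apply: ffunlP => a x; rewrite graded_cobdE; last first.
  by move=> i y; rewrite !tE (homs_vtx _ _ sh) /= pair_lfunE.
by rewrite !tE (homs_arw _ _ sh) /= ext_arwE /= s2 addrAC subrr add0r.
Qed.

(** Dually, a retraction [r] of the extension onto [I] yields [t x = - r (0, x)] with
    [z = cobd t]. *)
Lemma injective_dext X I : injective_mod I -> dext X I = 0%VS.
Proof.
move=> Ii; apply: vspace0P => g gD; apply: (dext_eq0 gD) => z zc.
have i0 : lker (ext_inl zc) = 0%VS.
  by apply: vspace0P => y; rewrite memv_ker ext_inlE => /eqP[].
have [r rh rE] := Ii _ _ _ _ (ext_inl_hom zc) i0 (homs_id I).
have r1 y : r (y, 0) = y by have /lfunP/(_ y) := rE; rewrite lfE ext_inlE lfE.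
have lin : linear (fun x : X => - r ((0, x) : (I * X)%type)).
  move=> c u v; rewrite scalerN -opprD -linearP; congr (- r _).
  by congr (_, _); rewrite /= scaler0 addr0.
pose t := linfun (fun x : X => - r ((0, x) : (I * X)%type)).
have tE x : t x = - r (0, x) by rewrite linfunP.
rewrite (_ : z = cobd X I t) ?tpair_dext_cobd //.
apply: ffunlP => a x; rewrite graded_cobdE; last first.
  move=> i y; rewrite !tE (linearN (vtx I i)) /=.
  have <- : r (vtx (ext_mod zc) i (0, y)) = vtx I i (r (0, y)) by exact: homs_vtx.
  by rewrite /= pair_lfunE /= linear0.
rewrite !tE (linearN (arw I a)) opprK /=.
have <- : r (arw (ext_mod zc) a (0, x)) = arw I a (r (0, x)) by exact: homs_arw.
rewrite /= ext_arwE /= linear0 add0r.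
rewrite (_ : (z a x, arw X a x) = (z a x, 0) + (0, arw X a x)); last first.
  by congr (_, _); rewrite /= ?addr0 ?add0r.
by rewrite linearD /= r1 addrCA addNr addr0.
Qed.

(** Projectivity tested by [dext]; it is equivalent to [projective] by [projective_dext] and
    [ext_projective_projective], and its passage to submodules is immediate. *)
Definition ext_projective V := forall Y, dext V Y = 0%VS.

Lemma ext_projective_lift V X Y (g : 'Hom(X, Y)) (h : 'Hom(V, Y)) :
  ext_projective V -> g \in homs X Y -> limg g = fullv -> h \in homs V Y ->
  exists2 h', h' \in homs V X & (g \o h')%VF = h.
Proof.
move=> V0 gh g1 hh; have [K [i se]] := short_exact_lker gh g1.
have [s sg gs] := graded_section gh g1.
have [z zc zE] := ext_cocycle_ex se sg gs.
apply: (ext_liftP se sg gs zc zE hh) => u; rewrite V0 memv0 => /eqP ->.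
by rewrite linear0 lfE.
Qed.

Lemma ext_projective_projective V : ext_projective V -> projective V.
Proof. by move=> V0 X Y g h gh g1 hh; exact: ext_projective_lift. Qed.

(** Heredity of the path algebra: [post j] embeds [dext V Y] into [dext X Y], which is zero. *)
Lemma ext_projective_sub V X (j : 'Hom(V, X)) :
  j \in homs V X -> lker j = 0%VS -> ext_projective X -> ext_projective V.
Proof.
move=> jh j0 X0 Y; apply: vspace0P => g gD; apply: (post_inj j0).
have := dext_post jh gD; rewrite X0 memv0 => /eqP ->.
by apply: ffunlP => a x; rewrite postE !ffunE !lfE linear0.
Qed.

(** [dim_ext1] is chosen by [xget] with default 0, so its value is known only once a projective
    presentation exists. A cover provides one. *)
Definition proj_covered X :=
  exists (P : qmod k Q) (p : 'Hom(P, X)),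
    [/\ ext_projective P, p \in homs P X & limg p = fullv].

(** [K] is projective as a submodule of [P], so [chi] gives the dimensions of Hom(K, Y) and Hom(P,
    Y). Left exactness of Hom(-, Y) and additivity of [chi] then determine the cokernel, whatever
    the presentation. *)
Lemma is_dim_ext1E X Y d : is_dim_ext1 X Y d -> d = \dim (dext X Y).
Proof.
case=> K [P [i [p [Pp se ->]]]]; have P0 := fun Y => projective_dext Y Pp.
have K0 : ext_projective K.
  by case: se => ih _ /eqP i0 _ _; exact: ext_projective_sub ih i0 P0.
have eK := homs_dext_chi K Y; have eP := homs_dext_chi P Y; have eX := homs_dext_chi X Y.
rewrite K0 dimv0 subr0 in eK; rewrite P0 dimv0 subr0 in eP.
have : \dim (homs P Y) = (\dim (homs X Y) + \dim (precomp Y i @: homs P Y))%N.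
  rewrite -(limg_ker_dim (precomp Y i) (homs P Y)); congr (_ + _)%N.
  case: se => ih ph i0 /eqP ip /eqP p1.
  have <- : (precomp Y p @: homs X Y = homs P Y :&: lker (precomp Y i))%VS.
    apply/vspaceP => f; apply/memv_imgP/memv_capP => [[h hh ->]|[fh]].
      rewrite precompE memv_ker precompE; split; first exact: homs_comp.
      apply/eqP/lfunP => x; rewrite !lfE (_ : p (i x) = 0) ?linear0 //.
      by apply/eqP; rewrite -memv_ker -ip memv_img ?memvf.
    rewrite memv_ker precompE => /eqP fi.
    have [|h hh fE] := hom_factor_surj ph p1 fh.
      rewrite -ip; apply/subvP => _ /memv_imgP[x _ ->].
      by have /lfunP/(_ x) := fi; rewrite memv_ker !lfE => ->.
    by exists h; rewrite ?precompE.
  rewrite limg_dim_eq //; apply: vspace0P => h /memv_capP[_].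
  rewrite memv_ker precompE => /eqP hp; apply/lfunP => x.
  have := memvf x; rewrite -p1 => /memv_imgP[y _ ->].
  by have /lfunP/(_ y) := hp; rewrite !lfE.
have := congr1 (fun v => chi Q v (dimvec Y)) (dimvec_short_exact se).
rewrite /= chiDl -eK -eP -eX => e1 e2; rewrite e2 PoszD in e1.
by move: e1; lia.
Qed.

End Projectives.

Section Covers.
Variables (k : fieldType) (m : nat) (Q : quiver m).
Implicit Types X Y Z V E M N P : qmod k Q.

Lemma dim_ext1E X Y : proj_covered X -> dim_ext1 X Y = \dim (dext X Y).
Proof.
case=> P [p [P0 ph p1]]; have [K [i se]] := short_exact_lker ph p1.
apply: is_dim_ext1E; apply: classical_sets.xgetPex.
exists (\dim (homs K Y) - \dim (precomp Y i @: homs P Y))%N.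
by exists K, P, i, p; split=> //; exact: ext_projective_projective.
Qed.

Lemma eulerE X Y : proj_covered X -> euler X Y = chi Q (dimvec X) (dimvec Y).
Proof. by move=> Xc; rewrite /euler dim_ext1E // homs_dext_chi. Qed.

Lemma proj_covered_surj X Y (f : 'Hom(X, Y)) :
  f \in homs X Y -> limg f = fullv -> proj_covered X -> proj_covered Y.
Proof.
move=> fh f1 [P [p [P0 ph p1]]]; exists P, (f \o p)%VF.
by split=> //; [exact: homs_comp | rewrite limg_comp p1].
Qed.

Definition pair_map (U V W : vectType k) (f : 'Hom(U, V)) (g : 'Hom(U, W)) :
  'Hom(U, (V * W)%type) := linfun (fun x => (f x, g x)).

Lemma pair_mapE (U V W : vectType k) (f : 'Hom(U, V)) (g : 'Hom(U, W)) x :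
  pair_map f g x = (f x, g x).
Proof. by rewrite linfunP // => c u v; rewrite !linearP. Qed.

Lemma pair_map_hom X Y Z (f : 'Hom(X, Y)) (g : 'Hom(X, Z)) :
  f \in homs X Y -> g \in homs X Z ->
  (pair_map f g : 'Hom(X, dsum Y Z)) \in homs X (dsum Y Z).
Proof.
move=> fh gh; apply: homsI => [i|a] x; rewrite !pair_mapE /= pair_lfunE /=.
  by rewrite (homs_vtx _ _ fh) (homs_vtx _ _ gh).
by rewrite (homs_arw _ _ fh) (homs_arw _ _ gh).
Qed.

Definition dsum_fst X Y : 'Hom(dsum X Y, X) := linfun (fun w : (X * Y)%type => w.1).
Definition dsum_snd X Y : 'Hom(dsum X Y, Y) := linfun (fun w : (X * Y)%type => w.2).

Lemma dsum_fstE X Y w : dsum_fst X Y w = w.1. Proof. by rewrite linfunP. Qed.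
Lemma dsum_sndE X Y w : dsum_snd X Y w = w.2. Proof. by rewrite linfunP. Qed.

Lemma dsum_fst_hom X Y : dsum_fst X Y \in homs (dsum X Y) X.
Proof. by apply: homsI => [i|a] w; rewrite !dsum_fstE /= pair_lfunE. Qed.

Lemma dsum_snd_hom X Y : dsum_snd X Y \in homs (dsum X Y) Y.
Proof. by apply: homsI => [i|a] w; rewrite !dsum_sndE /= pair_lfunE. Qed.

Lemma qiso_split X Y (p : 'Hom(X, Y)) (s : 'Hom(Y, X)) :
  p \in homs X Y -> s \in homs Y X -> (p \o s)%VF = \1%VF ->
  exists K, qiso X (dsum Y K).
Proof.
move=> ph sh /lfunP psE; have ps y : p (s y) = y by have := psE y; rewrite !lfE.
have p1 : limg p = fullv.
  apply/eqP; rewrite eqEsubv subvf; apply/subvP => y _.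
  by rewrite -[y]ps memv_img ?memvf.
have [K [i [ih _ i0 /eqP iE _]]] := short_exact_lker ph p1.
have dh : (\1 - (s \o p))%VF \in homs X X.
  by rewrite rpredB ?homs_id // (homs_comp sh ph).
have [|r rh rE] := hom_factor_inj ih (eqP i0) dh.
  rewrite iE; apply/subvP => _ /memv_imgP[x _ ->].
  by rewrite memv_ker !lfE linearB /= ps subrr.
have ir x : i (r x) = x - s (p x) by have /lfunP/(_ x) := rE; rewrite !lfE.
exists K, (pair_map p r); split; first exact: pair_map_hom.
  apply/eqP/vspace0P => x; rewrite memv_ker pair_mapE => /eqP e.
  have px : p x = 0 := congr1 fst e; have rx : r x = 0 := congr1 snd e.
  by have := ir x; rewrite rx px (linear0 i) (linear0 s) subr0 => <-.
rewrite eqEsubv subvf; apply/subvP => -[y z] _; apply/memv_imgP.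
exists (s y + i z); rewrite ?memvf // pair_mapE linearD /= ps.
have pi : p (i z) = 0 by apply/eqP; rewrite -memv_ker -iE memv_img ?memvf.
rewrite pi addr0; congr (_, _); have /lker0P := i0; apply.
by rewrite ir linearD /= ps pi addr0 addrAC subrr add0r.
Qed.

(** The image of [f] is a submodule of [P], hence projective, hence a summand of [X], hence zero. *)
Lemma hom_to_projective_eq0 X P f :
  no_projective_summand X -> ext_projective P -> f \in homs X P -> f = 0.
Proof.
move=> Xn P0 fh.
have [L [j [g [[jh j0 _] [gh g1 fE]]]]] := hom_image fh.
have L0 := ext_projective_sub jh j0 P0.
have [s sh gs] := ext_projective_lift L0 gh g1 (homs_id L).
have [K iso] := qiso_split gh sh gs.
have := Xn _ _ (ext_projective_projective L0) iso => /eqP; rewrite dimv_eq0 => /eqP L00.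
apply/lfunP => x; rewrite fE lfE; have := memvf (g x).
by rewrite L00 memv0 => /eqP ->; rewrite linear0.
Qed.

End Covers.

(** * The path algebra *)

Section AcyclicWalks.
Variables (m : nat) (Q : quiver m) (Q_acyclic : acyclic Q).

Definition adj : rel 'I_m := fun i j => [exists a : arrow Q, (src a == i) && (tgt a == j)].

(** The induction measure that acyclicity provides. It drops strictly along arrows, so walks have
    length at most [m]; it also drives the nilpotency argument for socles. *)
Definition height (i : 'I_m) : nat := #|connect adj i|.

Lemma connect_walk i j : connect adj i j ->
  exists2 s : seq (arrow Q), walk i s & last i (map (@tgt m Q) s) = j.
Proof.
case/connectP => p; elim: p i => [|l p IH] i /=; first by move=> _ ->; exists [::].
case/andP => /existsP[a /andP[/eqP si /eqP tl]] /IH h /h[s ws ls].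
by exists (a :: s); rewrite /= ?si ?eqxx ?tl.
Qed.

Lemma walk_path a (s : seq (arrow Q)) : walk (tgt a) s ->
  path (fun b c => tgt b == src c) a s /\ last (tgt a) (map (@tgt m Q) s) = tgt (last a s).
Proof.
elim: s a => [|b s IH] a //= /andP[/eqP e /IH[ps ls]].
by rewrite e eqxx ls.
Qed.

Lemma height_lt (a : arrow Q) : (height (tgt a) < height (src a))%N.
Proof.
have sa : connect adj (src a) (tgt a).
  by apply: connect1; apply/existsP; exists a; rewrite !eqxx.
apply: proper_card; apply/properP; split.
  by apply/subsetP => j; rewrite !inE; exact: connect_trans.
exists (src a); rewrite ?inE ?connect0 //; apply/negP.
move=> /connect_walk[s /walk_path[ps ls] e].
by have := Q_acyclic ps; rewrite -ls e eqxx.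
Qed.

Lemma walk_height i (s : seq (arrow Q)) : walk i s ->
  (size s + height (last i (map (@tgt m Q) s)) <= height i)%N.
Proof.
elim: s i => [|a s IH] i //= /andP[/eqP <- /IH le].
by rewrite addSn; apply: leq_ltn_trans le (height_lt a).
Qed.

Lemma walk_size i (s : seq (arrow Q)) : walk i s -> (size s <= m)%N.
Proof.
move=> /walk_height le; rewrite -[X in (_ <= X)%N]card_ord.
apply: leq_trans (max_card (connect adj i)); apply: leq_trans le.
exact: leq_addr.
Qed.

End AcyclicWalks.

Section RegularModule.
Variables (k : fieldType) (m : nat) (Q : quiver m).
Implicit Types (i j : 'I_m) (a b : arrow Q) (s : seq (arrow Q)) (p r : qpath Q).
Local Notation A := (regular_mod k Q).

Lemma qpath_walk p : walk (pstart p) (parrows p).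
Proof. exact: (valP p). Qed.

Lemma qpath_size p : (size (parrows p) <= m)%N.
Proof. exact: size_bseq. Qed.

Lemma qpath_ex i s : walk i s -> (size s <= m)%N ->
  exists p, pstart p = i /\ parrows p = s.
Proof.
move=> w le; pose u : 'I_m * m.-bseq (arrow Q) := (i, Bseq le).
by exists (exist _ u w : qpath Q).
Qed.

Lemma qpath_inj p r : pstart p = pstart r -> parrows p = parrows r -> p = r.
Proof.
rewrite /pstart /parrows; case: p r => [[i s] ws] [[j t] wt] /= e1 e2.
by apply: val_inj; congr (_, _) => //; apply: val_inj.
Qed.

Lemma walk_rcons i s b :
  walk i (rcons s b) = walk i s && (src b == last i (map (@tgt m Q) s)).
Proof. by elim: s i => [|c s IH] i /=; rewrite ?andbT // IH andbA. Qed.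

(* The path with start i and arrows s, or 0 if there is none. *)
Definition path_elt i s : path_space k Q :=
  [ffun p => ((pstart p == i) && (parrows p == s))%:R].

Lemma path_expand (f : path_space k Q) :
  f = \sum_p f p *: path_elt (pstart p) (parrows p).
Proof.
apply/ffunP => r; rewrite sum_ffunE (bigD1 r) //= !ffunE !eqxx big1 ?addr0.
  by rewrite [RHS]mulr1.
move=> p npr; rewrite !ffunE; case: eqP => //= [e1|_]; last by rewrite scaler0.
by case: eqP => [e2|_]; rewrite ?scaler0 //; case/eqP: npr; exact: qpath_inj.
Qed.

Lemma lfun_path_ext (W : vectType k) (f g : 'Hom(path_space k Q, W)) :
  (forall p, f (path_elt (pstart p) (parrows p)) = g (path_elt (pstart p) (parrows p))) -> f = g.
Proof.
move=> e; apply/lfunP => x; rewrite [x]path_expand !linear_sum.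
by apply: eq_bigr => p _; rewrite !linearZ /= e.
Qed.

Lemma sum_path_elt (P : pred (qpath Q)) i s :
  \sum_(r | P r) path_elt i s r = [exists r, [&& P r, pstart r == i & parrows r == s]]%:R.
Proof.
case: existsP => [[r0 /and3P[Pr0 /eqP e1 /eqP e2]]|no].
  rewrite (bigD1 r0) //= ffunE e1 e2 !eqxx big1 ?addr0 // => r /andP[_ nr].
  rewrite ffunE; case: eqP => //= e3; case: eqP => //= e4; case/eqP: nr.
  by apply: qpath_inj; congruence.
rewrite big1 // => r Pr; rewrite ffunE; case: andP => // -[e1 e2].
by case: no; exists r; rewrite Pr e1 e2.
Qed.

Lemma lmul_arw_elt a i s :
  lmul_arw k a (path_elt i s) = if i == tgt a then path_elt (src a) (a :: s) else 0.
Proof.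
apply/ffunP => p; rewrite lmul_arwE sum_path_elt.
have [->|ni] := eqVneq i (tgt a); last first.
  rewrite ffunE; case: existsP => // -[r /andP[/andP[/eqP e _] /andP[/eqP e' _]]].
  by rewrite -e' e eqxx in ni.
rewrite ffunE; congr ((nat_of_bool _)%:R); apply/existsP/andP.
  case=> r /andP[/andP[_ /eqP e1] /andP[_ /eqP e2]]; rewrite e1 e2; split=> //.
  by have := qpath_walk p; rewrite e1 /= eq_sym => /andP[].
case=> /eqP e1 /eqP e2; have := qpath_walk p; have := qpath_size p.
rewrite e2 /= => sz /andP[_ w]; have [r [r1 r2]] := qpath_ex w (ltnW sz).
by exists r; rewrite r1 r2 !eqxx.
Qed.

Lemma lmul_vtx_elt j i s : lmul_vtx k Q j (path_elt i s) = if i == j then path_elt i s else 0.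
Proof.
apply/ffunP => p; rewrite lmul_vtxE; have [->|ni] := eqVneq i j.
  by rewrite ffunE; case: (pstart p == j).
by rewrite !ffunE; case: eqP => // ->; rewrite eq_sym (negPf ni).
Qed.

Lemma rmul_arw_elt b i s : rmul_arw k b (path_elt i s) = path_elt i (rcons s b).
Proof.
apply/ffunP => p; rewrite rmul_arwE sum_path_elt ffunE; congr ((nat_of_bool _)%:R).
apply/existsP/andP => [[r /and3P[/andP[/eqP e1 /eqP e2] /eqP e3 /eqP e4]]|].
  by rewrite -e1 e2 e3 e4 !eqxx.
case=> /eqP e1 /eqP e2; have := qpath_walk p; have := qpath_size p.
rewrite e1 e2 walk_rcons size_rcons => sz /andP[w _].
by have [r [r1 r2]] := qpath_ex w (ltnW sz); exists r; rewrite r1 r2 !eqxx.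
Qed.

Lemma rmul_vtx_elt j i s :
  rmul_vtx k Q j (path_elt i s) = if last i (map (@tgt m Q) s) == j then path_elt i s else 0.
Proof.
apply/ffunP => p; rewrite rmul_vtxE /pend.
have [e|ni] := eqVneq (last i (map (@tgt m Q) s)) j; rewrite !ffunE.
  by case: (eqVneq (last (pstart p) _) j) => // ne; case: eqP => //= e1;
    case: eqP => //= e2; rewrite -e1 -e2 in e; rewrite e eqxx in ne.
case: eqP => // e; case: eqP => //= e1; case: eqP => //= e2.
by rewrite -e1 -e2 e eqxx in ni.
Qed.

Lemma rmul_arw_hom b : rmul_arw k b \in homs A A.
Proof.
apply/homsP; split=> [i|a]; apply: lfun_path_ext => p; rewrite !comp_lfunE /=.
  by rewrite lmul_vtx_elt rmul_arw_elt lmul_vtx_elt; case: eqP; rewrite ?rmul_arw_elt ?linear0.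
by rewrite lmul_arw_elt rmul_arw_elt lmul_arw_elt; case: eqP; rewrite ?rmul_arw_elt ?linear0.
Qed.

Lemma rmul_vtx_hom j : rmul_vtx k Q j \in homs A A.
Proof.
apply/homsP; split=> [i|a]; apply: lfun_path_ext => p; rewrite !comp_lfunE /= rmul_vtx_elt.
  rewrite lmul_vtx_elt; case: (eqVneq _ i) => e; last first.
    by case: ifP; rewrite ?lmul_vtx_elt ?(negPf e) !linear0.
  by rewrite rmul_vtx_elt; case: ifP; rewrite ?linear0 // lmul_vtx_elt e eqxx.
rewrite lmul_arw_elt; case: (eqVneq _ (tgt a)) => e; last first.
  by case: ifP; rewrite ?lmul_arw_elt ?(negPf e) !linear0.
by rewrite rmul_vtx_elt /= -e; case: ifP; rewrite ?linear0 // lmul_arw_elt e eqxx.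
Qed.

Section Action.
Variable Y : qmod k Q.

Definition arw_prod s : 'End(Y) := foldr (fun a f => arw Y a \o f)%VF \1%VF s.

(** The projection to [i] lets the empty path act as the idempotent at [i], and makes a sequence
    that is not a walk from [i] act as 0, in agreement with [path_elt]. *)
Definition path_act i s (y : Y) : Y := vtx Y i (arw_prod s y).

Lemma arw_prod_rcons s b y : arw_prod (rcons s b) y = arw_prod s (arw Y b y).
Proof. by elim: s => [|a s IH] /=; rewrite !lfE // IH. Qed.

Lemma path_act_cons i a s y :
  path_act i (a :: s) y = if i == src a then arw Y a (path_act (tgt a) s y) else 0.
Proof. by rewrite /path_act /= lfE vtx_arw arw_tgt. Qed.

Lemma path_act_vtx i s j y : path_act i s (vtx Y j y) =
  if last i (map (@tgt m Q) s) == j then path_act i s y else 0.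
Proof.
elim: s i => [|a s IH] i; first by rewrite /path_act !lfE vtx_vtx; case: eqP => // ->.
rewrite !path_act_cons IH /=.
by case: ifP => _; case: ifP => _ //; rewrite linear0.
Qed.

Lemma path_act_nwalk i s y : ~~ walk i s -> path_act i s y = 0.
Proof.
elim: s i => [|a s IH] i //=; rewrite path_act_cons eq_sym negb_and.
by case: eqP => //= _ /IH ->; rewrite linear0.
Qed.

Lemma path_act_is_linear i s : linear (path_act i s).
Proof. by move=> c u v; rewrite /path_act !linearP. Qed.

(* Right multiplication by y, the homomorphism A -> Y sending 1 to y. *)
Definition rho (y : Y) : 'Hom(path_space k Q, Y) :=
  linfun (fun f : path_space k Q => \sum_p f p *: path_act (pstart p) (parrows p) y).

Lemma rhoE y f : rho y f = \sum_p f p *: path_act (pstart p) (parrows p) y.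
Proof.
rewrite linfunP // => c u v; rewrite scaler_sumr -big_split; apply: eq_bigr => p _ /=.
by rewrite !ffunE scalerDl scalerA.
Qed.

Lemma rhoD c y y' : rho (c *: y + y') = c *: rho y + rho y'.
Proof.
apply/lfunP => f; rewrite !lfE !rhoE scaler_sumr -big_split; apply: eq_bigr => p _ /=.
by rewrite path_act_is_linear scalerDr !scalerA [c * _]mulrC.
Qed.

Hypothesis Q_acyclic : acyclic Q.

Lemma rho_elt y i s : rho y (path_elt i s) = path_act i s y.
Proof.
rewrite rhoE; have [w|nw] := boolP (walk i s).
  have [p [p1 p2]] := qpath_ex w (walk_size Q_acyclic w).
  rewrite (bigD1 p) //= ffunE p1 p2 !eqxx scale1r big1 ?addr0 // => r nrp.
  rewrite ffunE; case: eqP => /= e1; last by rewrite scale0r.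
  case: eqP => e2; last by rewrite scale0r.
  by case/eqP: nrp; apply: qpath_inj; congruence.
rewrite path_act_nwalk // big1 // => r _; rewrite ffunE.
case: andP => [[/eqP e1 /eqP e2]|_]; last by rewrite scale0r.
by rewrite -e1 -e2 qpath_walk in nw.
Qed.

Lemma rho_hom y : rho y \in homs A Y.
Proof.
apply/homsP; split=> [i|a]; apply: lfun_path_ext => p; rewrite !comp_lfunE /= rho_elt.
  rewrite lmul_vtx_elt /path_act vtx_vtx eq_sym; case: eqP => [->|_]; last by rewrite linear0.
  by rewrite rho_elt.
rewrite lmul_arw_elt /path_act arw_vtx; case: eqP => _; last by rewrite linear0.
by rewrite rho_elt path_act_cons eqxx /path_act arw_tgt.
Qed.

Lemma rho_arw b y : rho (arw Y b y) = (rho y \o rmul_arw k b)%VF.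
Proof.
apply: lfun_path_ext => p; rewrite comp_lfunE rmul_arw_elt !rho_elt.
by rewrite /path_act arw_prod_rcons.
Qed.

Lemma rho_vtx j y : rho (vtx Y j y) = (rho y \o rmul_vtx k Q j)%VF.
Proof.
apply: lfun_path_ext => p; rewrite comp_lfunE rmul_vtx_elt rho_elt path_act_vtx.
by case: ifP; rewrite ?linear0 // rho_elt.
Qed.

End Action.

Definition path_one : path_space k Q := \sum_i path_elt i [::].

Hypothesis Q_acyclic : acyclic Q.

Lemma path_act_one i s : path_act i s (path_one : A) = path_elt i s :> A.
Proof.
elim: s i => [|a s IH] i.
  rewrite /path_act lfE linear_sum (bigD1 i) //= lmul_vtx_elt eqxx big1 ?addr0 //.
  by move=> j /negPf nj; rewrite lmul_vtx_elt nj.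
rewrite path_act_cons IH /= lmul_arw_elt eqxx; case: eqP => [->|ni] //.
apply/ffunP => p; rewrite !ffunE; case: eqP => //= e1; case: eqP => // e2.
by have := qpath_walk p; rewrite e1 e2 /= => /andP[/eqP/esym].
Qed.

Lemma rho_one (Y : qmod k Q) (y : Y) : rho y path_one = y.
Proof.
rewrite linear_sum -[RHS]sum_vtx; apply: eq_bigr => i _ /=.
by rewrite rho_elt // /path_act lfE.
Qed.

Lemma homs_path_act (X Y : qmod k Q) (f : 'Hom(X, Y)) i s x :
  f \in homs X Y -> f (path_act i s x) = path_act i s (f x).
Proof.
move=> fh; rewrite /path_act (homs_vtx _ _ fh); congr (vtx _ _ _).
by elim: s => [|a s IH] /=; rewrite !lfE // (homs_arw _ _ fh) IH.
Qed.

Lemma hom_regular (Y : qmod k Q) (f : 'Hom(A, Y)) : f \in homs A Y -> f = rho (f path_one).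
Proof.
move=> fh; apply: lfun_path_ext => p; rewrite rho_elt // -homs_path_act //.
by rewrite path_act_one.
Qed.

Lemma projective_regular : projective A.
Proof.
move=> X Y g h gh g1 hh; have := memvf (h path_one); rewrite -g1 => /memv_imgP[x _ hE].
exists (rho x); first exact: rho_hom.
have gx : (g \o rho x)%VF \in homs A Y by apply: homs_comp => //; exact: rho_hom.
by rewrite (hom_regular gx) lfE rho_one -hE -hom_regular.
Qed.

Lemma ext_projective_regular : ext_projective A.
Proof. by move=> Y; exact/projective_dext/projective_regular. Qed.

End RegularModule.

(** * The Auslander-Reiten translation *)

Section DualSpace.
Variables (k : fieldType) (V : vectType k).

Lemma dim_dual : \dim {:'Hom(V, k^o)} = \dim {:V}.
Proof. by rewrite !dimvf /dim /= muln1. Qed.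

Lemma dual_nondeg (v : V) : (forall l : 'Hom(V, k^o), l v = 0) -> v = 0.
Proof.
move=> h; rewrite (coord_vbasis (memvf v)) big1 // => i _.
have lin : linear (fun w : V => coord (vbasis {:V}) i w : k^o).
  by move=> c u w; rewrite linearP.
have := h (linfun (fun w : V => coord (vbasis {:V}) i w : k^o)).
by rewrite linfunP // => ->; rewrite scale0r.
Qed.

(** [b] is evaluation of functionals at vectors. The annihilator of [D] under it is zero, so [D] has
    full dimension. *)
Lemma dual_full (D : {vspace 'Hom(V, k^o)}) :
  (forall v, (forall l, l \in D -> l v = 0) -> v = 0) -> D = fullv.
Proof.
move=> h; have lin1 v : linear (fun l : 'Hom(V, k^o) => l v) by move=> c l l'; rewrite !lfE.
have lin2 : linear (fun v : V => linfun (fun l : 'Hom(V, k^o) => l v)).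
  by move=> c v w; apply/lfunP => l; rewrite !lfE !linfunP // linearP.
pose b := linfun (fun v : V => linfun (fun l : 'Hom(V, k^o) => l v)).
have bE v l : b v l = l v by rewrite linfunP // linfunP.
have b0 : lker b = 0%VS.
  apply: vspace0P => v; rewrite memv_ker => /eqP/lfunP v0; apply: dual_nondeg => l.
  by rewrite -bE v0 lfE.
have dV : \dim {:V} = \dim {:'Hom(V, k^o)} by rewrite dim_dual.
have := dim_annv b0 dV D; rewrite (_ : annv b D = 0%VS) ?dimv0 ?add0n => [e|].
  by apply/eqP; rewrite eqEdim subvf e /=.
by apply: vspace0P => v /annvP v0; apply: h => l lD; rewrite -bE v0.
Qed.

End DualSpace.

Lemma lfun_section_on (k : fieldType) (U V : vectType k) (c : 'Hom(U, V)) (H : {vspace U}) :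
  (c @: H)%VS = fullv ->
  exists2 s : 'Hom(V, U), forall z, s z \in H & forall z, c (s z) = z.
Proof.
move=> c1; pose e := (c \o projv H)%VF; exists (projv H \o e^-1)%VF => z.
  by rewrite lfE memv_proj.
have zin : z \in limg e by rewrite limg_comp limg_proj c1 memvf.
by rewrite [(projv H \o _)%VF z]comp_lfunE -[c _]comp_lfunE limg_lfunVK.
Qed.

(** * Representation of D Ext^1 by tau *)

Section Representation.
Variables (k : fieldType) (m : nat) (Q : quiver m).
Implicit Types X Y T : qmod k Q.

(* Since dext X Y = D Ext^1(X, Y), the Auslander-Reiten formula says that tau X
   represents the functor dext X. *)
Definition represents X T (u : {ffun arrow Q -> 'Hom(T, X)}) : Prop :=
  [/\ u \in dext X T,
      forall Y g, g \in dext X Y -> exists2 f, f \in homs Y T & g = pre u f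
    & forall Y (f : 'Hom(Y, T)), f \in homs Y T -> pre u f = 0 -> f = 0].

Hypothesis Q_acyclic : acyclic Q.
Local Notation A := (regular_mod k Q).

(** The image [L] of [p] is projective as a submodule of [P0], so [P1 -> L] splits. The image of the
    splitting and [lker p] span [P1], so superfluity makes the splitting onto. A minimal
    presentation is thus a projective resolution. *)
Lemma minimal_presentation_inj (P1 P0 X : qmod k Q) (p : 'Hom(P1, P0)) (r : 'Hom(P0, X)) :
  minimal_presentation p r -> lker p = 0%VS.
Proof.
case=> -[pP1 pP0] [ph rh] pr r1 [sup _].
have [L [j [q [[jh j0 _] [qh q1 pq]]]]] := hom_image ph.
have L0 := ext_projective_sub jh j0 (fun Y => projective_dext Y pP0).
have j_inj : injective j by apply/lker0P; rewrite j0.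
have [s sh qsE] := ext_projective_lift L0 qh q1 (homs_id L).
have qs y : q (s y) = y by have /lfunP/(_ y) := qsE; rewrite !lfE.
have sf : limg s = fullv.
  apply: sup; first exact: submod_img (submod_full _).
  apply/eqP; rewrite eqEsubv subvf; apply/subvP => x _.
  rewrite -[x](subrKC (s (q x))) memv_add ?memv_img ?memvf //.
  by rewrite memv_ker pq linearB /= qs subrr linear0.
apply: vspace0P => x; rewrite memv_ker pq => /eqP x0.
have := memvf x; rewrite -sf => /memv_imgP[y _ xE].
have : q x = 0 by apply: j_inj; rewrite x0 linear0.
by rewrite xE qs => ->; rewrite linear0.
Qed.

(** Since the presentation is a resolution, Tr X is the right module Ext^1(X, A). Hence tau X = D Tr
    X is [dext X A], with the action induced by right multiplication on the path algebra. *)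
Lemma tau_dual X T : is_tau X T ->
  exists gam : 'Hom(T, {ffun arrow Q -> 'Hom(A, X)}),
  [/\ lker gam = 0%VS, limg gam = dext X A,
      forall i t, gam (vtx T i t) = pre (gam t) (rmul_vtx k Q i)
    & forall b t, gam (arw T b t) = pre (gam t) (rmul_arw k b)].
Proof.
case=> Tr [P1 [P0 [p [r [c [mp c1 cker cvtx carw]]]]]] [th [thh th0 th1]].
have p0 := minimal_presentation_inj mp.
case: mp => -[pP1 pP0] [ph rh] pr r1 _.
have se : short_exact p r by split=> //; rewrite p0.
have [s sg rs] := graded_section rh (eqP r1).
have [w wc wE] := ext_cocycle_ex se sg rs.
have dimTr : \dim (dext X A) = \dim {:Tr}.
  rewrite -c1 -(is_dim_ext1E (d := \dim (homs P1 A) - \dim (precomp A p @: homs P0 A))%N).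
    by rewrite -cker capvC -(limg_ker_dim c (homs P1 A)) addKn.
  by exists P1, P0, p, r.
have [sec secH cK] := lfun_section_on c1.
have plin : linear (fun h : 'Hom(P1, A) => post h w).
  by move=> a h h'; apply: ffunlP => b x; rewrite !ffunE !lfE.
have [pw pwE] : exists pw : 'Hom('Hom(P1, A), {ffun arrow Q -> 'Hom(X, A)}),
    forall h, pw h = post h w.
  by exists (linfun (fun h : 'Hom(P1, A) => post h w)) => h; rewrite linfunP.
(* An element of [Tr] lifts to some [h : P1 -> A], whose class in Ext^1(X, A) is that of the pushout
   of the presentation along [h]. [Phi] pairs [dext X A] with this class; [PhiC] shows independence
   of the lift. *)
have [Phi PhiE] : exists Phi : 'Hom({ffun arrow Q -> 'Hom(A, X)}, 'Hom(Tr, k^o)),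
    forall g z, Phi g z = tpair _ X A g (post (sec z) w).
  exists (precomp k^o (pw \o sec) \o tpair _ X A)%VF => g z.
  by rewrite comp_lfunE precompE !comp_lfunE pwE.
have retr := fun q qh => ext_retractP (Z := A) (q := q) se sg rs wc wE qh.
have PhiC g h : g \in dext X A -> h \in homs P1 A -> Phi g (c h) = tpair _ X A g (post h w).
  move=> gD hH; rewrite PhiE -[sec (c h)](subrKC h) -!pwE linearD (linearD (tpair _ X A g)).
  have : sec (c h) - h \in (lker c :&: homs P1 A)%VS.
    by rewrite memv_cap memv_ker linearB /= cK subrr eqxx rpredB.
  rewrite cker => /memv_imgP[f fH ->]; rewrite precompE /= !pwE.
  have [h1 _] := retr _ (homs_comp fH ph).
  by rewrite h1 ?addr0 //; exists f.
(* The functionals in the image separate points: if all of them kill [z], the pushout along [sec z]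
   splits, so [sec z] factors through [p] and [z = 0]. Equality of dimensions will make [Phi]
   injective on [dext X A]. *)
have PhiD : (Phi @: dext X A)%VS = fullv.
  apply: dual_full => z z0; rewrite -[z]cK.
  have [_ h2] := retr _ (secH z).
  have [g gD|f fH fE] := h2; first by rewrite -PhiC // cK z0 // memv_img.
  apply/eqP; rewrite -memv_ker; apply: (subvP (capvSl _ (homs P1 A))).
  by rewrite cker; apply/memv_imgP; exists f; rewrite ?precompE.
have dimT : \dim (dext X A) = \dim {:T}.
  rewrite dimTr -(limg_dim_eq (f := th) (U := fullv)) ?(eqP th0) ?capv0 // (eqP th1).
  by rewrite dim_dual.
have Phi_inj g g' : g \in dext X A -> g' \in dext X A -> Phi g = Phi g' -> g = g'.
  move=> gD gD' e; apply/subr0_eq/eqP; rewrite -memv0.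
  have <- : (dext X A :&: lker Phi)%VS = 0%VS.
    apply/eqP; rewrite -dimv_eq0 -(eqn_add2r (\dim (Phi @: dext X A))).
    by rewrite limg_ker_dim PhiD dimTr dim_dual.
  by rewrite memv_cap rpredB // memv_ker linearB /= e subrr.
have [inv invD invE] := lfun_section_on PhiD.
pose gam := (inv \o th)%VF.
have gamD t : gam t \in dext X A by rewrite lfE invD.
have gamE t : Phi (gam t) = th t by rewrite lfE invE.
have gam0 : lker gam = 0%VS.
  apply: vspace0P => t; rewrite memv_ker => /eqP t0.
  have /lker0P := th0; apply; rewrite -gamE t0 !linear0.
  by [].
move: gam gamD gamE gam0 => gam gamD gamE gam0.
exists gam; split=> //.
- apply/eqP; rewrite eqEdim; apply/andP; split.
    by apply/subvP => _ /memv_imgP[t _ ->].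
  by rewrite limg_dim_eq ?gam0 ?capv0 // dimT.
- move=> i t; have Rh := rmul_vtx_hom k Q i.
  have pD := dext_pre Rh (gamD t); apply: (Phi_inj _ _ (gamD _) pD).
  apply/lfunP => z; rewrite gamE (homs_vtx _ _ thh) -[z]cK PhiC //.
  rewrite tpair_pre (_ : post _ (post _ w) = post (rmul_vtx k Q i \o sec z)%VF w).
    rewrite -PhiC //; last exact: homs_comp Rh (secH z).
    by rewrite -cvtx // gamE /= precompE lfE.
  by apply: ffunlP => a x; rewrite !postE lfE.
- move=> b t; have Rh := rmul_arw_hom k b.
  have pD := dext_pre Rh (gamD t); apply: (Phi_inj _ _ (gamD _) pD).
  apply/lfunP => z; rewrite gamE (homs_arw _ _ thh) -[z]cK PhiC //.
  rewrite tpair_pre (_ : post _ (post _ w) = post (rmul_arw k b \o sec z)%VF w).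
    rewrite -PhiC //; last exact: homs_comp Rh (secH z).
    by rewrite -carw // gamE /= precompE lfE.
  by apply: ffunlP => a x; rewrite !postE lfE.
Qed.

Lemma path_elt_arrow (a : arrow Q) i : i != src a -> path_elt k i [:: a] = 0.
Proof.
move=> ni; apply/ffunP => p; rewrite !ffunE; case: eqP => //= e1; case: eqP => // e2.
by have := qpath_walk p; rewrite e1 e2 /= andbT eq_sym (negPf ni).
Qed.

Lemma lmul_vtx_one i : lmul_vtx k Q i (path_one k Q) = @path_elt k m Q i [::].
Proof.
rewrite linear_sum (bigD1 i) //= lmul_vtx_elt eqxx big1 ?addr0 // => j /negPf nj.
by rewrite lmul_vtx_elt nj.
Qed.

Lemma rmul_vtx_one i : rmul_vtx k Q i (path_one k Q) = @path_elt k m Q i [::].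
Proof.
rewrite linear_sum (bigD1 i) //= rmul_vtx_elt eqxx big1 ?addr0 // => j /negPf nj.
by rewrite rmul_vtx_elt nj.
Qed.

Lemma lmul_arw_one (a : arrow Q) : lmul_arw k a (path_one k Q) = path_elt k (src a) [:: a].
Proof.
rewrite linear_sum (bigD1 (tgt a)) //= lmul_arw_elt eqxx big1 ?addr0 // => j /negPf nj.
by rewrite lmul_arw_elt nj.
Qed.

Lemma rmul_arw_one (a : arrow Q) : rmul_arw k a (path_one k Q) = path_elt k (src a) [:: a].
Proof.
rewrite linear_sum (bigD1 (src a)) //= rmul_arw_elt big1 ?addr0 // => j nj.
by rewrite rmul_arw_elt path_elt_arrow.
Qed.

(** Yoneda for Hom(A, T) = T: the universal family [u] is the value of [gam] at the unit of the path
    algebra. A family [g] in [dext X Y] yields the homomorphism that sends [y] to the element of [T]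
    corresponding to [pre g (rho y)]. *)
Lemma tau_represents X T : is_tau X T -> exists u, @represents X T u.
Proof.
case/tau_dual => gam [gam0 gam1 gvtx garw].
have gam_inj : injective gam by apply/lker0P; rewrite gam0.
have gamD t : gam t \in dext X A by rewrite -gam1 memv_img ?memvf.
have ulin a : linear (fun t => gam t a (path_one k Q)).
  by move=> c t t'; rewrite linearP !ffunE !lfE.
pose u := [ffun a => linfun (fun t => gam t a (path_one k Q))].
have uE a t : u a t = gam t a (path_one k Q) by rewrite ffunE linfunP.
have gdl s i t a : gam t a (path_elt k i s) = u a (path_act i s t).
  elim/last_ind: s t => [|s b IH] t.
    by rewrite /path_act lfE uE gvtx preE rmul_vtx_one.
  by rewrite /path_act arw_prod_rcons -/(path_act i s _) -IH garw preE rmul_arw_elt.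
have gu t : gam t = pre u (rho t).
  apply/ffunP => a; rewrite ffunE; apply: lfun_path_ext => p.
  by rewrite gdl lfE rho_elt.
have uD : u \in dext X T.
  apply/dextP; split=> [a t|t].
    rewrite !uE gvtx preE rmul_vtx_one -lmul_vtx_one.
    exact: (dextE1 _ _ (gamD t)).
  under eq_bigr do rewrite uE; rewrite (dextE2 (path_one k Q : A) (gamD t)).
  by apply: eq_bigr => a _; rewrite uE garw preE rmul_arw_one /= lmul_arw_one.
exists u; split=> // Y.
  move=> g gD; have gin y : pre g (rho y) \in limg gam.
    by rewrite gam1; apply: dext_pre gD; exact: rho_hom.
  have flin : linear (fun y => (gam^-1)%VF (pre g (rho y))).
    move=> c y y'; apply: gam_inj; rewrite linearP /= !limg_lfunVK //.
    by apply: ffunlP => a x; rewrite rhoD !ffunE !lfE linearP.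
  pose f := linfun (fun y => (gam^-1)%VF (pre g (rho y))).
  have fE y : gam (f y) = pre g (rho y) by rewrite linfunP // limg_lfunVK.
  exists f; last by apply: ffunlP => a y; rewrite preE uE fE preE rho_one.
  apply: homsI => [i|a] y; apply: gam_inj.
    by rewrite gvtx !fE rho_vtx //; apply: ffunlP => a x; rewrite !preE lfE.
  by rewrite garw !fE rho_arw //; apply: ffunlP => b x; rewrite !preE lfE.
move=> f fh uf; apply/lfunP => y; rewrite lfE; apply: gam_inj; rewrite linear0 gu.
have -> : rho (f y) = (f \o rho y)%VF.
  have fr : (f \o rho y)%VF \in homs A T by apply: homs_comp => //; exact: rho_hom.
  by rewrite (hom_regular Q_acyclic fr) lfE rho_one.
apply: ffunlP => a x; have /ffunP/(_ a)/lfunP/(_ (rho y x)) := uf.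
by rewrite !preE !ffunE !lfE.
Qed.

End Representation.

Section DirectSums.
Variables (k : fieldType) (m : nat) (Q : quiver m).
Implicit Types X Y Z : qmod k Q.

Definition dsum_inl X Y : 'Hom(X, dsum X Y) := linfun (fun x => (x, 0) : (X * Y)%type).
Definition dsum_inr X Y : 'Hom(Y, dsum X Y) := linfun (fun y => (0, y) : (X * Y)%type).

Lemma dsum_inlE X Y x : dsum_inl X Y x = (x, 0).
Proof. by rewrite linfunP // => c u v; congr (_, _); rewrite /= scaler0 addr0. Qed.

Lemma dsum_inrE X Y y : dsum_inr X Y y = (0, y).
Proof. by rewrite linfunP // => c u v; congr (_, _); rewrite /= scaler0 addr0. Qed.

Lemma dsum_inl_hom X Y : dsum_inl X Y \in homs X (dsum X Y).
Proof. by apply: homsI => [i|a] x; rewrite !dsum_inlE /= pair_lfunE /= linear0. Qed.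

Lemma dsum_inr_hom X Y : dsum_inr X Y \in homs Y (dsum X Y).
Proof. by apply: homsI => [i|a] x; rewrite !dsum_inrE /= pair_lfunE /= linear0. Qed.

Lemma dsum_inl_snd X Y w : w = dsum_inl X Y w.1 + dsum_inr X Y w.2.
Proof.
by case: w => x y; rewrite dsum_inlE dsum_inrE; congr (_, _); rewrite /= ?addr0 ?add0r.
Qed.

Lemma dsum_short_exact X Y : short_exact (dsum_inl X Y) (dsum_snd X Y).
Proof.
split; [exact: dsum_inl_hom | exact: dsum_snd_hom | | |].
- by apply/eqP/vspace0P => x; rewrite memv_ker dsum_inlE => /eqP[].
- apply/eqP/vspaceP => w; rewrite memv_ker dsum_sndE.
  apply/memv_imgP/eqP => [[x _ ->]|w2]; first by rewrite dsum_inlE.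
  by exists w.1; rewrite ?memvf // [LHS]dsum_inl_snd w2 linear0 addr0.
- rewrite eqEsubv subvf; apply/subvP => y _.
  by rewrite (_ : y = dsum_snd X Y (0, y)) ?memv_img ?memvf // dsum_sndE.
Qed.

Lemma dimvec_dsum X Y : dimvec (dsum X Y) = dimvec X + dimvec Y.
Proof. exact: dimvec_short_exact (dsum_short_exact X Y). Qed.

Lemma hom_inverse X Y (f : 'Hom(X, Y)) :
  f \in homs X Y -> lker f = 0%VS -> limg f = fullv ->
  exists g, [/\ g \in homs Y X, cancel f g & cancel g f].
Proof.
move=> fh f0 f1; have [|g gh gE] := hom_factor_inj fh f0 (homs_id Y).
  by rewrite f1 subvf.
have gK : cancel g f by move=> y; have /lfunP/(_ y) := gE; rewrite !lfE.
have f_inj : injective f by apply/lker0P; rewrite f0.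
by exists g; split=> // x; apply: f_inj; rewrite gK.
Qed.

Lemma dimvec_iso X Y (f : 'Hom(X, Y)) :
  f \in homs X Y -> lker f = 0%VS -> limg f = fullv -> dimvec X = dimvec Y.
Proof.
by move=> fh f0 f1; rewrite (dimvec_ker_img fh) f0 f1 sub_dimvec0 add0r.
Qed.

Lemma tau_covered X T : is_tau X T -> proj_covered X.
Proof.
case=> Tr [P1 [P0 [p [r [c [[[_ pP0] [_ rh] _ r1 _] _ _ _ _]]]]]] _.
by exists P0, r; split=> //; [move=> Y; exact: projective_dext | exact/eqP].
Qed.

End DirectSums.

Section Delta.
Variables (m : nat) (Q : quiver m).

Lemma dimvec_simple (k : fieldType) i : dimvec (simple_mod k Q i) = delta_mx i 0.
Proof.
apply/colP => j; rewrite dimvecE mxE andbT /= /simple_vtx.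
case: eqP => _; last by rewrite lim0g dimv0.
by rewrite lim1g dimvf.
Qed.

Lemma covered_simple (k : fieldType) i : acyclic Q -> proj_covered (simple_mod k Q i).
Proof.
move=> Qa; exists (regular_mod k Q), (rho (1 : simple_mod k Q i)); split.
- exact: ext_projective_regular.
- exact: rho_hom.
apply/eqP; rewrite eqEsubv subvf; apply/subvP => c _; apply/memv_imgP.
exists (rho (c : simple_mod k Q i) (path_one k Q) *: path_one k Q); rewrite ?memvf //.
have r1 := rho_one Qa (1 : simple_mod k Q i).
rewrite linearZ rho_one //; apply: etrans (congr1 (fun w : k^o => c *: w) (esym r1)).
by rewrite /GRing.scale /= mulr1.
Qed.

End Delta.

(** * The Coxeter relation and full faithfulness of tau *)

Section Translate.
Variables (k : fieldType) (m : nat) (Q : quiver m) (Q_acyclic : acyclic Q).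
Implicit Types X Y Z T : qmod k Q.

Lemma represents_dim X T u Y : @represents k m Q X T u ->
  \dim (homs Y T) = \dim (dext X Y).
Proof.
case=> uD uex uun.
have lin : linear (fun f : 'Hom(Y, T) => pre u f).
  by move=> c f g; apply: ffunlP => a x; rewrite !ffunE !lfE linearP.
pose F := linfun (fun f : 'Hom(Y, T) => pre u f).
have FE f : F f = pre u f by rewrite linfunP.
have -> : dext X Y = (F @: homs Y T)%VS.
  apply/vspaceP => g; apply/idP/memv_imgP => [gD|[f fh ->]].
    by have [f fh ->] := uex _ _ gD; exists f; rewrite ?FE.
  by rewrite FE dext_pre.
rewrite limg_dim_eq //; apply: vspace0P => f /memv_capP[fh].
by rewrite memv_ker FE => /eqP; exact: uun.
Qed.

Lemma pre_post (U V W W' : vectType k) (I : finType) (p : 'Hom(W, W'))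
    (g : {ffun I -> 'Hom(V, W)}) (f : 'Hom(U, V)) :
  post p (pre g f) = pre (post p g) f.
Proof. by apply: ffunlP => a x; rewrite !(postE, preE). Qed.

(* A module without projective summands is generated by the image of the
   universal element: a homomorphism killing it factors through a projective. *)
Lemma represents_generates X T u Z (f : 'Hom(X, Z)) :
  proj_covered X -> no_projective_summand X -> @represents k m Q X T u ->
  f \in homs X Z -> post f u = 0 -> f = 0.
Proof.
move=> Xc Xn [uD uex _] fh fu.
have [L [j [q [[jh j0 _] [qh q1 fE]]]]] := hom_image fh.
have qu : post q u = 0.
  apply: (post_inj j0); apply: ffunlP => a x; have /ffunP/(_ a)/lfunP/(_ x) := fu.
  by rewrite !postE fE !ffunE !lfE linear0.
have [P [r [P0 rh r1]]] := proj_covered_surj qh q1 Xc.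
have [K [i se]] := short_exact_lker rh r1.
have [s sg rs] := graded_section rh r1.
have [z zc zE] := ext_cocycle_ex se sg rs.
have [g gD|l lh lE] := ext_liftP se sg rs zc zE qh.
  have [t _ ->] := uex _ _ gD; rewrite -tpair_post pre_post qu.
  by rewrite (_ : pre 0 t = 0) ?linear0 ?lfE //; apply: ffunlP => a x; rewrite !ffunE !lfE.
apply/lfunP => x; rewrite fE -lE (hom_to_projective_eq0 Xn P0 lh).
by rewrite !lfE !linear0.
Qed.

(** Both sides are the dimension of D Ext^1(X, P): the left one as that of Hom(P, tau X), the right
    one because Hom(X, P) = 0. *)
Lemma coxeter_projective X T u (P : qmod k Q) :
  no_projective_summand X -> @represents k m Q X T u -> ext_projective P ->
  chi Q (dimvec P) (dimvec T) = - chi Q (dimvec X) (dimvec P).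
Proof.
move=> Xn Xr P0; rewrite -!homs_dext_chi (represents_dim _ Xr) P0 dimv0 subr0.
suff -> : homs X P = 0%VS by rewrite dimv0 sub0r opprK.
by apply: vspace0P => f; exact: hom_to_projective_eq0.
Qed.

(** Both sides are linear in [y], and a unit vector is the difference of the dimension vectors of
    two projectives: a cover of a simple module and its kernel. *)
Lemma coxeter X T u (y : 'cV[int]_m) :
  no_projective_summand X -> @represents k m Q X T u ->
  chi Q y (dimvec T) = - chi Q (dimvec X) y.
Proof.
move=> Xn Xr.
have simp i : chi Q (delta_mx i 0) (dimvec T) = - chi Q (dimvec X) (delta_mx i 0).
  rewrite -(dimvec_simple Q k); have [P [r [P0 rh r1]]] := covered_simple k i Q_acyclic.
  have [K [j se]] := short_exact_lker rh r1.
  have K0 : ext_projective K.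
    by case: se => jh _ /eqP j0 _ _; exact: ext_projective_sub jh j0 P0.
  have /eqP := dimvec_short_exact se; rewrite addrC -subr_eq => /eqP <-.
  by rewrite chiBl chiBr !(coxeter_projective Xn Xr) //; ring.
by rewrite chi_deltal chi_deltar -sumrN; apply: eq_bigr => i _; rewrite simp mulrN.
Qed.

(** The map sending [f] to [post f u] is injective by [represents_generates], and onto because the
    Coxeter relation gives Hom(X, Z) and [dext Z T] the same dimension. When [T'] represents
    [dext Z], this says that maps [X -> Z] correspond to maps [T -> T']. *)
Lemma represents_couniversal X T u Z (g : {ffun arrow Q -> 'Hom(T, Z)}) :
  proj_covered X -> no_projective_summand X -> @represents k m Q X T u ->
  g \in dext Z T -> exists2 f, f \in homs X Z & g = post f u.
Proof.
move=> Xc Xn Xr; have [uD _ _] := Xr.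
have lin : linear (fun f : 'Hom(X, Z) => post f u).
  by move=> c f h; apply: ffunlP => a x; rewrite !ffunE !lfE.
pose F := linfun (fun f : 'Hom(X, Z) => post f u).
have FE f : F f = post f u by rewrite linfunP.
have -> : dext Z T = (F @: homs X Z)%VS.
  apply/esym/eqP; rewrite eqEdim; apply/andP; split.
    by apply/subvP => _ /memv_imgP[f fh ->]; rewrite FE dext_post.
  rewrite limg_dim_eq; last first.
    apply: vspace0P => f /memv_capP[fh]; rewrite memv_ker FE => /eqP.
    exact: (represents_generates Xc Xn Xr fh).
  have := homs_dext_chi Z T; have := homs_dext_chi X Z.
  rewrite (coxeter _ Xn Xr) (represents_dim _ Xr) => <-.
  by rewrite opprB => /addrI /oppr_inj[->].
by case/memv_imgP => f fh ->; exists f; rewrite ?FE.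
Qed.

End Translate.

(** * The surjection from M to A0 *)

Section Structure.
Variables (k : fieldType) (m : nat) (Q : quiver m) (Q_acyclic : acyclic Q).
Variables (M N tauM D0 A tauA I M' P0 : qmod k Q).
Variables (d : 'Hom(D0, N)) (f : 'Hom(N, tauM)) (c : 'Hom(tauM, dsum tauA I)).
Hypotheses (tauM_def : is_tau M tauM) (tauA_def : is_tau A tauA).
Hypotheses (I_injective : injective_mod I) (A_no_proj : no_projective_summand A).
Hypotheses (d_hom : d \in homs D0 N) (f_hom : f \in homs N tauM)
  (c_hom : c \in homs tauM (dsum tauA I)).
Hypotheses (f_neq0 : f != 0) (d_inj : lker d = 0%VS) (exact_N : exact_at d f)
  (exact_tauM : exact_at f c) (c_surj : limg c = fullv).
Hypotheses (M_split : qiso M (dsum M' P0)) (P0_projective : projective P0)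
  (M'_no_proj : no_projective_summand M').

Lemma injective_factor_out (X : qmod k Q) (v : {ffun arrow Q -> 'Hom(dsum tauA I, X)}) :
  v \in dext X (dsum tauA I) -> v = pre (pre v (dsum_inl tauA I)) (dsum_fst tauA I).
Proof.
move=> vD; apply: ffunlP => a w; rewrite [w in LHS]dsum_inl_snd linearD /= !preE dsum_fstE.
have : pre v (dsum_inr tauA I) \in dext X I by apply: dext_pre vD; exact: dsum_inr_hom.
rewrite injective_dext // memv0 => /eqP/ffunP/(_ a)/lfunP/(_ w.2).
by rewrite preE !ffunE lfE => ->; rewrite addr0.
Qed.

Lemma exchange_structure :
  exists (g : {ffun arrow Q -> 'Hom(N, M)}) (psi : 'Hom(M, dsum A P0)),
  [/\ [/\ g \in dext M N, g <> 0, psi \in homs M (dsum A P0) & limg psi = fullv],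
      forall U : {vspace N}, submod U ->
        ((forall a, U <= lker (g a))%VS <-> (U <= limg d)%VS),
      forall V : {vspace M}, submod V ->
        ((forall a, limg (g a) <= V)%VS <-> (lker psi <= V)%VS)
    & forall x, chi Q x (dimvec N - dimvec D0) =
        - chi Q (dimvec M - dimvec (dsum A P0)) x - chi Q x (dimvec I)].
Proof.
have [uM [uMD uMex uMun]] := tau_represents Q_acyclic tauM_def.
have [uA uAr] := tau_represents Q_acyclic tauA_def.
have Mc := tau_covered tauM_def; have Ac := tau_covered tauA_def.
case: M_split => F [Fh /eqP F0 /eqP F1].
have [G [Gh FG GF]] := hom_inverse Fh F0 F1.
pose p1 := (dsum_fst M' P0 \o F)%VF; pose p2 := (dsum_snd M' P0 \o F)%VF.
pose i1 := (G \o dsum_inl M' P0)%VF.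
have p1h : p1 \in homs M M' := homs_comp (dsum_fst_hom M' P0) Fh.
have p2h : p2 \in homs M P0 := homs_comp (dsum_snd_hom M' P0) Fh.
have i1h : i1 \in homs M' M := homs_comp Gh (dsum_inl_hom M' P0).
have p1i1 x : p1 (i1 x) = x by rewrite !lfE GF dsum_fstE dsum_inlE.
have p12 x z : exists w, p1 w = x /\ p2 w = z.
  by exists (G (x, z)); rewrite !lfE GF dsum_fstE dsum_sndE.
have i1p1 x : p2 x = 0 -> i1 (p1 x) = x.
  rewrite !lfE dsum_sndE dsum_fstE => e; rewrite -[RHS]FG [F x in RHS]dsum_inl_snd e.
  by rewrite linear0 addr0.
move: p1 p2 i1 p1h p2h i1h p1i1 p12 i1p1 => p1 p2 i1 p1h p2h i1h p1i1 p12 i1p1.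
(* The composite with [M -> P0] lies in [dext P0 Y], which is zero, so families with values in [M]
   take values in the summand [M']. *)
have p2D (Y : qmod k Q) (g : {ffun arrow Q -> 'Hom(Y, M)}) a y :
    g \in dext M Y -> p2 (g a y) = 0.
  move=> gD; have := dext_post p2h gD; rewrite projective_dext // memv0 => /eqP/ffunP/(_ a).
  by move=> /lfunP/(_ y); rewrite postE !ffunE lfE.
(* Hence [tauM] represents [dext M'] as well, and [M'] has no projective summand, as
   [represents_couniversal] requires. *)
pose u := post p1 uM; have uD : u \in dext M' tauM := dext_post p1h uMD.
have ur : represents u.
  split=> // [Y g gD|Y h hh uh].
    have [h hh e] := uMex _ _ (dext_post i1h gD); exists h => //.
    by rewrite -pre_post -e; apply: ffunlP => a y; rewrite !postE p1i1.
  apply: (uMun _ _ hh); apply: ffunlP => a y.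
  have hD := dext_pre hh uMD; rewrite -[LHS]i1p1; last exact: p2D hD.
  have /ffunP/(_ a)/lfunP/(_ y) := uh; rewrite !preE postE => ->.
  by rewrite !ffunE !lfE linear0.
have uE a t : uM a t = i1 (u a t) by rewrite postE i1p1 //; exact: p2D uMD.
have p1s : limg p1 = fullv.
  apply/eqP; rewrite eqEsubv subvf; apply/subvP => x _.
  by rewrite -[x]p1i1 memv_img ?memvf.
have M'c := proj_covered_surj p1h p1s Mc.
have c1h := homs_comp (dsum_fst_hom tauA I) c_hom.
have [uAD _ _] := uAr.
(* [s : M' -> A] is the homomorphism that induces the first component of [c] on translates. *)
have [s sh sE] := represents_couniversal Q_acyclic M'c M'_no_proj ur (dext_pre c1h uAD).
have sE' a t : s (u a t) = uA a (c t).1.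
  by have /ffunP/(_ a)/lfunP/(_ t) := sE; rewrite preE postE lfE dsum_fstE.
(* The cokernel map [q] of [s] kills the universal family of [A], because the first component of [c]
   is onto; such a map is zero. *)
have s1 : limg s = fullv.
  have [Z [q [qh q1 qE]]] := quotient_model (submod_img sh (submod_full M')).
  suff q0 : q = 0 by rewrite -qE q0; apply/vspaceP => x; rewrite memv_ker lfE eqxx memvf.
  apply: (represents_generates Ac A_no_proj uAr qh); apply: ffunlP => a t.
  rewrite postE !ffunE lfE; have : dsum_inl tauA I t \in limg c by rewrite c_surj memvf.
  case/memv_imgP => y _; rewrite dsum_inlE => /(congr1 fst) /= ->.
  by apply/eqP; rewrite -memv_ker qE -sE' memv_img ?memvf.
pose g := pre uM f; have gD : g \in dext M N := dext_pre f_hom uMD.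
pose psi : 'Hom(M, dsum A P0) := pair_map (s \o p1)%VF p2.
have psih : psi \in homs M (dsum A P0) by apply: pair_map_hom => //; exact: homs_comp.
have psiE x : psi x = (s (p1 x), p2 x) by rewrite pair_mapE lfE.
have psi1 : limg psi = fullv.
  apply/eqP; rewrite eqEsubv subvf; apply/subvP => -[y z] _.
  have /memv_imgP[x _ ->] : y \in limg s by rewrite s1 memvf.
  have [w [<- <-]] := p12 x z; rewrite -psiE memv_img ?memvf //.
have psi0 x : (x \in lker psi) = (s (p1 x) == 0) && (p2 x == 0).
  by rewrite memv_ker psiE -pair_eqE.
exists g, psi; split.
- split=> // g0; case/eqP: f_neq0; exact: uMun f_hom g0.
(* By uniqueness in the representation of [dext M], the family [g] vanishes on a submodule exactly
   when [f] does. *)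
- move=> U Us; rewrite (eqP exact_N); split=> [h|h a]; last first.
    apply/subvP => y /(subvP h); rewrite !memv_ker preE => /eqP ->.
    by rewrite linear0.
  have [U' [j [jh j0 jE]]] := submod_model Us.
  have fj : (f \o j)%VF = 0.
    apply: (uMun _ _ (homs_comp f_hom jh)); apply: ffunlP => a y.
    have : j y \in lker (g a) by rewrite (subvP (h a)) // -jE memv_img ?memvf.
    by rewrite memv_ker !preE lfE => /eqP ->; rewrite !ffunE lfE.
  rewrite -jE; apply/subvP => _ /memv_imgP[y _ ->].
  by have /lfunP/(_ y) := fj; rewrite memv_ker !lfE => ->.
- move=> V Vs; split=> [h|h a]; last first.
    apply/subvP => _ /memv_imgP[y _ ->]; apply: (subvP h).
    rewrite psi0 (p2D _ _ _ _ gD) eqxx andbT preE uE p1i1 sE'.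
    have : f y \in lker c by rewrite -(eqP exact_tauM) memv_img ?memvf.
    by rewrite memv_ker => /eqP ->; rewrite linear0.
  (* If [V] contains the values of [g], the family induced in M/V vanishes on the image of [f]. It
     descends along [c] to tau A + I, then to tau A, where it comes from some [x : A -> M/V]. So
     [M' -> M/V] factors through [s]. *)
  have [Z [q [qh q1 qE]]] := quotient_model Vs.
  have qi := homs_comp qh i1h; have hD := dext_post qi uD.
  have [|v vD hE] := dext_factor_surj c_hom c_surj hD.
    move=> a; rewrite -(eqP exact_tauM); apply/subvP => _ /memv_imgP[y _ ->].
    rewrite memv_ker postE lfE -uE -memv_ker qE (subvP (h a)) //.
    by rewrite -preE memv_img ?memvf.
  have vE := injective_factor_out vD.
  have vAD := dext_pre (dsum_inl_hom tauA I) vD.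
  have [x xh xE] := represents_couniversal Q_acyclic Ac A_no_proj uAr vAD.
  have qx : ((q \o i1) - (x \o s))%VF = 0.
    apply: (represents_generates M'c M'_no_proj ur).
      by rewrite rpredB // homs_comp.
    apply: ffunlP => a t; rewrite [in RHS]ffunE [in RHS]lfE postE !lfE sE'.
    have /ffunP/(_ a)/lfunP/(_ t) := hE; rewrite postE comp_lfunE => ->.
    by rewrite vE xE !preE postE dsum_fstE subrr.
  apply/subvP => w; rewrite psi0 => /andP[/eqP w1 /eqP w2].
  rewrite -qE memv_ker -[w]i1p1 //.
  have /lfunP/(_ (p1 w)) := qx; rewrite !lfE w1 linear0 subr0 => ->.
  by [].
(* The image of [f] is counted in both [N] and [tauM]; exactness at [tauM] expresses it by [tauM],
   [tauA] and [I], to which the Coxeter relations apply. *)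
- move=> x.
  have eN : dimvec N = dimvec D0 + sub_dimvec (limg f).
    by rewrite (dimvec_ker_img f_hom) -(eqP exact_N) (dimvec_model d_hom d_inj).
  have eT : dimvec tauM = sub_dimvec (limg f) + dimvec tauA + dimvec I.
    by rewrite (dimvec_ker_img c_hom) c_surj -(eqP exact_tauM) -addrA -dimvec_dsum.
  have eM : dimvec M = dimvec M' + dimvec P0 by rewrite (dimvec_iso Fh F0 F1) dimvec_dsum.
  have := coxeter Q_acyclic x M'_no_proj ur; have := coxeter Q_acyclic x A_no_proj uAr.
  rewrite eN eT eM dimvec_dsum !(chiDl, chiDr, chiNl, chiNr, chiBl, chiBr) => -> e.
  have -> : chi Q x (sub_dimvec (limg f))
      = - chi Q (dimvec M') x + chi Q (dimvec A) x - chi Q x (dimvec I).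
    by rewrite -e; ring.
  by ring.
Qed.

End Structure.

(** * Counting submodules of an extension *)

Section Fibres.
Variables (k : finFieldType) (m : nat) (Q : quiver m).
Variables (N E M : qmod k Q) (i : 'Hom(N, E)) (p : 'Hom(E, M)).

Definition fibre (U : {vspace N}) (V : {vspace M}) : {set {vspace E}} :=
  [set W | [&& submod W, (i @^-1: W)%VS == U & (p @: W)%VS == V]].

Hypothesis se : short_exact i p.
Variables (V' Z : qmod k Q) (j : 'Hom(V', M)) (q : 'Hom(N, Z)).
Hypotheses (jh : j \in homs V' M) (j0 : lker j = 0%VS).
Hypotheses (qh : q \in homs N Z) (q1 : limg q = fullv).

(** The pullback of the extension along [j], realised as the preimage of [limg j] in [E]; it
    contains every member of a fibre over [limg j]. *)
Lemma fibre_pullback : exists (E' : qmod k Q) (e : 'Hom(E', E)) (i' : 'Hom(N, E'))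
    (p' : 'Hom(E', V')),
  [/\ e \in homs E' E, lker e = 0%VS & limg e = (p @^-1: limg j)%VS] /\
  [/\ short_exact i' p', forall n, e (i' n) = i n & forall x, j (p' x) = p (e x)].
Proof.
case: se => ih ph i0 /eqP ip /eqP p1.
have Vs := submod_img jh (submod_full V').
have [E' [e [eh e0 eE]]] := submod_model (submod_preim ph Vs).
have i_inj : injective i by apply/lker0P.
have e_inj : injective e by apply/lker0P; rewrite e0.
have j_inj : injective j by apply/lker0P; rewrite j0.
have pi n : p (i n) = 0 by apply/eqP; rewrite -memv_ker -ip memv_img ?memvf.
have pe x : p (e x) \in limg j by rewrite memv_preim -eE memv_img ?memvf.
have [|i' i'h i'E] := hom_factor_inj eh e0 ih.
  by rewrite eE; apply/subvP => _ /memv_imgP[n _ ->]; rewrite -memv_preim pi mem0v.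
have [|p' p'h p'E] := hom_factor_inj jh j0 (homs_comp ph eh).
  by apply/subvP => _ /memv_imgP[x _ ->]; rewrite lfE.
have ei n : e (i' n) = i n by rewrite i'E lfE.
have jp x : j (p' x) = p (e x) by have /lfunP/(_ x) := p'E; rewrite !lfE.
exists E', e, i', p'; split=> //; split=> //; split=> //.
- by apply/lker0P => n n' /(congr1 e); rewrite !ei => /i_inj.
- apply/eqP/vspaceP => x; apply/memv_imgP/idP => [[n _ ->]|].
    by rewrite memv_ker; apply/eqP/j_inj; rewrite jp ei pi linear0.
  rewrite memv_ker => /eqP x0; have : e x \in limg i.
    by rewrite ip memv_ker -jp x0 linear0.
  by case/memv_imgP => n _; rewrite -ei => /e_inj ->; exists n; rewrite ?memvf.
- rewrite eqEsubv subvf; apply/subvP => y _.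
  have : j y \in limg p by rewrite p1 memvf.
  case/memv_imgP => w _ yw; have : w \in limg e.
    by rewrite eE -memv_preim -yw memv_img ?memvf.
  case/memv_imgP => x _ wE; have <- : p' x = y by apply: j_inj; rewrite jp -wE.
  by rewrite memv_img ?memvf.
Qed.

Section Retractions.
Variables (E' : qmod k Q) (e : 'Hom(E', E)) (i' : 'Hom(N, E')) (p' : 'Hom(E', V')).
Hypotheses (eh : e \in homs E' E) (e0 : lker e = 0%VS)
  (eE : limg e = (p @^-1: limg j)%VS).
Hypotheses (se' : short_exact i' p') (ei : forall n, e (i' n) = i n)
  (jp : forall x, j (p' x) = p (e x)).

(** Members of the fibre are the kernels of extensions [r] of [q] to [E']. Such a kernel maps onto
    [limg j]: as [q] is onto, any element of [E'] can be moved into the kernel by an element of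
    [N]. *)
Lemma retraction_fibre r : r \in homs E' Z -> (r \o i')%VF = q ->
  (e @: lker r)%VS \in fibre (lker q) (limg j).
Proof.
move=> rh rE; have ri n : r (i' n) = q n by rewrite -rE lfE.
have e_inj : injective e by apply/lker0P; rewrite e0.
case: se' => i'h p'h i'0 /eqP ip' /eqP p'1.
rewrite inE; apply/and3P; split; first exact/(submod_img eh)/(submod_lker rh).
  apply/eqP/vspaceP => n; rewrite -memv_preim memv_ker -ri -memv_ker -ei.
  by apply/memv_imgP/idP => [[x xr /e_inj ->]|nr] //; exists (i' n).
apply/eqP/vspaceP => v; apply/memv_imgP/memv_imgP => [[_ /memv_imgP[x _ ->] ->]|[y _ ->]].
  by exists (p' x); rewrite ?memvf ?jp.
have : y \in limg p' by rewrite p'1 memvf.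
case/memv_imgP => x _ ->; have : r x \in limg q by rewrite q1 memvf.
case/memv_imgP => n _ xn; have pn : p' (i' n) = 0.
  by apply/eqP; rewrite -memv_ker -ip' memv_img ?memvf.
exists (e (x - i' n)); last by rewrite -jp linearB /= pn subr0.
by rewrite memv_img // memv_ker linearB /= ri xn subrr.
Qed.

(** The inverse construction. For a linear section [s] of [p'] with values in [W], the element
    [x - s (p' x)] comes from [N], and its image under [q] defines [r x]. This is a homomorphism
    because [W] is a submodule. *)
Lemma fibre_retraction W : W \in fibre (lker q) (limg j) ->
  exists r, [/\ r \in homs E' Z, (r \o i')%VF = q & W = (e @: lker r)%VS].
Proof.
rewrite inE => /and3P[Ws /eqP iW /eqP pW].
case: se' => i'h p'h i'0 /eqP ip' /eqP p'1.
have e_inj : injective e by apply/lker0P; rewrite e0.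
have i_inj : injective i' by apply/lker0P.
have j_inj : injective j by apply/lker0P; rewrite j0.
have We w : w \in W -> exists2 x, w = e x & e x \in W.
  move=> wW; have : w \in limg e by rewrite eE -memv_preim -pW memv_img.
  by case/memv_imgP => x _ we; exists x; rewrite -?we.
have pe : (p' @: (e @^-1: W))%VS = fullv.
  apply/eqP; rewrite eqEsubv subvf; apply/subvP => y _.
  have : j y \in (p @: W)%VS by rewrite pW memv_img ?memvf.
  case/memv_imgP => w /We[x -> xW]; rewrite -jp => /j_inj ->.
  by rewrite memv_img // -memv_preim.
have [s sW ps] := lfun_section_on pe.
have [t tE] : exists t : 'Hom(E', N), forall x, i' (t x) = x - s (p' x).
  exists (i'^-1 \o (\1 - (s \o p')))%VF => x.
  by rewrite !lfE limg_lfunVK // ip' memv_ker linearB /= ps subrr.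
have pi n : p' (i' n) = 0 by apply/eqP; rewrite -memv_ker -ip' memv_img ?memvf.
have rW x : e x \in W -> q (t x) = 0.
  move=> xW; apply/eqP; rewrite -memv_ker -iW -memv_preim -ei tE linearB /=.
  by rewrite rpredB // memv_preim sW.
have ri n : q (t (i' n)) = q n.
  by congr (q _); apply: i_inj; rewrite tE pi linear0 subr0.
exists (q \o t)%VF; split.
- have xE x : x = i' (t x) + s (p' x) by rewrite tE subrK.
  have esW y : e (s y) \in W by rewrite memv_preim.
  apply: homsI => [l|a] x; rewrite !comp_lfunE [x in LHS]xE !linearD /=.
    rewrite -(homs_vtx _ _ i'h) ri [X in _ + X]rW ?addr0 ?(homs_vtx _ _ qh) //.
    by rewrite (homs_vtx _ _ eh) submod_vtx.
  rewrite -(homs_arw _ _ i'h) ri [X in _ + X]rW ?addr0 ?(homs_arw _ _ qh) //.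
  by rewrite (homs_arw _ _ eh) submod_arw.
- by apply/lfunP => n; rewrite !lfE ri.
- apply/vspaceP => w; apply/idP/memv_imgP => [/We[x -> xW]|[x]].
    by exists x; rewrite // memv_ker lfE rW.
  rewrite memv_ker lfE => x0 ->.
  rewrite -[x](subrK (s (p' x))) -tE linearD /= rpredD //; last by rewrite memv_preim.
  by rewrite ei memv_preim iW memv_ker.
Qed.

(** Two extensions of [q] differ by a homomorphism that factors through [p']. Distinct extensions
    have distinct kernels, because the restriction [q] is already onto. *)
Lemma card_retractions r0 : r0 \in homs E' Z -> (r0 \o i')%VF = q ->
  #|fibre (lker q) (limg j)| = (#|k| ^ \dim (homs V' Z))%N.
Proof.
move=> r0h r0E; case: se' => i'h p'h i'0 /eqP ip' /eqP p'1.
have e_inj : injective e by apply/lker0P; rewrite e0.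
pose H : {vspace finvect_type 'Hom(V', Z)} := homs V' Z.
pose R (h : 'Hom(V', Z)) : 'Hom(E', Z) := r0 + (h \o p')%VF.
pose F (h : finvect_type 'Hom(V', Z)) := (e @: lker (R h))%VS.
have pi n : p' (i' n) = 0 by apply/eqP; rewrite -memv_ker -ip' memv_img ?memvf.
have rh (h : 'Hom(V', Z)) : h \in homs V' Z -> R h \in homs E' Z.
  by move=> hh; rewrite rpredD // homs_comp.
have ri (h : 'Hom(V', Z)) : (R h \o i')%VF = q.
  apply/lfunP => n; rewrite -r0E /R !lfE pi linear0 addr0 //.
have -> : fibre (lker q) (limg j) = [set F h | h in H].
  apply/setP => W; apply/idP/imsetP => [/fibre_retraction[r [rh' rE ->]]|[h hH ->]].
    have [||h hh hE] := hom_factor_surj (f := r - r0) p'h p'1.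
    - by rewrite rpredB.
    - rewrite -ip'; apply/subvP => _ /memv_imgP[n _ ->].
      have /lfunP/(_ n) := rE; rewrite -r0E memv_ker !lfE => ->.
      by rewrite subrr.
    by exists h => //; rewrite /F /R -hE subrKC.
  by apply: retraction_fibre; [exact: rh | exact: ri].
rewrite card_in_imset ?card_vspace // => h h' hH hH' /eqP.
rewrite /F eq_limg_ker0 ?e0 // => /eqP kerE; apply/lfunP => y.
have : y \in limg p' by rewrite p'1 memvf.
case/memv_imgP => x _ ->; apply: (addrI (r0 x)).
have : R h x \in limg q by rewrite q1 memvf.
case/memv_imgP => n _ xn.
have : x - i' n \in lker (R h').
  by rewrite -kerE memv_ker linearB /= xn -comp_lfunE ri subrr.
rewrite memv_ker linearB /= -comp_lfunE ri -xn subr_eq0 => /eqP.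
by rewrite /R !lfE.
Qed.

End Retractions.

Lemma card_fibre (W : {vspace E}) : W \in fibre (lker q) (limg j) ->
  #|fibre (lker q) (limg j)| = (#|k| ^ \dim (homs V' Z))%N.
Proof.
move=> WF; have [E' [e [i' [p' [[eh e0 eE] [se' ei jp]]]]]] := fibre_pullback.
have [r [rh rE _]] := fibre_retraction eh e0 eE se' ei jp WF.
by have -> := card_retractions eh e0 eE se' ei jp rh rE.
Qed.

(** [ext_retractP] for the pullback extension: the obstruction to extending [q] is the image of the
    class of [E] in Ext^1(V', Z). *)
Lemma fibre_neq0P (s : 'Hom(M, E)) (z : {ffun arrow Q -> 'Hom(M, N)}) :
  graded s -> (forall x, p (s x) = x) -> cocycle z -> ext_cocycle i s z ->
  (exists W, W \in fibre (lker q) (limg j)) <->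
  (forall g, g \in dext V' Z -> tpair _ V' Z g (post q (pre z j)) = 0).
Proof.
move=> sg ps zc zE.
have [E' [e [i' [p' [[eh e0 eE] [se' ei jp]]]]]] := fibre_pullback.
have j_inj : injective j by apply/lker0P; rewrite j0.
have e_inj : injective e by apply/lker0P; rewrite e0.
have [s' sE] : exists s' : 'Hom(V', E'), forall y, e (s' y) = s (j y).
  exists (e^-1 \o s \o j)%VF => y; rewrite !lfE limg_lfunVK // eE -memv_preim ps.
  by rewrite memv_img ?memvf.
have sg' : graded s'.
  by move=> l y; apply: e_inj; rewrite (homs_vtx _ _ eh) !sE (homs_vtx _ _ jh) sg.
have ps' y : p' (s' y) = y by apply: j_inj; rewrite jp sE ps.
have zc' := cocycle_pre zc jh.
have zE' : ext_cocycle i' s' (pre z j).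
  move=> a y; apply: e_inj; rewrite ei preE zE linearB /= (homs_arw _ _ eh) !sE.
  by rewrite (homs_arw _ _ jh).
have [h1 h2] := ext_retractP se' sg' ps' zc' zE' qh.
split=> [[W /(fibre_retraction eh e0 eE se' ei jp)[r [rh rE _]]]|/h2[r rh rE]].
  by apply: h1; exists r.
by exists (e @: lker r)%VS; exact: (retraction_fibre eh e0 se' ei jp rh rE).
Qed.

End Fibres.

(** * The quantum Caldero-Chapoton map *)

Section Socle.
Variables (k : finFieldType) (m : nat) (Q : quiver m) (Q_acyclic : acyclic Q).
Variable I : qmod k Q.

(** The span [W] of the images of [U] under arrows is a submodule, so it is 0 or [U]. In the second
    case every element is a sum of arrow images, and induction on [height] makes [U] zero. *)
Lemma simple_submod_killed (U : {vspace I}) a u :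
  simple_submod U -> u \in U -> arw I a u = 0.
Proof.
case/and3P => Us Un /forallP min uU.
pose W := (\sum_b (arw I b @: U))%VS.
have WU : (W <= U)%VS.
  by apply/subv_sumP => b _; apply/subvP => _ /memv_imgP[v vU ->]; exact: submod_arw.
have Wa b v : v \in U -> arw I b v \in W.
  by move=> vU; apply: (subvP (sumv_sup b isT (subvv _))); rewrite memv_img.
have Ws : submod W.
  apply/submodP; split=> [i|b] v vW; last by rewrite Wa // (subvP WU).
  have /memv_sumP[w wW ->] := vW; rewrite linear_sum rpred_sum //= => b _.
  have /memv_imgP[x xU ->] := wW b isT; rewrite vtx_arw.
  by case: ifP => _; rewrite ?mem0v ?Wa.
have := min W; rewrite Ws WU /= => /orP[/eqP WE|/eqP W0]; last first.
  by have := Wa a _ uU; rewrite W0 memv0 => /eqP.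
case/eqP: Un; apply: vspace0P => v vU; rewrite -[v]sum_vtx big1 // => i _.
have [h] := ubnP (height Q i); elim: h i v vU => // h IH i v vU; rewrite ltnS => le.
move: (vU); rewrite -{1}WE => /memv_sumP[w wW ->]; rewrite linear_sum big1 //= => b _.
have /memv_imgP[x xU ->] := wW b isT; rewrite vtx_arw; case: eqP => // ib.
by rewrite -arw_tgt IH ?linear0 // (leq_trans _ le) // ib height_lt.
Qed.

(** For the converse, each nonzero vertex component of an element killed by all arrows spans a
    simple submodule. *)
Lemma mem_soc x : reflect (forall a, arw I a x = 0) (x \in soc I).
Proof.
apply: (iffP idP) => [/memv_sumP[v vU ->] a|h].
  rewrite linear_sum big1 // => U Us /=.
  exact: simple_submod_killed (vU U Us).
rewrite -[x]sum_vtx rpred_sum // => i _; have [->|yn0] := eqVneq (vtx I i x) 0.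
  exact: mem0v.
set y := vtx I i x in yn0 *.
suff ys : simple_submod <[y]>%VS.
  by apply: (subvP (sumv_sup <[y]>%VS ys (subvv _))); exact: memv_line.
apply/and3P; split.
- apply/submodP; split=> [j|a] _ /vlineP[c ->]; rewrite linearZ memvZ //=.
    by rewrite /y vtx_vtx; case: eqP => [->|_]; rewrite ?mem0v ?memv_line.
  by rewrite /y arw_vtx h if_same mem0v.
- by rewrite -dimv_eq0 dim_vline yn0.
- apply/forallP => W; apply/implyP => /andP[_ Wy].
  rewrite -[W == 0%VS]dimv_eq0 eqEdim Wy /= dim_vline yn0.
  by case: (\dim W).
Qed.

Lemma sub_dimvec_soc i :
  sub_dimvec (soc I) i 0 = (\dim (homs (simple_mod k Q i) I))%:Z.
Proof.
rewrite mxE; congr Posz; apply/esym.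
have evl : linear (fun f : 'Hom(k^o, I) => f 1) by move=> c f g; rewrite !lfE.
pose ev := linfun (fun f : 'Hom(k^o, I) => f 1).
have evE f : ev f = f 1 by rewrite linfunP.
have f1 (f : 'Hom(k^o, I)) (c : k^o) : f c = c *: f 1.
  by rewrite -linearZ /= /GRing.scale /= mulr1.
rewrite -(limg_dim_eq (f := ev)); last first.
  apply: vspace0P => f /memv_capP[_]; rewrite memv_ker evE => /eqP f0.
  by apply/lfunP => c; rewrite f1 f0 scaler0 lfE.
congr (\dim _); apply/vspaceP => x; apply/memv_imgP/memv_imgP => [[f fh ->]|[y ys ->]].
  exists (f 1).
    apply/mem_soc => a.
    by rewrite -(@homs_arw _ _ _ (simple_mod k Q i) I f a 1 fh) /= lfE linear0.
  by rewrite evE -(@homs_vtx _ _ _ (simple_mod k Q i) I f i 1 fh) /= /simple_vtx eqxx lfE.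
have lin : linear (fun c : k^o => c *: vtx I i y).
  by move=> c u v; rewrite scalerDl scalerA.
pose f := linfun (fun c : k^o => c *: vtx I i y).
have fE c : f c = c *: vtx I i y by rewrite linfunP.
exists f; last by rewrite evE fE scale1r.
apply: (@homsI _ _ _ (simple_mod k Q i) I) => [j|a] c; rewrite [in RHS]fE linearZ /=.
  rewrite vtx_vtx /simple_vtx; case: eqP => [->|_]; first by rewrite lfE fE.
  by rewrite lfE linear0 scaler0.
have /mem_soc ya := ys; rewrite lfE linear0 arw_vtx ya.
by rewrite if_same scaler0.
Qed.

(** The socle at [i] has the dimension of Hom(S_i, I), and Ext^1(S_i, I) = 0. This turns the
    exponent dim P/rad P into an Euler form. *)
Lemma top_dimvecE P i : top_iso_soc P I -> injective_mod I ->
  top_dimvec P i 0 = chi Q (delta_mx i 0) (dimvec I).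
Proof.
case=> f [fh f0 f1] Ii.
have -> : top_dimvec P = sub_dimvec (soc I).
  by rewrite /top_dimvec (dimvec_ker_img fh) f0 f1 addrAC subrr add0r.
by rewrite sub_dimvec_soc -(dimvec_simple Q k) -homs_dext_chi injective_dext // dimv0 subr0.
Qed.

End Socle.

(** * The exponent matrices in terms of the Euler form *)

Section EulerMatrices.
Variables (k : finFieldType) (m n : nat) (le_nm : (n <= m)%N) (Q : quiver m).
Hypothesis Q_acyclic : acyclic Q.

Lemma chi_delta i j :
  chi Q (delta_mx i 0) (delta_mx j 0) = (i == j)%:R - (narrows Q j i)%:Z.
Proof.
rewrite /chi (bigD1 i) //= !mxE !eqxx big1 => [|l /negPf nl]; last first.
  by rewrite mxE nl mul0r.
rewrite mul1r addr0 andbT; congr (_ - _); rewrite /narrows -sum1_card -natz natr_sum.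
rewrite [RHS]big_mkcond /=; apply: eq_bigr => a _; rewrite !mxE !andbT inE.
by case: (tgt a == i); case: (src a == j).
Qed.

Lemma dim_homs_simple i j :
  \dim (homs (simple_mod k Q i) (simple_mod k Q j)) = (i == j) :> nat.
Proof.
have [<-|nij] := eqVneq i j.
  have -> : homs (simple_mod k Q i) (simple_mod k Q i) = fullv.
    apply/eqP; rewrite eqEsubv subvf; apply/subvP => f _.
    apply: (@homsI _ _ _ (simple_mod k Q i) (simple_mod k Q i)) => [l|a] x /=.
      by rewrite /simple_vtx; case: eqP => _; rewrite !lfE // linear0.
    by rewrite !lfE linear0.
  by rewrite dimvf.
have -> : homs (simple_mod k Q i) (simple_mod k Q j) = 0%VS; last by rewrite dimv0.
apply: vspace0P => f fh; apply/lfunP => x; rewrite lfE.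
have := @homs_vtx _ _ _ (simple_mod k Q i) (simple_mod k Q j) f i x fh.
by rewrite /= /simple_vtx eqxx (negPf nij) !lfE.
Qed.

Lemma euler_simple i j :
  euler (simple_mod k Q i) (simple_mod k Q j) = chi Q (delta_mx i 0) (delta_mx j 0).
Proof. by rewrite eulerE ?dimvec_simple //; exact: covered_simple. Qed.

Lemma euler_vecE x y : euler_vec k Q x y = chi Q x y.
Proof.
rewrite chi_deltal; apply: eq_bigr => i _; rewrite [in RHS]chi_deltar mulr_sumr.
by apply: eq_bigr => j _; rewrite euler_simple mulrA.
Qed.

Lemma ext1_simple i j : (dim_ext1 (simple_mod k Q i) (simple_mod k Q j))%:Z
  = (i == j)%:R - chi Q (delta_mx i 0) (delta_mx j 0).
Proof.
rewrite -euler_simple /euler dim_homs_simple.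
by case: eqP => _; rewrite opprB addrCA subrr addr0.
Qed.

Local Notation J := (Imx m n).
Local Notation w := (widen_ord le_nm).

Lemma ord_widenP (i : 'I_m) : (exists j, i = w j) \/ (n <= i)%N.
Proof.
have [lt|le] := ltnP i n; [left; exists (Ordinal lt) | by right].
exact: val_inj.
Qed.

Lemma Imx_widen (y : 'cV[int]_n) j : (J *m y) (w j) 0 = y j 0.
Proof.
rewrite mxE (bigD1 j) //= mxE /= eqxx ltn_ord mul1r big1 ?addr0 // => l nl.
by rewrite mxE /= eq_sym (negPf (nl : (l : nat) != j)) mul0r.
Qed.

Lemma Imx_frozen (y : 'cV[int]_n) (i : 'I_m) : (n <= i)%N -> (J *m y) i 0 = 0.
Proof.
move=> le; rewrite mxE big1 // => j _; rewrite mxE [(i < n)%N]ltnNge le andbF.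
exact: mul0r.
Qed.

Lemma sum_Imx (y : 'cV[int]_n) (F : 'I_m -> int) :
  \sum_i (J *m y) i 0 * F i = \sum_j y j 0 * F (w j).
Proof.
under eq_bigr do rewrite mxE mulr_suml.
rewrite exchange_big; apply: eq_bigr => j _ /=.
rewrite (bigD1 (w j)) //= mxE /= eqxx ltn_ord mul1r big1 ?addr0 // => i ni.
by rewrite mxE (negPf (ni : (i : nat) != j)) !mul0r.
Qed.

End EulerMatrices.

Section Exponents.
Variables (m : nat) (Q : quiver m).
Implicit Types v : 'cV[int]_m.

(** With [chir], the vectors of Euler forms against the simple modules. By [mul_IR] and [mul_B], the
    matrix [J - R] becomes [chil], and [B] becomes [chil - chir]. *)
Definition chil v : 'cV[int]_m := \col_i chi Q (delta_mx i 0) v.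
Definition chir v : 'cV[int]_m := \col_i chi Q v (delta_mx i 0).

Lemma chilE v i : chil v i 0 = chi Q (delta_mx i 0) v.
Proof. by rewrite [LHS]mxE. Qed.

Lemma chirE v i : chir v i 0 = chi Q v (delta_mx i 0).
Proof. by rewrite [LHS]mxE. Qed.

Lemma chilD u v : chil (u + v) = chil u + chil v.
Proof. by apply/colP => i; rewrite [RHS]mxE !chilE chiDr. Qed.

Lemma chirD u v : chir (u + v) = chir u + chir v.
Proof. by apply/colP => i; rewrite [RHS]mxE !chirE chiDl. Qed.

Lemma chil_form u v : (u^T *m chil v) 0 0 = chi Q u v.
Proof.
rewrite chi_deltal mxE; apply: eq_bigr => i _.
by rewrite [u^T _ _]mxE chilE.
Qed.

Lemma chir_form u v : (u^T *m chir v) 0 0 = chi Q v u.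
Proof.
rewrite chi_deltar mxE; apply: eq_bigr => i _.
by rewrite [u^T _ _]mxE chirE.
Qed.

End Exponents.

Lemma scale_natl (R : nzRingType) (V : lmodType R) d (a : R) (v : V) :
  (d%:R * a) *: v = (a *: v) *+ d.
Proof. by rewrite -scalerA scaler_nat. Qed.

Lemma sumr_const_on (V : nmodType) (I : finType) (A : {set I}) (P : pred I) (F : I -> V) x :
  (forall i, (i \in A) = P i) -> (forall i, P i -> F i = x) ->
  \sum_(i | P i) F i = x *+ #|A|.
Proof. by move=> AP Fx; rewrite -sumr_const; apply: eq_big => // i /Fx. Qed.

Section CCSum.
Variables (k : finFieldType) (m n : nat) (le_nm : (n <= m)%N) (Q : quiver m).
Hypothesis Q_acyclic : acyclic Q.
Variable Lam : 'M[int]_m.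
Local Notation J := (Imx m n).
Local Notation w := (widen_ord le_nm).
Local Notation T := (qtorus k Lam).

Lemma mul_IR (y : 'cV[int]_n) : (J - Rmx k le_nm Q) *m y = chil Q (J *m y).
Proof.
apply/colP => i; rewrite mulmxBl [LHS]mxE [X in _ + X]mxE chilE.
have -> : (Rmx k le_nm Q *m y) i 0
    = \sum_j y j 0 * ((i == w j)%:R - chi Q (delta_mx i 0) (delta_mx (w j) 0)).
  rewrite mxE; apply: eq_bigr => j _; rewrite [Rmx _ _ _ _ _]mxE mulrC.
  by rewrite ext1_simple.
rewrite -(sum_Imx le_nm y (fun l => (i == l)%:R - chi Q (delta_mx i 0) (delta_mx l 0))).
under eq_bigr do rewrite mulrBr.
rewrite sumrB -chi_deltar (bigD1 i) //= eqxx mulr1 big1 => [|l /negPf nl].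
  by rewrite addr0 opprB addrC subrK.
by rewrite eq_sym nl mulr0.
Qed.

Lemma mul_B (y : 'cV[int]_n) : Bmx le_nm Q *m y = chil Q (J *m y) - chir Q (J *m y).
Proof.
apply/colP => i; rewrite [RHS]mxE [X in _ = _ + X]mxE chilE chirE.
rewrite chi_deltar (chi_deltal Q (J *m y)).
rewrite (sum_Imx le_nm y (fun l => chi Q (delta_mx i 0) (delta_mx l 0))).
rewrite (sum_Imx le_nm y (fun l => chi Q (delta_mx l 0) (delta_mx i 0))).
rewrite -sumrB mxE; apply: eq_bigr => j _; rewrite [Bmx _ _ _ _]mxE !chi_delta.
by rewrite [w j == i]eq_sym; ring.
Qed.

Lemma Imx_col (v : 'cV[int]_m) : (forall i : 'I_m, (n <= i)%N -> v i 0 = 0) ->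
  J *m (\col_j v (w j) 0) = v.
Proof.
move=> v0; apply/colP => i; have [[j ->]|le] := ord_widenP le_nm i.
  by rewrite Imx_widen mxE.
by rewrite Imx_frozen // v0.
Qed.

Lemma sub_dimvec_frozen (M : qmod k Q) (U : {vspace M}) (i : 'I_m) :
  unfrozen n M -> (n <= i)%N -> sub_dimvec U i 0 = 0.
Proof. by move=> Mu le; rewrite mxE Mu // lim0g dimv0. Qed.

Lemma Imx_udimvec (M : qmod k Q) : unfrozen n M -> J *m udimvec le_nm M = dimvec M.
Proof. by move=> Mu; apply: Imx_col => i; exact: sub_dimvec_frozen. Qed.

(* The summand of X_{M + P[1]} at a submodule of dimension vector e, where M has
   dimension vector t and s is the dimension vector of P / rad P. *)
Definition CCterm (e t s : 'cV[int]_m) : T :=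
  qhalf k (- chi Q e (t - e)) *: (Xpow k (chil Q e - chir Q e - chil Q t + s) : T).

(** Submodules are grouped by dimension vector. The [inord] in [h] loses nothing, as the dimensions
    are at most that of [M]; [Imx_col] recovers the full vector because [M] vanishes at frozen
    vertices. *)
Lemma CCshift_sum (M P : qmod k Q) : unfrozen n M ->
  CCshift le_nm Lam M P =
  \sum_(U : {vspace M} | submod U) CCterm (sub_dimvec U) (dimvec M) (top_dimvec P).
Proof.
move=> Mu; pose h (U : {vspace M}) : {ffun 'I_n -> 'I_(\dim {:M}).+1} :=
  [ffun j => inord (\dim (vtx M (w j) @: U))].
have hE U j : h U j = \dim (vtx M (w j) @: U) :> nat.
  by rewrite ffunE inordK // ltnS dimvS ?subvf.
rewrite [RHS](partition_big h xpredT) //=; apply: eq_bigr => e _.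
set ev := (\col_j _ : 'cV[int]_n).
have GrE U : (U \in Gr M (J *m ev)) = submod U && (h U == e).
  rewrite inE; congr (_ && _); apply/eqP/eqP => [UE|hU].
    apply/ffunP => j; apply: ord_inj; rewrite hE.
    have := congr1 (fun v : 'cV[int]_m => v (w j) 0) UE.
    by rewrite /= Imx_widen !mxE => -[].
  have -> : ev = \col_j sub_dimvec U (w j) 0.
    by apply/colP => j; rewrite !mxE -hU hE.
  by rewrite Imx_col // => i; exact: sub_dimvec_frozen.
have e1 : euler_vec k Q (J *m ev) (J *m (udimvec le_nm M - ev))
    = chi Q (J *m ev) (dimvec M - J *m ev).
  by rewrite euler_vecE // mulmxBr Imx_udimvec.
have e2 : Bmx le_nm Q *m ev - (J - Rmx k le_nm Q) *m udimvec le_nm M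
    = chil Q (J *m ev) - chir Q (J *m ev) - chil Q (dimvec M).
  by rewrite mul_IR Imx_udimvec // mul_B.
cbv zeta beta; rewrite e1 e2 scale_natl.
symmetry; apply: (sumr_const_on GrE) => U UE.
suff -> : J *m ev = sub_dimvec U by [].
by have := UE; rewrite -GrE inE => /andP[_ /eqP ->].
Qed.

End CCSum.

Section Coefficients.
Variable k : finFieldType.

Lemma qhalf_natX (d : nat) : ((#|k| ^ d)%N%:R : Zq k) = qhalf k (2 * d%:Z).
Proof.
apply: val_inj; rewrite rmorph_nat /= natrX -exprz_exp; congr (_ ^+ d).
by rewrite -exprnP Num.Theory.sqrtCK.
Qed.

End Coefficients.

(** * Sizes of fibres as powers of q *)

Section FibreSum.
Variables (k : finFieldType) (m : nat) (Q : quiver m).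
Variables (N E M : qmod k Q) (i : 'Hom(N, E)) (p : 'Hom(E, M)) (se : short_exact i p).

Lemma sub_dimvec_fibre (W : {vspace E}) : submod W ->
  sub_dimvec W = sub_dimvec (i @^-1: W)%VS + sub_dimvec (p @: W)%VS.
Proof.
case: se => ih ph /eqP i0 /eqP ip _ Ws; rewrite (sub_dimvec_img ph Ws); congr (_ + _).
rewrite -(sub_dimvec_inj_img ih (submod_preim ih Ws) i0); congr sub_dimvec.
apply/vspaceP => x; apply/memv_capP/memv_imgP => [[xW]|[n nW ->]].
  by rewrite -ip => /memv_imgP[n _ xE]; exists n; rewrite // -memv_preim -xE.
by rewrite memv_preim nW -ip memv_img ?memvf.
Qed.

Lemma sum_fibres (A : nmodType) (F : 'cV[int]_m -> A) :
  \sum_(W : {vspace E} | submod W) F (sub_dimvec W)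
  = \sum_(U : {vspace N} | submod U) \sum_(V : {vspace M} | submod V)
      F (sub_dimvec U + sub_dimvec V) *+ #|fibre i p U V|.
Proof.
case: (se) => ih ph _ _ _.
rewrite (partition_big (fun W => ((i @^-1: W)%VS, (p @: W)%VS))
  (fun UV : {vspace N} * {vspace M} => submod UV.1 && submod UV.2)) /=; last first.
  by move=> W Ws; rewrite submod_preim // submod_img.
rewrite pair_big /=; apply: eq_bigr => -[U V] /= _.
rewrite -sumr_const; apply: eq_big => [W|W /andP[Ws /eqP[<- <-]]].
  by rewrite inE xpair_eqE.
by rewrite sub_dimvec_fibre.
Qed.

Section Models.
Variables (V' Z : qmod k Q) (j : 'Hom(V', M)) (q : 'Hom(N, Z)).
Hypotheses (jh : j \in homs V' M) (j0 : lker j = 0%VS).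
Hypotheses (qh : q \in homs N Z) (q1 : limg q = fullv).

Lemma post_pre_eq0 (h : {ffun arrow Q -> 'Hom(Z, V')}) : post j (pre h q) = 0 -> h = 0.
Proof.
move=> h0; apply: ffunlP => a x; have : x \in limg q by rewrite q1 memvf.
case/memv_imgP => y _ ->; have /lker0P := introT eqP j0; apply.
have /ffunP/(_ a)/lfunP/(_ y) := h0; rewrite postE preE !ffunE !lfE => ->.
by rewrite linear0.
Qed.

(** Without Ext^1(V', Z) there is no obstruction, and the dimension of Hom(V', Z) is the Euler form
    of V' and Z. The factor 2 appears because [qhalf] counts half powers. *)
Lemma card_fibre_free : dext V' Z = 0%VS ->
  (#|fibre i p (lker q) (limg j)|%:R : Zq k)
  = qhalf k (2 * chi Q (sub_dimvec (limg j)) (dimvec N - sub_dimvec (lker q))).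
Proof.
move=> D0; case: (se) => ih ph _ _ /eqP p1.
have [s sg ps] := graded_section ph p1.
have [z zc zE] := ext_cocycle_ex se sg ps.
have [_ h2] := fibre_neq0P se jh j0 qh q1 sg ps zc zE.
have [W WF] : exists W, W \in fibre i p (lker q) (limg j).
  by apply: h2 => h; rewrite D0 memv0 => /eqP ->; rewrite linear0 lfE.
rewrite (card_fibre se jh j0 qh q1 WF) qhalf_natX (dimvec_model jh j0).
by rewrite -(dimvec_quotient qh q1) -homs_dext_chi D0 dimv0 subr0.
Qed.

End Models.

(** D Ext^1(V, N/U) embeds into D Ext^1(M, N) by [post j] and [pre q], so it vanishes too. *)
Lemma card_fibre_dext0 (U : {vspace N}) (V : {vspace M}) :
  dext M N = 0%VS -> submod U -> submod V ->
  (#|fibre i p U V|%:R : Zq k)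
  = qhalf k (2 * chi Q (sub_dimvec V) (dimvec N - sub_dimvec U)).
Proof.
move=> MN0 /quotient_model[Z [q [qh q1 <-]]] /submod_model[V' [j [jh j0 <-]]].
apply: (card_fibre_free jh j0 qh q1); apply: vspace0P => h hD.
apply: (post_pre_eq0 j0 q1); apply/eqP; rewrite -memv0 -MN0.
exact: dext_post jh (dext_pre qh hD).
Qed.

(* If Ext^1(M, N) is spanned by the class of E, the class of E dies in
   Ext^1(V, N / U) only if that space, a quotient of Ext^1(M, N), vanishes. *)
Lemma fibre_dichotomy (g : {ffun arrow Q -> 'Hom(N, M)}) (U : {vspace N}) (V : {vspace M}) :
  ~ split_epi p -> \dim (dext M N) = 1%N -> g \in dext M N -> g <> 0 ->
  submod U -> submod V ->
  let linked := (forall a, U <= lker (g a))%VS /\ (forall a, limg (g a) <= V)%VS in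
  (linked -> fibre i p U V = set0) /\
  (~ linked -> (#|fibre i p U V|%:R : Zq k)
               = qhalf k (2 * chi Q (sub_dimvec V) (dimvec N - sub_dimvec U))).
Proof.
move=> nsplit dim1 gD gn0 Us Vs linked; case: (se) => ih ph _ _ /eqP p1.
have [s sg ps] := graded_section ph p1.
have [z zc zE] := ext_cocycle_ex se sg ps.
have [V' [j [jh j0 jE]]] := submod_model Vs.
have [Z [q [qh q1 qE]]] := quotient_model Us.
have mem_line h : h \in dext M N -> exists c, h = c *: g.
  have -> : dext M N = <[g]>%VS.
    apply/esym/eqP; rewrite eqEdim -memvE gD dim1 dim_vline.
    by case: eqP gn0.
  by case/vlineP => c ->; exists c.
have [h1 _] := fibre_neq0P se jh j0 qh q1 sg ps zc zE.
rewrite jE qE in h1.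
(* Otherwise all of [dext M N], being spanned by [g], would kill the class of [E], and the sequence
   would split. *)
have gz : tpair _ M N g z <> 0.
  move=> gz0; apply: nsplit.
  have [h /mem_line[c ->]|l lh lE] := ext_liftP se sg ps zc zE (homs_id M).
    rewrite (_ : pre z \1%VF = z) ?linearZ ?scale_lfunE ?gz0 ?scaler0 //.
    by apply: ffunlP => a x; rewrite preE lfE.
  by exists l.
split=> [[gU gV]|nlinked].
  (* A linked [g] comes from an element of D Ext^1(V, N/U); a member of the fibre would make that
     element kill the image of the class of [E], against [gz]. *)
  apply/setP => W; rewrite [RHS]inE; apply/negP => WF.
  have [|g1 g1D gE1] := dext_factor_inj jh j0 gD; first by rewrite jE.
  have j_inj : injective j by apply/lker0P; rewrite j0.
  have [|g2 g2D gE2] := dext_factor_surj qh q1 g1D.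
    move=> a; rewrite qE; apply/subvP => y /(subvP (gU a)); rewrite !memv_ker gE1 postE.
    by move=> /eqP e; apply/eqP/j_inj; rewrite e linear0.
  by apply: gz; rewrite gE1 gE2 tpair_post tpair_pre h1 //; exists W.
rewrite -jE -qE; apply: (card_fibre_free jh j0 qh q1); apply: vspace0P => h hD.
(* Any [h] in D Ext^1(V, N/U) gives a multiple [c *: g]. A nonzero [c] would make the pair linked,
   and [c = 0] forces [h = 0]. *)
have [c cE] := mem_line _ (dext_post jh (dext_pre qh hD)).
have cE' a y : j (h a (q y)) = c *: g a y.
  by have /ffunP/(_ a)/lfunP/(_ y) := cE; rewrite postE preE !ffunE lfE.
have [c0|cn0] := eqVneq c 0; first by apply: (post_pre_eq0 j0 q1); rewrite cE c0 scale0r.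
case: nlinked; split=> a.
  rewrite -qE; apply/subvP => y; rewrite !memv_ker => /eqP qy.
  have := cE' a y; rewrite qy !linear0 => /esym/eqP.
  by rewrite scaler_eq0 (negPf cn0).
apply/subvP => _ /memv_imgP[y _ ->].
have -> : g a y = c^-1 *: j (h a (q y)) by rewrite cE' scalerA mulVf ?scale1r.
by rewrite memvZ // -jE memv_img ?memvf.
Qed.

End FibreSum.

(** * The multiplication formula *)

Section Sums.
Variables (R : pzSemiRingType) (L : lSemiModType R) (I J : finType).

(** To be used with [f] the size of a fibre and [w] the twist from the product. These agree off the
    linked pairs, and on linked pairs the fibre is empty. *)
Lemma split_sum (P b : pred I) (P' b' : pred J) (f : I -> J -> nat) (w : I -> J -> R)
    (t : I -> J -> L) (l : R) :
  (forall i j, P i -> P' j -> b i && b' j -> f i j = 0%N) ->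
  (forall i j, P i -> P' j -> ~~ (b i && b' j) -> (f i j)%:R = w i j) ->
  \sum_(i | P i) \sum_(j | P' j) (l * w i j) *: t i j
  = l *: (\sum_(i | P i) \sum_(j | P' j) t i j *+ f i j)
    + l *: (\sum_(i | P i && b i) \sum_(j | P' j && b' j) w i j *: t i j).
Proof.
move=> f0 f1; rewrite -scalerDr big_mkcondr -big_split scaler_sumr /=.
apply: eq_bigr => i Pi.
have -> : (if b i then \sum_(j | P' j && b' j) w i j *: t i j else 0)
    = \sum_(j | P' j) if b i && b' j then w i j *: t i j else 0.
  by case: (b i) => /=; [rewrite big_mkcondr | rewrite big1].
rewrite -big_split scaler_sumr /=; apply: eq_bigr => j P'j; rewrite -scalerA; congr (l *: _).
have [bij|nbij] := boolP (b i && b' j); first by rewrite f0 // mulr0n add0r.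
by rewrite addr0 -f1 // scaler_nat.
Qed.

Lemma sum_mul_sum (A : nzRingType) (P : pred I) (P' : pred J) (x : I -> A) (y : J -> A)
    (z : I -> J -> A) : (forall i j, P i -> P' j -> x i * y j = z i j) ->
  (\sum_(i | P i) x i) * (\sum_(j | P' j) y j) = \sum_(i | P i) \sum_(j | P' j) z i j.
Proof.
move=> xyz; rewrite big_distrlr /=; apply: eq_bigr => i Pi; apply: eq_bigr => j P'j.
exact: xyz.
Qed.

End Sums.

Section Submodules.
Variables (k : finFieldType) (m : nat) (Q : quiver m) (L : nmodType).

Lemma sum_submod_img (X Y : qmod k Q) (d : 'Hom(X, Y)) (F : {vspace Y} -> L) :
  d \in homs X Y -> lker d = 0%VS ->
  \sum_(U : {vspace Y} | submod U && (U <= limg d)%VS) F U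
  = \sum_(U : {vspace X} | submod U) F (d @: U)%VS.
Proof.
move=> dh d0; have d_inj : injective d by apply/lker0P; rewrite d0.
have imK (U : {vspace X}) : (d @^-1: (d @: U))%VS = U.
  apply/vspaceP => x; rewrite -memv_preim.
  by apply/memv_imgP/idP => [[y yU /d_inj ->]|xU] //; exists x.
rewrite (reindex_onto (fun U : {vspace X} => (d @: U)%VS) (fun U => (d @^-1: U)%VS)) /=.
  apply: eq_bigl => U; rewrite imK eqxx andbT limgS ?subvf // andbT.
  apply/idP/idP => Us; last exact: submod_img.
  by rewrite -[U]imK submod_preim.
by move=> U /andP[_ Ud]; exact: lpreimK.
Qed.

Lemma sum_submod_preim (X Y : qmod k Q) (p : 'Hom(X, Y)) (F : {vspace X} -> L) :
  p \in homs X Y -> limg p = fullv ->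
  \sum_(V : {vspace X} | submod V && (lker p <= V)%VS) F V
  = \sum_(V : {vspace Y} | submod V) F (p @^-1: V)%VS.
Proof.
move=> ph p1; have imK (V : {vspace Y}) : (p @: (p @^-1: V))%VS = V.
  by rewrite lpreimK // p1 subvf.
rewrite (reindex_onto (fun V : {vspace Y} => (p @^-1: V)%VS) (fun V => (p @: V)%VS)) /=.
  apply: eq_bigl => V; rewrite imK eqxx andbT -lpreim0 lpreimS ?sub0v // andbT.
  apply/idP/idP => Vs; last exact: submod_preim.
  by rewrite -[V]imK submod_img.
move=> V /andP[_ kV]; apply/vspaceP => x; rewrite -memv_preim.
apply/memv_imgP/idP => [[y yV pxy]|xV]; last by exists x.
rewrite -[x](subrK y) rpredD // (subvP kV) // memv_ker linearB /= pxy subrr //.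
Qed.

Lemma sub_dimvec_preim (X Y : qmod k Q) (p : 'Hom(X, Y)) (V : {vspace Y}) :
  p \in homs X Y -> limg p = fullv -> submod V ->
  sub_dimvec (p @^-1: V)%VS = sub_dimvec (lker p) + sub_dimvec V.
Proof.
move=> ph p1 Vs; rewrite (sub_dimvec_img ph (submod_preim ph Vs)) lpreimK ?p1 ?subvf //.
by rewrite (capv_idPr _) // -lpreim0 lpreimS ?sub0v.
Qed.

(** A map from [U] to [I] extends to [X] and so vanishes, while Ext^1 into [I] is zero. *)
Lemma chi_injective_eq0 (X I : qmod k Q) (U : {vspace X}) :
  injective_mod I -> homs X I = 0%VS -> submod U ->
  chi Q (sub_dimvec U) (dimvec I) = 0.
Proof.
move=> Ii X0 Us; have [V [j [jh j0 <-]]] := submod_model Us.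
rewrite (dimvec_model jh j0) -homs_dext_chi injective_dext //.
have -> : homs V I = 0%VS; last by rewrite !dimv0.
apply: vspace0P => f fh; have [h hh <-] := Ii _ _ _ _ jh j0 fh.
by move: hh; rewrite X0 memv0 => /eqP ->; rewrite comp_lfun0l.
Qed.

Lemma top_dimvec_zero : top_dimvec (zero_mod k Q) = 0.
Proof.
apply/colP => i; rewrite !mxE.
have d0 (U : {vspace 'rV[k]_0}) : \dim U = 0%N.
  by apply/eqP; rewrite -leqn0; apply: leq_trans (dimvS (subvf U)) _; rewrite dimvf.
by rewrite !d0 subrr.
Qed.

End Submodules.

(** * Products of terms and comparison of exponents *)

Section TermProduct.
Variables (k : finFieldType) (m n : nat) (le_nm : (n <= m)%N) (Q : quiver m).
Hypothesis Q_acyclic : acyclic Q.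
Variable Lam : 'M[int]_m.
Hypotheses (Lam_skew : Lam^T = - Lam) (Lam_compat : Lam *m (- Bmx le_nm Q) = Imx m n).
Local Notation J := (Imx m n).
Local Notation T := (qtorus k Lam).

(** Skew-symmetry turns the compatibility condition into [J^T = B^T *m Lam], so the form against
    [B x] is a plain dot product. *)
Lemma qform_Bl (x : 'cV[int]_n) v : qform Lam (Bmx le_nm Q *m x) v = ((J *m x)^T *m v) 0 0.
Proof.
have JE : J^T = (Bmx le_nm Q)^T *m Lam.
  by rewrite -Lam_compat trmx_mul Lam_skew mulmxN [(- Bmx _ _)^T]linearN mulNmx opprK.
by rewrite /qform !trmx_mul JE !mulmxA.
Qed.

Lemma qform_Br (x : 'cV[int]_n) v :
  qform Lam v (Bmx le_nm Q *m x) = - (v^T *m (J *m x)) 0 0.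
Proof.
by rewrite /qform -Lam_compat mulmxN mulNmx mulmxN -!mulmxA [in RHS]mxE opprK.
Qed.

Lemma qtorus_mulZXX (a b : Zq k) e f :
  (a *: (Xpow k e : T)) * (b *: (Xpow k f : T))
  = (a * b * qhalf k (qform Lam e f)) *: (Xpow k (e + f) : T).
Proof. exact: tw_mulZXX. Qed.

Lemma eq_scale_Xpow (a b : Zq k) e f :
  a = b -> e = f -> a *: (Xpow k e : T) = b *: (Xpow k f : T).
Proof. by move=> -> ->. Qed.

Lemma qform_exponents (x y : 'cV[int]_n) (s t : 'cV[int]_m) :
  let u := J *m x in let v := J *m y in
  qform Lam (chil Q u - chir Q u - chil Q s) (chil Q v - chir Q v - chil Q t)
  = qform Lam (chil Q s) (chil Q t) + chi Q v (s - u) - chi Q u (t - v).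
Proof.
move=> u v.
have qformNl e f : qform Lam (- e) f = - qform Lam e f.
  by apply: (addrI (qform Lam e f)); rewrite -qformDl !subrr /qform trmx0 !mul0mx mxE.
have qformNr e f : qform Lam e (- f) = - qform Lam e f.
  by apply: (addrI (qform Lam e f)); rewrite -qformDr !subrr /qform mulmx0 mxE.
have uB : chil Q u - chir Q u = Bmx le_nm Q *m x by rewrite mul_B.
have vB : chil Q v - chir Q v = Bmx le_nm Q *m y by rewrite mul_B.
have formB (a b c : 'cV[int]_m) :
    (a^T *m (b - c)) 0 0 = (a^T *m b) 0 0 - (a^T *m c) 0 0.
  by rewrite mulmxBr [LHS]mxE; congr (_ + _); rewrite mxE.
have formC (a b : 'cV[int]_m) : (a^T *m b) 0 0 = (b^T *m a) 0 0.
  by rewrite !mxE; apply: eq_bigr => i _; rewrite !mxE mulrC.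
rewrite uB vB qformDl !qformDr !qformNl !qformNr !qform_Bl qform_Br -vB formB.
rewrite (formC (chil Q s)) !chil_form chir_form !chiBr; ring.
Qed.

(** With [s] the dimension of [N] and [u], [v] those of [U], [V], the second factor is q^<V, N/U>,
    the size of an unobstructed fibre. The first factor does not depend on the pair. *)
Lemma CCterm_mul (x y : 'cV[int]_n) (s t : 'cV[int]_m) :
  let u := J *m x in let v := J *m y in
  CCterm k Q Lam u s 0 * CCterm k Q Lam v t 0
  = (qhalf k (qform Lam (chil Q s) (chil Q t)) * qhalf k (2 * chi Q v (s - u)))
      *: CCterm k Q Lam (u + v) (s + t) 0.
Proof.
move=> u v; apply: etrans (qtorus_mulZXX _ _ _ _) _.
apply: etrans _ (esym (scalerA _ _ _)).
apply: eq_scale_Xpow; last by apply/colP => i; rewrite !addr0 !chilD chirD !mxE; ring.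
rewrite !addr0 -!qhalfD qform_exponents; congr (qhalf k _).
by rewrite -/u -/v !(chiDl, chiDr, chiNl, chiNr, chiBl, chiBr); ring.
Qed.

End TermProduct.

Section LinkedTerms.
Variables (k : finFieldType) (m : nat) (Q : quiver m) (Lam : 'M[int]_m).

(** Here [u], [v] belong to submodules of modules of dimension [d], [a]; taking preimages replaces
    [v] by [kap + v]. By the first hypothesis the exponents of q differ by <u, I> - <v, I> + <a, I>,
    which is zero. The same hypothesis at unit vectors accounts for [top] in the exponent of X. *)
Lemma CCterm_linked (u v d a kap iota I top : 'cV[int]_m) :
  (forall x, chi Q x iota = - chi Q kap x - chi Q x I) ->
  (forall i, top i 0 = chi Q (delta_mx i 0) I) ->
  chi Q u I = 0 -> chi Q v I = 0 -> chi Q a I = 0 ->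
  qhalf k (2 * chi Q (kap + v) (d + iota - u))
    *: CCterm k Q Lam (u + (kap + v)) (d + iota + (a + kap)) 0
  = qhalf k (chi Q (a + kap) (d + iota) - chi Q a d)
    *: (qhalf k (2 * chi Q v (d - u)) *: CCterm k Q Lam (u + v) (d + a) top).
Proof.
move=> h topE uI vI aI; apply: etrans (scalerA _ _ _) _; symmetry.
apply: etrans (scalerA _ _ _) _; apply: etrans (scalerA _ _ _) _; apply: eq_scale_Xpow.
  rewrite -!qhalfD; congr (qhalf k _).
  rewrite !(chiDl, chiDr, chiNl, chiNr, chiBl, chiBr) !h uI vI aI.
  by ring.
apply/colP => i; have hi := h (delta_mx i 0).
rewrite !chilD !chirD !mxE topE hi; ring.
Qed.

End LinkedTerms.

Lemma sum_submod_img_preim (k : finFieldType) m (Q : quiver m) (L : nmodType)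
    (D N M A : qmod k Q) (d : 'Hom(D, N)) (psi : 'Hom(M, A))
    (F : {vspace N} -> {vspace M} -> L) :
  d \in homs D N -> lker d = 0%VS -> psi \in homs M A -> limg psi = fullv ->
  \sum_(U : {vspace N} | submod U && (U <= limg d)%VS)
    \sum_(V : {vspace M} | submod V && (lker psi <= V)%VS) F U V
  = \sum_(U : {vspace D} | submod U) \sum_(V : {vspace A} | submod V)
      F (d @: U)%VS (psi @^-1: V)%VS.
Proof.
move=> dh d0 ph p1; rewrite (sum_submod_img _ dh d0); apply: eq_bigr => U _.
exact: (sum_submod_preim _ ph p1).
Qed.

Lemma eq_scale_sum (R : pzSemiRingType) (L : lSemiModType R) (I J : finType) (P : pred I)
    (P' : pred J) (x y : I -> J -> L) (c : R) :
  (forall i j, P i -> P' j -> x i j = c *: y i j) ->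
  \sum_(i | P i) \sum_(j | P' j) x i j = c *: \sum_(i | P i) \sum_(j | P' j) y i j.
Proof.
move=> xy; rewrite scaler_sumr; apply: eq_bigr => i Pi; rewrite scaler_sumr.
by apply: eq_bigr => j P'j; exact: xy.
Qed.

Lemma unfrozen_inj (k : finFieldType) m n (Q : quiver m) (X Y : qmod k Q) (f : 'Hom(X, Y)) :
  f \in homs X Y -> lker f = 0%VS -> unfrozen n Y -> unfrozen n X.
Proof.
move=> fh f0 Yu i le; have f_inj : injective f by apply/lker0P; rewrite f0.
by apply/lfunP => x; apply: f_inj; rewrite (homs_vtx _ _ fh) Yu // !lfE linear0.
Qed.

Lemma unfrozen_surj (k : finFieldType) m n (Q : quiver m) (X Y : qmod k Q) (f : 'Hom(X, Y)) :
  f \in homs X Y -> limg f = fullv -> unfrozen n X -> unfrozen n Y.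
Proof.
move=> fh f1 Xu i le; apply/lfunP => y.
have : y \in limg f by rewrite f1 memvf.
by case/memv_imgP => x _ ->; rewrite -(homs_vtx _ _ fh) Xu // !lfE linear0.
Qed.

Lemma unfrozen_ext (k : finFieldType) m n (Q : quiver m) (N E M : qmod k Q)
    (i : 'Hom(N, E)) (p : 'Hom(E, M)) :
  short_exact i p -> unfrozen n N -> unfrozen n M -> unfrozen n E.
Proof.
case=> ih ph _ /eqP ip _ Nu Mu l le; apply/lfunP => x; rewrite lfE -vtx_id.
have : vtx E l x \in limg i by rewrite ip memv_ker (homs_vtx _ _ ph) Mu // lfE.
by case/memv_imgP => y _ ->; rewrite -(homs_vtx _ _ ih) Nu // lfE linear0.
Qed.

Theorem theorem3p5
  (k : finFieldType) (m n : nat) (n_gt0 : (0 < n)%N) (le_nm : (n <= m)%N)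
  (Q : quiver m) (Q_acyclic : acyclic Q)
  (Lam : 'M[int]_m) (Lam_skew : Lam^T = - Lam)
  (Lam_compat : Lam *m (- Bmx le_nm Q) = Imx m n)
  (M N : qmod k Q) (M_unfrozen : unfrozen n M) (N_unfrozen : unfrozen n N)
  (tauM : qmod k Q) (tauM_def : is_tau M tauM)
  (ext_MN : dim_ext1 M N = 1%N) (hom_NtauM : \dim (homs N tauM) = 1%N)
  (* 0 -> N -> E -> M -> 0, not split *)
  (E : qmod k Q) (i : 'Hom(N, E)) (p : 'Hom(E, M))
  (NEM_exact : short_exact i p) (NEM_nonsplit : ~ split_epi p)
  (* 0 -> D0 -> N -> tau M -> tau A + I -> 0 *)
  (D0 A tauA I : qmod k Q)
  (I_injective : injective_mod I)
  (A_no_proj : no_projective_summand A) (tauA_def : is_tau A tauA)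
  (d : 'Hom(D0, N)) (f : 'Hom(N, tauM)) (c : 'Hom(tauM, dsum tauA I))
  (d_hom : d \in homs D0 N) (f_hom : f \in homs N tauM)
  (c_hom : c \in homs tauM (dsum tauA I))
  (f_neq0 : f != 0)
  (d_inj : lker d = 0%VS) (exact_N : exact_at d f) (exact_tauM : exact_at f c)
  (c_surj : limg c = fullv)
  (* M = M' + P0, A0 = A + P0 *)
  (M' P0 : qmod k Q) (M_split : qiso M (dsum M' P0))
  (P0_projective : projective P0) (M'_no_proj : no_projective_summand M')
  (A0 : qmod k Q) (A0_def : A0 = dsum A P0)
  (tauA0 : qmod k Q) (tauA0_def : is_tau A0 tauA0)
  (hom_D0 : homs D0 (dsum tauA0 I) = 0%VS) (hom_A0 : homs A0 I = 0%VS)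
  (* I[-1] = P[1] *)
  (P : qmod k Q) (P_projective : projective P) (P_soc : top_iso_soc P I) :
  let lam : int := qform Lam ((Imx m n - Rmx k le_nm Q) *m udimvec le_nm N)
                             ((Imx m n - Rmx k le_nm Q) *m udimvec le_nm M) in
  CC le_nm Lam N * CC le_nm Lam M
  = qhalf k lam *: CC le_nm Lam E
    + qhalf k (lam + euler M N - euler A0 D0) *: CCshift le_nm Lam (dsum D0 A0) P.
Proof.
have Mc := tau_covered tauM_def; have A0c := tau_covered tauA0_def.
have [g [psi [[gD gn0 psih psi1] gU gV chi_iota]]] :=
  exchange_structure Q_acyclic tauM_def tauA_def I_injective A_no_proj d_hom f_hom
    c_hom f_neq0 d_inj exact_N exact_tauM c_surj M_split P0_projective M'_no_proj.
rewrite -A0_def in psi psih psi1 gV chi_iota.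
have D0u := unfrozen_inj d_hom d_inj N_unfrozen.
have A0u := unfrozen_surj psih psi1 M_unfrozen.
have Eu := unfrozen_ext NEM_exact N_unfrozen M_unfrozen.
have DAu := unfrozen_ext (dsum_short_exact D0 A0) D0u A0u.
have D0_tauA0 : homs D0 tauA0 = 0%VS.
  apply: vspace0P => h hh; have := homs_comp (dsum_inl_hom tauA0 I) hh.
  rewrite hom_D0 memv0 => /eqP/lfunP h0; apply/lfunP => x; have := h0 x.
  by rewrite !lfE dsum_inlE => -[].
have D0_I : homs D0 I = 0%VS.
  apply: vspace0P => h hh; have := homs_comp (dsum_inr_hom tauA0 I) hh.
  rewrite hom_D0 memv0 => /eqP/lfunP h0; apply/lfunP => x; have := h0 x.
  by rewrite !lfE dsum_inrE => -[].
(* The Auslander-Reiten formula: Hom(D0, tau A0) and D Ext^1(A0, D0) have the same dimension. *)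
have extA0D0 : dext A0 D0 = 0%VS.
  have [u ur] := tau_represents Q_acyclic tauA0_def.
  by apply/eqP; rewrite -dimv_eq0 -(represents_dim _ ur) D0_tauA0 dimv0.
have ext1 : \dim (dext M N) = 1%N by rewrite -dim_ext1E.
have EE : dimvec E = dimvec N + dimvec M := dimvec_short_exact NEM_exact.
move=> lam.
have lamE : lam = qform Lam (chil Q (dimvec N)) (chil Q (dimvec M)).
  by rewrite /lam !mul_IR // !Imx_udimvec.
pose tM := dimvec M; pose tN := dimvec N; pose a := dimvec A0; pose d0 := dimvec D0.
(* [kap] is dim M - dim A0, and [iota] is the dimension vector of the image of [f]. *)
pose kap := sub_dimvec (lker psi); pose iota := tN - d0; pose s := top_dimvec P.
have MK : tM = a + kap by rewrite addrC /tM (dimvec_ker_img psih) psi1.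
have NK : tN = d0 + iota by rewrite addrC subrK.
have chi_iota' x : chi Q x iota = - chi Q kap x - chi Q x (dimvec I).
  by rewrite chi_iota -/tM MK [a + _]addrC addrK.
have sE l : s l 0 = chi Q (delta_mx l 0) (dimvec I).
  exact: (top_dimvecE Q_acyclic l P_soc I_injective).
have aI : chi Q a (dimvec I) = 0 := chi_injective_eq0 I_injective hom_A0 (submod_full A0).
have eMN : euler M N = chi Q tM tN by rewrite eulerE.
have eAD : euler A0 D0 = chi Q a d0 by rewrite eulerE.
have CC0 (X : qmod k Q) : unfrozen n X -> CC le_nm Lam X =
    \sum_(U : {vspace X} | submod U) CCterm k Q Lam (sub_dimvec U) (dimvec X) 0.
  move=> Xu; have := CCshift_sum le_nm Q_acyclic Lam (zero_mod k Q) Xu.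
  rewrite top_dimvec_zero; exact.
have prodE : CC le_nm Lam N * CC le_nm Lam M =
    \sum_(U : {vspace N} | submod U) \sum_(V : {vspace M} | submod V)
      (qhalf k lam * qhalf k (2 * chi Q (sub_dimvec V) (tN - sub_dimvec U)))
        *: CCterm k Q Lam (sub_dimvec U + sub_dimvec V) (tN + tM) 0.
  rewrite (CC0 N) // (CC0 M) //; apply: sum_mul_sum => U V _ _; rewrite lamE.
  (* [CCterm_mul] asks for vectors of the form [J y]; those of submodules of [N] and [M] qualify,
     being zero at frozen vertices. *)
  have /Imx_col uE (l : 'I_m) : (n <= l)%N -> sub_dimvec U l 0 = 0.
    exact: sub_dimvec_frozen.
  have /Imx_col vE (l : 'I_m) : (n <= l)%N -> sub_dimvec V l 0 = 0.
    exact: sub_dimvec_frozen.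
  rewrite -(uE le_nm) -(vE le_nm); exact: CCterm_mul.
have EsumE : CC le_nm Lam E =
    \sum_(U : {vspace N} | submod U) \sum_(V : {vspace M} | submod V)
      CCterm k Q Lam (sub_dimvec U + sub_dimvec V) (tN + tM) 0 *+ #|fibre i p U V|.
  rewrite (CC0 E) // EE.
  exact: (sum_fibres NEM_exact (fun e => CCterm k Q Lam e (tN + tM) 0)).
pose b1 (U : {vspace N}) := (U <= limg d)%VS; pose b2 (V : {vspace M}) := (lker psi <= V)%VS.
have dich U V : submod U -> submod V ->
    (b1 U && b2 V -> #|fibre i p U V| = 0%N) /\
    (~~ (b1 U && b2 V) -> (#|fibre i p U V|%:R : Zq k)
        = qhalf k (2 * chi Q (sub_dimvec V) (tN - sub_dimvec U))).
  move=> Us Vs; have [h1 h2] := fibre_dichotomy NEM_exact NEM_nonsplit ext1 gD gn0 Us Vs.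
  have [gU1 gU2] := gU U Us; have [gV1 gV2] := gV V Vs.
  split=> [/andP[bU bV]|/negP nb].
    by rewrite h1 ?cards0 //; split; [exact: gU2 | exact: gV2].
  apply: h2 => -[lU lV]; apply: nb; apply/andP; split; [exact: gU1|exact: gV1].
have DAE : CCshift le_nm Lam (dsum D0 A0) P =
    \sum_(U : {vspace D0} | submod U) \sum_(V : {vspace A0} | submod V)
      CCterm k Q Lam (sub_dimvec U + sub_dimvec V) (d0 + a) s
        *+ #|fibre (dsum_inl D0 A0) (dsum_snd D0 A0) U V|.
  have := CCshift_sum le_nm Q_acyclic Lam P DAu; rewrite dimvec_dsum => ->.
  exact: (sum_fibres (dsum_short_exact D0 A0) (fun e => CCterm k Q Lam e (d0 + a) s)).
(* Linked pairs are reindexed by submodules of [D0] and [A0]. As Ext^1(A0, D0) = 0, each such pair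
   also has a fibre of known size in the split extension, which matches the sum for [dsum D0 A0]. *)
have linkedE :
    \sum_(U : {vspace N} | submod U && b1 U) \sum_(V : {vspace M} | submod V && b2 V)
      qhalf k (2 * chi Q (sub_dimvec V) (tN - sub_dimvec U))
        *: CCterm k Q Lam (sub_dimvec U + sub_dimvec V) (tN + tM) 0
    = qhalf k (chi Q tM tN - chi Q a d0) *: CCshift le_nm Lam (dsum D0 A0) P.
  rewrite DAE; apply: etrans (sum_submod_img_preim _ d_hom d_inj psih psi1) _.
  apply: eq_scale_sum => U V Us Vs.
  have uI : chi Q (sub_dimvec U) (dimvec I) = 0 := chi_injective_eq0 I_injective D0_I Us.
  have vI : chi Q (sub_dimvec V) (dimvec I) = 0 := chi_injective_eq0 I_injective hom_A0 Vs.
  rewrite -scaler_nat (card_fibre_dext0 (dsum_short_exact D0 A0) extA0D0 Us Vs).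
  rewrite (sub_dimvec_inj_img d_hom Us d_inj) (sub_dimvec_preim psih psi1 Vs) NK MK.
  exact: CCterm_linked.
rewrite prodE EsumE.
rewrite (split_sum (b := b1) (b' := b2) (f := fun U V => #|fibre i p U V|)); last first.
- by move=> U V Us Vs; exact: (dich U V Us Vs).2.
- by move=> U V Us Vs; exact: (dich U V Us Vs).1.
have -> : qhalf k (lam + euler M N - euler A0 D0)
    = qhalf k lam * qhalf k (chi Q tM tN - chi Q a d0).
  by rewrite eMN eAD -qhalfD; congr (qhalf k _); ring.
by rewrite linkedE [_ *: (_ *: CCshift _ _ _ _)]scalerA.
Qed.
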